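(* Let $n\ge 1$ be an integer, let $0<\alpha<1$, and let $\psi:\mathbb{R}_+\to\mathbb{R}$ be such that the vector field $b(x)=-\frac{x}{|x|}\psi(|x|)$ belongs to $C^{\alpha}(\mathbb{R}^n)$ and $$\limsup_{r\to\infty}\frac{1}{\log r}\int_0^r\max\{\psi(\rho),0\}\,d\rho<n.$$ Let $u_0\in C^{2+\alpha}(\mathbb{R}^n)\cap L^1(\mathbb{R}^n)$ satisfy $u_0\ge 0$ and $u_0\not\equiv 0$, and assume in addition that $u_0$ is rotationally symmetric and monotonically decreasing in radial direction. Then there is a unique positive solution $u\in C^{2+\alpha,\,1+\alpha/2}(\mathbb{R}^n\times\mathbb{R}_+)$ of $$\begin{cases}\dot u=\Delta u-\left\langle\frac{x}{|x|}\psi(|x|),\,\nabla u\right\rangle&\text{in }\mathbb{R}^n\times\mathbb{R}_+,\\ u(\cdot,0)=u_0&\text{in }\mathbb{R}^n,\end{cases}$$ and this $u$ is rotationally symmetric (in $x$, for every $t$) and satisfies $$\lim_{t\to\infty}\sup_{x\in\mathbb{R}^n}u(x,t)=0.$$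
   Context: $\mathbb{R}_+=[0,\infty)$; $\dot u$ denotes the time derivative, and $\Delta$, $\nabla$ are taken in the spatial variable $x\in\mathbb{R}^n$. $C^{\alpha}(\mathbb{R}^n)$ denotes the space of uniformly bounded functions (or vector fields) on $\mathbb{R}^n$ having bounded Hölder semi-norm with exponent $\alpha$; the vector field $b(x)=-\frac{x}{|x|}\psi(|x|)$ is understood as extended continuously to $x=0$. $C^{2+\alpha}(\mathbb{R}^n)$ denotes the functions that are bounded together with their derivatives up to order two, and whose second derivatives have bounded Hölder semi-norm with exponent $\alpha$. $C^{2+\alpha,1+\alpha/2}(\mathbb{R}^n\times\mathbb{R}_+)$ is the corresponding parabolic Hölder space: $u$, $\nabla u$, $D^2u$, $\dot u$ are uniformly bounded on $\mathbb{R}^n\times\mathbb{R}_+$, and $D^2u$, $\dot u$ have globally bounded Hölder semi-norm with exponent $\alpha$ in $x$ and $\alpha/2$ in $t$. A function $f$ on $\mathbb{R}^n$ is rotationally symmetric if $f(Rx)=f(x)$ for all orthogonal $R$ and all $x$; it is monotonically decreasing in radial direction if $[0,\infty)\ni\lambda\mapsto f(\lambda x)$ is monotonically decreasing (not necessarily strictly) for every $x\in\mathbb{R}^n$. A positive solution means a solution with $u(x,t)>0$ for all $x\in\mathbb{R}^n$, $t>0$. *)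

(* Defs.v *)
From HB Require Import structures.
From mathcomp Require Import all_boot all_order all_algebra.
From mathcomp Require Import all_classical all_reals all_analysis.

Set Implicit Arguments.
Unset Strict Implicit.
Unset Printing Implicit Defensive.

Import Order.TTheory GRing.Theory Num.Theory.
Import numFieldNormedType.Exports.

Local Open Scope classical_set_scope.
Local Open Scope ring_scope.

(* The library norm on 'rV[R]_n is the sup norm, hence this explicit Euclidean
   structure. *)
Definition edot (R : realType) (n : nat) (x y : 'rV[R]_n) : R :=
  \sum_(i < n) x 0 i * y 0 i.

Definition enorm (R : realType) (n : nat) (x : 'rV[R]_n) : R :=
  Num.sqrt (edot x x).

(* Points are row vectors, so a matrix acts on them from the right. *)
Definition orthogonal_mx (R : realType) (n : nat) (Q : 'M[R]_n) : Prop :=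
  Q *m Q^T = 1%:M.

Definition rotationally_symmetric (R : realType) (n : nat)
    (f : 'rV[R]_n -> R) : Prop :=
  forall Q : 'M[R]_n, orthogonal_mx Q -> forall x, f (x *m Q) = f x.

Definition radially_decreasing (R : realType) (n : nat)
    (f : 'rV[R]_n -> R) : Prop :=
  forall (x : 'rV[R]_n) (l m : R), 0 <= l -> l <= m -> f (m *: x) <= f (l *: x).

Definition is_sigma_finite_measure (R : realType) (d : measure_display)
    (T : measurableType d) (mu : set T -> \bar R) : Prop :=
  exists nu : {sigma_finite_measure set T -> \bar R}, mu = nu.

Section SigmaFinitePack.
Variables (R : realType) (d : measure_display) (T : measurableType d).
Variables (mu : {measure set T -> \bar R}) (smu : sigma_finite setT mu).

Definition sf_pack (_ : sigma_finite setT mu) : set T -> \bar R := mu.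
HB.instance Definition _ := Measure.on (sf_pack smu).
HB.instance Definition _ := Measure_isSigmaFinite.Build _ _ _ (sf_pack smu) smu.

Lemma sigma_finite_measure_of : is_sigma_finite_measure mu.
Proof. by exists (sf_pack smu). Qed.

End SigmaFinitePack.

(* The library has this fact, but the resulting instance
   is not found by inference. *)
Section ProductSigmaFinite.
Local Open Scope ereal_scope.
Variables (R : realType) (d1 d2 : measure_display).
Variables (T1 : measurableType d1) (T2 : measurableType d2).
Variable m1 : {sigma_finite_measure set T1 -> \bar R}.
Variable m2 : {sigma_finite_measure set T2 -> \bar R}.

Lemma sigma_finite_product : sigma_finite setT (m1 \x m2).
Proof.
have /sigma_finiteP[F [TF ndF Foo]] := sigma_finiteT m1.
have /sigma_finiteP[G [TG ndG Goo]] := sigma_finiteT m2.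
exists (fun k => F k `*` G k); last first.
  move=> k; have [? ?] := Foo k; have [? ?] := Goo k.
  split; first exact: measurableX.
  by rewrite product_measure1E// lte_mul_pinfty// ge0_fin_numE.
rewrite -setXTT TF TG predeqE => -[x y]; split.
  move=> [/= [n _ Fnx] [k _ Gky]]; exists (maxn n k) => //; split.
  - by move: x Fnx; exact/subsetPset/ndF/leq_maxl.
  - by move: y Gky; exact/subsetPset/ndG/leq_maxr.
by move=> [n _ []/= ? ?]; split; exists n.
Qed.

End ProductSigmaFinite.

Section LebesgueTuple.
Variable R : realType.
Local Open Scope ereal_scope.
Local Notation mR := (measurableTypeR R).
Local Notation lambda := (@lebesgue_measure R).

Definition tuple_cons (n : nat) (p : mR * n.-tuple mR) : n.+1.-tuple mR :=
  [tuple of p.1 :: p.2].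

(* Lebesgue measure on R^n, for the product sigma-algebra of n.-tuple. *)
Fixpoint lebesgue_tuple (n : nat) : set (n.-tuple mR) -> \bar R :=
  match n with
  | 0 => \d_ [tuple]
  | m.+1 => pushforward (lambda \x @lebesgue_tuple m) (@tuple_cons m)
  end.

Let measurable_tuple_cons n : measurable_fun setT (@tuple_cons n).
Proof. by apply: measurable_cons. Qed.

Let tuple_uncons (n : nat) (t : n.+1.-tuple mR) : mR * n.-tuple mR :=
  (tnth t ord0, [tuple of behead t]).

Let measurable_tuple_uncons n : measurable_fun setT (@tuple_uncons n).
Proof.
by apply/measurable_fun_pair; [exact: measurable_tnth|exact: measurable_behead].
Qed.

Let tuple_consK n : cancel (@tuple_cons n) (@tuple_uncons n).
Proof.
move=> [x t]; rewrite /tuple_uncons /tuple_cons; congr pair.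
exact: val_inj.
Qed.

Let lebesgue_tuple_is_measure n : is_sigma_finite_measure (@lebesgue_tuple n).
Proof.
elim: n => [|n [nu /= ->]].
  by exists (\d_ [tuple]).
pose mu : {measure set (n.+1.-tuple mR) -> \bar R} :=
  @measure_function_pushforward__canonical__measure_function_Measure _ _ _ _ _
     (lambda \x nu) _ (@measurable_tuple_cons n).
apply: (@sigma_finite_measure_of _ _ _ mu).
have [F FT Ffin] : sigma_finite setT (lambda \x nu) by exact: sigma_finite_product.
exists (fun i => @tuple_uncons n @^-1` F i).
  by rewrite -preimage_bigcup -FT preimage_setT.
move=> i; have [mF Foo] := Ffin i; split.
  by rewrite -[X in measurable X]setTI; exact: measurable_tuple_uncons.
rewrite /mu /= /pushforward -comp_preimage (_ : _ \o _ = id) //.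
by apply/funext => p /=; rewrite tuple_consK.
Qed.

Let lebesgue_tuple0 n : @lebesgue_tuple n set0 = 0.
Proof. by have [nu ->] := lebesgue_tuple_is_measure n. Qed.

Let lebesgue_tuple_ge0 n A : 0 <= @lebesgue_tuple n A.
Proof. by have [nu ->] := lebesgue_tuple_is_measure n. Qed.

Let lebesgue_tuple_sigma_additive n : semi_sigma_additive (@lebesgue_tuple n).
Proof.
have [nu ->] := lebesgue_tuple_is_measure n.
exact: measure_semi_sigma_additive.
Qed.

Let lebesgue_tuple_sigma_finite n : sigma_finite setT (@lebesgue_tuple n).
Proof. by have [nu ->] := lebesgue_tuple_is_measure n; exact: sigma_finiteT. Qed.

HB.instance Definition _ n := isMeasure.Build _ _ _ (@lebesgue_tuple n)
  (@lebesgue_tuple0 n) (@lebesgue_tuple_ge0 n) (@lebesgue_tuple_sigma_additive n).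

HB.instance Definition _ n := Measure_isSigmaFinite.Build _ _ _
  (@lebesgue_tuple n) (@lebesgue_tuple_sigma_finite n).

End LebesgueTuple.

Definition L1 (R : realType) (n : nat) (f : 'rV[R]_n -> R) : Prop :=
  (@lebesgue_tuple R n).-integrable setT
    (fun t : n.-tuple (measurableTypeR R) => (f (\row_i tnth t i))%:E).

Definition partial (R : realType) (n : nat) (i : 'I_n) (f : 'rV[R]_n -> R) :
    'rV[R]_n -> R :=
  fun x => 'D_(delta_mx 0 i) f x.

Definition has_partials (R : realType) (n : nat) (f : 'rV[R]_n -> R) : Prop :=
  forall (i : 'I_n) (x : 'rV[R]_n), derivable f x (delta_mx 0 i).

Definition has_partials2 (R : realType) (n : nat) (f : 'rV[R]_n -> R) : Prop :=
  has_partials f /\ forall i : 'I_n, has_partials (partial i f).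

Definition gradient (R : realType) (n : nat) (f : 'rV[R]_n -> R)
    (x : 'rV[R]_n) : 'rV[R]_n :=
  \row_i partial i f x.

Definition laplacian (R : realType) (n : nat) (f : 'rV[R]_n -> R)
    (x : 'rV[R]_n) : R :=
  \sum_(i < n) partial i (partial i f) x.

Definition bounded_space (R : realType) (n : nat) (f : 'rV[R]_n -> R) : Prop :=
  exists M : R, forall x, `|f x| <= M.

Definition holder_space (R : realType) (n : nat) (alpha : R)
    (f : 'rV[R]_n -> R) : Prop :=
  exists M : R, forall x y, `|f x - f y| <= M * enorm (x - y) `^ alpha.

Definition C_alpha_field (R : realType) (n : nat) (alpha : R)
    (b : 'rV[R]_n -> 'rV[R]_n) : Prop :=
  bounded_space (fun x => enorm (b x)) /\
  exists M : R, forall x y, enorm (b x - b y) <= M * enorm (x - y) `^ alpha.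

(* The derivatives are classical partial derivatives.  Continuity of f and of
   its first and second partials is not listed: the Hoelder bound makes the
   second partials continuous, whence the first partials and f are C^1. *)
Definition C_2alpha (R : realType) (n : nat) (alpha : R)
    (f : 'rV[R]_n -> R) : Prop :=
  [/\ has_partials2 f,
      bounded_space f,
      forall i, bounded_space (partial i f),
      forall i j, bounded_space (partial j (partial i f)) &
      forall i j, holder_space alpha (partial j (partial i f))].

(* Functions on R^n x [0, +oo[ are represented by u : 'rV[R]_n -> R -> R, of
   which only the values u x t with 0 <= t matter.  The increment h ranges over
   0 <= t + h, so that the time derivative at t = 0 is one-sided. *)
Definition time_quotient (R : realType) (n : nat) (u : 'rV[R]_n -> R -> R)
    (x : 'rV[R]_n) (t : R) : set_system R :=
  (h^-1 * (u x (t + h) - u x t)) @[h --> within [set h | 0 <= t + h] 0^'].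

Definition time_derivable (R : realType) (n : nat) (u : 'rV[R]_n -> R -> R)
    (x : 'rV[R]_n) (t : R) : Prop :=
  cvg (time_quotient u x t).

Definition dtime (R : realType) (n : nat) (u : 'rV[R]_n -> R -> R)
    (x : 'rV[R]_n) (t : R) : R :=
  lim (time_quotient u x t).

Definition bounded_spacetime (R : realType) (n : nat)
    (v : 'rV[R]_n -> R -> R) : Prop :=
  exists M : R, forall x t, 0 <= t -> `|v x t| <= M.

Definition holder_spacetime (R : realType) (n : nat) (alpha : R)
    (v : 'rV[R]_n -> R -> R) : Prop :=
  exists M : R, forall x y s t, 0 <= s -> 0 <= t ->
    `|v x s - v y t| <=
      M * (enorm (x - y) `^ alpha + `|s - t| `^ (alpha / 2)).

Definition C_2alpha_parabolic (R : realType) (n : nat) (alpha : R)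
    (u : 'rV[R]_n -> R -> R) : Prop :=
  [/\ forall t, 0 <= t -> has_partials2 (u^~ t),
      forall x t, 0 <= t -> time_derivable u x t,
      [/\ bounded_spacetime u,
          forall i, bounded_spacetime (fun x t => partial i (u^~ t) x),
          forall i j,
            bounded_spacetime (fun x t => partial j (partial i (u^~ t)) x) &
          bounded_spacetime (dtime u)],
      forall i j,
        holder_spacetime alpha (fun x t => partial j (partial i (u^~ t)) x) &
      holder_spacetime alpha (dtime u)].

Definition positive_solution (R : realType) (n : nat) (alpha : R)
    (b : 'rV[R]_n -> 'rV[R]_n) (u0 : 'rV[R]_n -> R)
    (u : 'rV[R]_n -> R -> R) : Prop :=
  [/\ C_2alpha_parabolic alpha u,
      forall x t, 0 <= t ->
        dtime u x t = laplacian (u^~ t) x + edot (b x) (gradient (u^~ t) x),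
      forall x, u x 0 = u0 x &
      forall x t, 0 < t -> 0 < u x t].

(* limsup_(r -> +oo) (1 / log r) \int_0^r max(psi, 0) *)
Definition log_mean_limsup (R : realType) (psi : R -> R) : \bar R :=
  limf_esup (fun r : R => (ln r)^-1%:E *
    \int[@lebesgue_measure R]_(rho in `[0%R, r]) (Num.max (psi rho) 0%R)%:E)%E
    (pinfty_nbhs R).

(* Main.v *)
Require Import Defs.
From mathcomp Require Import all_boot all_order all_algebra.
From mathcomp Require Import all_classical all_reals all_analysis.
From mathcomp Require Import measurable_realfun ring lra.

Set Implicit Arguments.
Unset Strict Implicit.
Unset Printing Implicit Defensive.

Import Order.TTheory GRing.Theory Num.Theory.
Import numFieldNormedType.Exports.

Local Open Scope classical_set_scope.
Local Open Scope ring_scope.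

(* A radial solution U(|x|, t) comes from an explicit finite difference scheme, which is
   a random walk on the nodes (i + 1/2) h.  Reflection coupling bounds its moduli of
   continuity uniformly in h; as the drift does not depend on time, the generator applied
   to the iterates follows the same scheme, which controls U_t.  Since U_r / r is a
   weighted average of U_rr + (n - 1) U_r / r, second derivatives are controlled as well,
   and h tends to 0 along an ultrafilter.  Uniqueness is a maximum principle on R^n, and
   positivity follows by comparison with eps e^(-Kt) (rho + c t - |x - x0|^2)_+^2.

   For the decay, U is radially decreasing, so the mass of U on [0, r] for the weight
   r^(n - 1) exp (- \int_0^r psi_+) cannot increase in time.  The growth condition makes
   the total weight infinite, whence sup_t U(r, t) -> 0 as r -> oo.  If the maximum
   U(0, t) stayed above some l > 0, then U(0, t) - u would be bounded below far from the
   origin, and the spreading of positivity would make the maximum drop by a fixed amount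
   during each unit of time. *)

(** * Powers with exponent in (0, 1) *)

(** The drift is only Hölder, so no derivative of a coefficient may be used; radial symmetry leaves
    [m / r], with [m = n - 1], as the only singular coefficient. On half-integer nodes,
    [dif u i.+1 / h] is a slope at the edge [(i + 1) h > 0], where division by the radius is
    harmless. [W = U_r / r] is kept as an unknown of its own because the Hessian of a radial
    function is [W Id + (Z - W) x x^T / |x|^2]: it is Hölder across the origin exactly when [W] and
    [Z] are and [|Z - W| <= C r^a], which is what the averaging identity delivers. Hölder continuity
    of the Hessian in time is recovered afterwards, by interpolation between space and time. All
    discrete bounds come from nonnegative weights, which the time step [h^2 / (m + 4)] guarantees.
    The threshold [n] in the growth condition is the borderline of a logarithmic divergence: if
    [\int_0^r psi_+ <= n log r] for large [r], the weight [r^(n - 1) exp (- \int_0^r psi_+)] is at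
    least [1 / r]. Passing from [psi] to [psi_+] in the weight has the right sign because
    [U_r <= 0]. *)

Lemma le_of_eq (R : numDomainType) (x y : R) : x = y -> x <= y.
Proof. by move=> ->. Qed.

Section Power.
Variable R : realType.
Implicit Types a x y e : R.

(** Young's inequality for the product of [x^a] and 1, with exponents [1 / a] and [1 / (1 - a)]. *)
Lemma powR_le_tangent a x : 0 < a < 1 -> 0 <= x -> x `^ a <= 1 + a * (x - 1).
Proof.
move=> /andP[a0 a1] x0.
have := @conjugate_powR R (x `^ a) 1 (a^-1) ((1 - a)^-1).
rewrite mulr1 -powRrM mulfV ?gt_eqF// powRr1// powR1 !invrK mul1r.
move=> H; apply: (le_trans (H _ _ _ _ _)); rewrite ?powR_ge0 ?ler01 ?invr_gt0 ?subr_gt0//; lra.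
Qed.

Lemma powR_concave_quotient a x y : 0 < a < 1 -> 0 < x -> 0 <= y ->
  y `^ a <= x `^ a + a * (x `^ a / x) * (y - x).
Proof.
move=> a01 x0 y0.
have /(powR_le_tangent a01) H : 0 <= y / x by rewrite divr_ge0// ltW.
have xa0 := powR_gt0 a x0.
have : x `^ a * (y / x) `^ a <= x `^ a * (1 + a * (y / x - 1)) by rewrite ler_wpM2l// ltW.
rewrite -powRM ?(ltW x0)// ?divr_ge0// ?(ltW x0)// mulrCA mulfV ?gt_eqF// mulr1.
move=> /le_trans; apply; apply: le_of_eq; field; exact: lt0r_neq0.
Qed.

Lemma powR_subadd a x y : 0 < a < 1 -> 0 <= x -> 0 <= y ->
  (x + y) `^ a <= x `^ a + y `^ a.
Proof.
move=> /andP[a0 a1] x0 y0.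
have [s0|] := ltP 0 (x + y); last first.
  move=> s0; have -> : x = 0 by lra.
  have -> : y = 0 by lra.
  by rewrite addr0 powR0 ?gt_eqF// addr0.
have aux z : 0 <= z <= x + y -> (x + y) `^ a * (z / (x + y)) <= z `^ a.
  move=> /andP[z0 zs].
  rewrite -[leRHS](_ : (x + y) `^ a * (z / (x + y)) `^ a = _); last first.
    by rewrite -powRM ?(ltW s0) ?divr_ge0 ?(ltW s0)// mulrCA mulfV ?gt_eqF// mulr1.
  rewrite ler_wpM2l ?powR_ge0//.
  have q0 : 0 <= z / (x + y) by rewrite divr_ge0// ltW.
  have q1 : z / (x + y) <= 1 by rewrite ler_pdivrMr// mul1r.
  move: q0; rewrite le_eqVlt => /orP[/eqP <-|q0]; first exact: powR_ge0.
  rewrite -[leLHS]powRr1 ?(ltW q0)//; apply: ger_powR; [by rewrite q0 q1|exact: ltW].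
have ax : 0 <= x <= x + y by rewrite x0 lerDl.
have ay : 0 <= y <= x + y by rewrite y0 lerDr.
have := lerD (aux x ax) (aux y ay).
by rewrite -mulrDr -mulrDl mulfV ?gt_eqF// mulr1.
Qed.

(** At a chosen scale [e], a Hölder modulus is traded for a constant plus a linear one, and in the
    next lemma for a constant plus a quadratic one: these are the shapes that the coupling and the
    barrier propagate. *)
Lemma powR_interp1 a e x : 0 < a < 1 -> 0 < e -> 0 <= x ->
  x `^ a <= e `^ a + e `^ a / e * x.
Proof.
move=> a01 e0 x0.
apply: (le_trans (powR_concave_quotient a01 e0 x0)).
have ea0 := powR_gt0 a e0.
have /andP[a0 a1] := a01.
have k0 : 0 < e `^ a / e by rewrite divr_gt0.
have : a * (e `^ a / e * x) <= 1 * (e `^ a / e * x).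
  by apply: ler_wpM2r; [exact: mulr_ge0 (ltW k0) x0|exact: ltW].
have : 0 <= a * (e `^ a / e * e) := mulr_ge0 (ltW a0) (mulr_ge0 (ltW k0) (ltW e0)).
lra.
Qed.

Lemma powR_interp2 a e x : 0 < a < 1 -> 0 < e -> 0 <= x ->
  x `^ a <= e `^ a + e `^ a / e ^+ 2 * x ^+ 2.
Proof.
move=> /andP[a0 a1] e0 x0.
have ea0 := powR_gt0 a e0.
have e20 : 0 < e ^+ 2 by rewrite exprn_gt0.
have [xe|ex] := leP x e.
  have : x `^ a <= e `^ a by apply: ge0_ler_powR; rewrite ?nnegrE// ltW.
  have : 0 <= e `^ a / e ^+ 2 * x ^+ 2 by rewrite mulr_ge0 ?sqr_ge0// divr_ge0// ltW.
  lra.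
have a01 : 0 < a < 1 by rewrite a0 a1.
have H := powR_concave_quotient a01 e0 x0.
have k0 : 0 < e `^ a / e by rewrite divr_gt0.
have -> : e `^ a / e ^+ 2 * x ^+ 2 = (e `^ a / e) * (x ^+ 2 / e).
  by field; exact: lt0r_neq0.
apply: (le_trans H).
rewrite lerD2l -mulrA mulrCA ler_wpM2l// ?(ltW k0)//.
apply: (@le_trans _ _ x); first nra.
by rewrite ler_pdivlMr// expr2 ler_wpM2l// ltW.
Qed.

(** Bounds [l^(a - 1)] by an increment of [l^a / a], so that sums of such terms telescope. *)
Lemma powR_sum_step a (l : nat) : 0 < a < 1 ->
  (l.+1%:R) `^ a / l.+1%:R <= a^-1 * ((l.+1%:R) `^ a - (l%:R : R) `^ a).
Proof.
move=> a01; have a0 : 0 < a by case/andP: a01.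
have := @powR_concave_quotient a (l.+1%:R) l%:R a01 (ltr0Sn _ _) (ler0n _ _).
rewrite ler_pdivlMl// -natr1; lra.
Qed.

Lemma powR_diff_le a x y : 0 < a < 1 -> 0 <= x <= y ->
  y `^ a - x `^ a <= (y - x) `^ a.
Proof.
move=> a01 /andP[x0 xy].
have := @powR_subadd a x (y - x) a01 x0; rewrite subr_ge0 => /(_ xy).
have -> : x + (y - x) = y by lra.
lra.
Qed.

End Power.

(** * The explicit radial scheme *)

Section Scheme.
Variables (R : realFieldType) (m : nat) (h : R) (psi : nat -> R).
Implicit Types u v : nat -> R.

Definition dif u i := u i - u i.-1.

(* Discretizes [u'' + (m / r) u' - psi u'] on the nodes [(i + 1/2) h]; the convention
   [0.-1 = 0] makes [dif u 0 = 0], which reflects the walk at the origin. *)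
Definition gen u i : R :=
  h ^- 2 * (dif u i.+1 * (1 + m%:R / i.+1%:R - h / 2 * psi i)
            - dif u i * (1 + h / 2 * psi i)).

(** With drift terms at most 1/2, one step of the walk uses at most [m + 2] units of weight and the
    balance of the coupled pair below at most [m + 7/2]; the [m + 4] available leave a nonnegative
    weight for staying put. *)
Definition step u i : R := u i + (h ^+ 2 / m.+4%:R) * gen u i.

Lemma gen_lin a c u v i :
  gen (fun i => a * u i + c * v i) i = a * gen u i + c * gen v i.
Proof. rewrite /gen /dif; set X := h ^- 2; set Y := _ / _; ring. Qed.

Lemma gen_cst c i : gen (fun=> c) i = 0.
Proof. by rewrite /gen /dif !subrr !mul0r subrr mulr0. Qed.

Lemma step_lin a c u v i :
  step (fun i => a * u i + c * v i) i = a * step u i + c * step v i.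
Proof. rewrite /step gen_lin; ring. Qed.

Lemma step_cst c i : step (fun=> c) i = c.
Proof. by rewrite /step gen_cst mulr0 addr0. Qed.

Lemma eq_gen u v : u =1 v -> gen u =1 gen v.
Proof. by move=> uv i; rewrite /gen /dif !uv. Qed.

Lemma eq_step u v : u =1 v -> step u =1 step v.
Proof. by move=> uv i; rewrite /step (eq_gen uv) uv. Qed.

Lemma gen_step u i : gen (step u) i = step (gen u) i.
Proof.
rewrite {2}/step -(@eq_gen (fun i => 1 * u i + h ^+ 2 / m.+4%:R * gen u i)).
  by rewrite gen_lin mul1r.
by move=> k; rewrite mul1r.
Qed.

Variable B : R.
Hypotheses (h0 : 0 < h) (B0 : 0 <= B) (Bh : B * h <= 1).
Hypothesis psiB : forall i, `|psi i| <= B.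

Let p : R := m.+4%:R^-1.
Let b : R := h / 2 * B.

Let stepE u i : step u i = u i +
  p * ((u i.+1 - u i) * (1 + m%:R / i.+1%:R - h / 2 * psi i)
       + (u i.-1 - u i) * (1 + h / 2 * psi i)).
Proof.
rewrite /step /gen /dif /p; congr (_ + _).
have : h != 0 by rewrite gt_eqF.
set X := _ / i.+1%:R; set M := m.+4%:R^-1 => hN.
by rewrite succnK; field.
Qed.

Let p_gt0 : 0 < p. Proof. by rewrite invr_gt0 ltr0n. Qed.

Let pM : p * (m%:R + 4) = 1.
Proof. by rewrite /p -addn4 natrD mulVf// -natrD addn4 pnatr_eq0. Qed.

Let slope_ge0 i : 0 <= m%:R / i.+1%:R :> R. Proof. exact: divr_ge0. Qed.

Let slope_le j i : (j <= i)%N -> m%:R / i.+1%:R <= m%:R / j.+1%:R :> R.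
Proof. by move=> ji; rewrite ler_wpM2l// lef_pV2 ?posrE ?ltr0n// ler_nat ltnS. Qed.

Let slope_leM j : m%:R / j.+1%:R <= m%:R :> R.
Proof. by rewrite ler_pdivrMr ?ltr0n// ler_peMr// ler1n. Qed.

Let drift_le i : - b <= h / 2 * psi i <= b.
Proof.
have := psiB i; rewrite ler_norml => /andP[H1 H2].
have h2 : 0 <= h / 2 by have := h0; lra.
by rewrite /b -mulrN; apply/andP; split; apply: ler_wpM2l.
Qed.

Let b_ge0 : 0 <= b. Proof. by rewrite /b mulr_ge0// divr_ge0// ltW. Qed.

Let b_le : b <= 1 / 2. Proof. rewrite /b; have := Bh; lra. Qed.

Lemma step_ge0 u : (forall i, 0 <= u i) -> forall i, 0 <= step u i.
Proof.
move=> u0 i; rewrite stepE.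
have Ui := u0 i; have Ui1 := u0 i.+1; have Ui0 := u0 i.-1.
have [D1 D2] := andP (drift_le i).
have s0 := slope_ge0 i; have sM := slope_leM i.
move: D1 D2 s0 sM Ui Ui1 Ui0.
move: (m%:R / i.+1%:R) (h / 2 * psi i) (u i) (u i.+1) (u i.-1) => s d x y z D1 D2 s0 sM x0 y0 z0.
have pp := ltW p_gt0; have bl := b_le.
have H1 : 0 <= p * (y * (1 + s - d)) by rewrite !mulr_ge0//; lra.
have H2 : 0 <= p * (z * (1 + d)) by rewrite !mulr_ge0//; lra.
have H3 : 0 <= x * (p * (m%:R + 4) - p * (2 + s)).
  by rewrite -mulrBr !mulr_ge0//; lra.
rewrite pM in H3; lra.
Qed.

Lemma step_le u v : (forall i, u i <= v i) -> forall i, step u i <= step v i.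
Proof.
move=> uv i; rewrite -subr_ge0.
have := @step_ge0 (fun i => 1 * v i + (-1) * u i) _ i.
rewrite step_lin mul1r mulN1r; apply => k; have := uv k; lra.
Qed.

Lemma step_bound u (M : R) : (forall i, `|u i| <= M) -> forall i, `|step u i| <= M.
Proof.
move=> uM i; rewrite ler_norml -{1}(step_cst (- M) i) -{2}(step_cst M i).
by apply/andP; split; apply: step_le => k; have := uM k; rewrite ler_norml => /andP[].
Qed.

(** [X] is the current difference; [a], [a'] are the outward and inward increments at the outer
    copy, [e], [e'] those at the inner one; [w_], [w0], [w1], [w2] are the modulus at distances D -
    2, D, D + 1, D + 2. The joint rates are [1 - b] for each of the two opposite moves, [si] for a
    common outward move, [sj - si] for the inner copy alone, and [b - bi], [b + bi], [b - bj],
    [b + bj] for the remaining single moves. [K1] to [K8] charge these events in this order, [K9]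
    that of staying. *)
Let pair_far (X a a' e e' w0 w1 w2 w_ si sj bi bj : R) :
  X <= w0 -> X + a - e' <= w2 -> X + a' - e <= w_ -> X + a - e <= w0 ->
  X - e <= w0 -> X + a <= w1 -> X + a' <= w0 -> X - e' <= w1 -> w0 <= w1 ->
  0 <= si <= sj -> sj <= m%:R -> - b <= bi <= b -> - b <= bj <= b ->
  (1 - b) * (w2 + w_ - 2 * w0) + 4 * b * (w1 - w0) <= 0 ->
  X + p * ((a * (1 + si - bi) + a' * (1 + bi)) - (e * (1 + sj - bj) + e' * (1 + bj)))
    <= w0.
Proof.
move=> H1 H2 H3 H4 H5 H6 H7 H8 w01 /andP[s1 s2] s3 /andP[b1 b2] /andP[b3 b4] H9.
have pp := ltW p_gt0; have bb := b_ge0; have bl := b_le.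
have K1 : 0 <= p * ((1 - b) * (w2 - (X + a - e'))) by rewrite !mulr_ge0//; lra.
have K2 : 0 <= p * ((1 - b) * (w_ - (X + a' - e))) by rewrite !mulr_ge0//; lra.
have K3 : 0 <= p * (si * (w0 - (X + a - e))) by rewrite !mulr_ge0//; lra.
have K4 : 0 <= p * ((sj - si) * (w0 - (X - e))) by rewrite !mulr_ge0//; lra.
have K5 : 0 <= p * ((b - bi) * (w1 - (X + a))) by rewrite !mulr_ge0//; lra.
have K6 : 0 <= p * ((b + bi) * (w1 - (X + a'))) by rewrite !mulr_ge0//; lra.
have K7 : 0 <= p * ((b - bj) * (w1 - (X - e))) by rewrite !mulr_ge0//; lra.
have K8 : 0 <= p * ((b + bj) * (w1 - (X - e'))) by rewrite !mulr_ge0//; lra.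
have K9 : 0 <= (w0 - X) * (p * (m%:R + 4) - p * (2 + sj + 2 * b)).
  by rewrite -mulrBr !mulr_ge0//; lra.
have K10 : p * ((1 - b) * (w2 + w_ - 2 * w0) + 4 * b * (w1 - w0)) <= 0.
  by rewrite mulr_ge0_le0.
rewrite pM in K9; lra.
Qed.

(** At distance one, inward moves of both copies exchange them and turn [X] into [- X], as if the
    modulus were continued by w(-1) = - w(1); hence the [3 * w0]. Single moves that make the copies
    meet leave the difference 0, covered by [0 <= w0]. *)
Let pair_near (X a e' w0 w1 w2 si sj bi bj : R) :
  X <= w0 -> X + a - e' <= w2 -> X + a <= w1 -> X - e' <= w1 ->
  0 <= w0 -> w0 <= w1 -> a <= w0 ->
  0 <= si <= sj -> sj <= m%:R -> - b <= bi <= b -> - b <= bj <= b ->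
  (1 - b) * (w2 - 3 * w0) + 4 * b * (w1 - w0) <= 0 ->
  X + p * ((a * (1 + si - bi) - X * (1 + bi)) - (X * (1 + sj - bj) + e' * (1 + bj)))
    <= w0.
Proof.
move=> H1 H2 H6 H8 w00 w01 H4 /andP[s1 s2] s3 /andP[b1 b2] /andP[b3 b4] H9.
have pp := ltW p_gt0; have bb := b_ge0; have bl := b_le.
have K1 : 0 <= p * ((1 - b) * (w2 - (X + a - e'))) by rewrite !mulr_ge0//; lra.
have K3 : 0 <= p * (si * (w0 - a)) by rewrite !mulr_ge0//; lra.
have K4 : 0 <= p * ((sj - si) * w0) by rewrite !mulr_ge0//; lra.
have K5 : 0 <= p * ((b - bi) * (w1 - (X + a))) by rewrite !mulr_ge0//; lra.
have K6 : 0 <= p * ((b + bi) * w1) by rewrite !mulr_ge0//; lra.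
have K7 : 0 <= p * ((b - bj) * w1) by rewrite !mulr_ge0//; lra.
have K8 : 0 <= p * ((b + bj) * (w1 - (X - e'))) by rewrite !mulr_ge0//; lra.
have K9 : 0 <= (w0 - X) * (p * (m%:R + 4) - p * (3 + sj + b)).
  by rewrite -mulrBr !mulr_ge0//; lra.
have K10 : p * ((1 - b) * (w2 - 3 * w0) + 4 * b * (w1 - w0)) <= 0.
  by rewrite mulr_ge0_le0.
rewrite pM in K9; lra.
Qed.

(* Reflection coupling of two copies of the walk: while they are apart they make
   opposite moves, and copies at distance one may exchange their positions. *)
Lemma step_pair u (w : nat -> R) (d : nat) :
  (forall j d, u (j + d)%N - u j <= w d) -> (forall d, w d <= w d.+1) -> 0 <= w 0%N ->
  ((0 < d)%N -> (1 - b) * (w d.+3 + w d.-1 - 2 * w d.+1)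
     + 4 * b * (w d.+2 - w d.+1) <= 0) ->
  (d = 0%N -> (1 - b) * (w 3 - 3 * w 1) + 4 * b * (w 2 - w 1) <= 0) ->
  forall j, step u (j + d.+1)%N - step u j <= w d.+1.
Proof.
move=> uw wS w0 Hfar Hnear j.
have w_ge0 k : 0 <= w k by elim: k => // k /le_trans; apply.
have wle i k : (i <= k)%N -> w i <= w k.
  by move/subnKC <-; elim: (k - i)%N => [|l /le_trans]; [rewrite addn0|apply; rewrite addnS].
have ji : (j <= j + d.+1)%N by rewrite leq_addr.
have S1 : 0 <= (m%:R / (j + d.+1).+1%:R : R) <= m%:R / j.+1%:R.
  by rewrite slope_ge0 slope_le.
have S2 := slope_leM j.
have D1 := drift_le (j + d.+1); have D2 := drift_le j.
(* At [j = 0] the inner copy cannot move inwards, as [0.-1 = 0]; the distance then grows by one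
   less, and monotonicity of [w] covers this case. *)
have Hp : u (j + d.+1).+1 - u j.-1 <= w d.+3.
  case: j {ji S1 S2 D1 D2} => [|j] /=.
    by have := uw 0%N d.+2; rewrite !add0n => /le_trans; apply; exact: wS.
  by have := uw j d.+3; rewrite !addnS !addSn.
have Hp' : u (j + d.+1)%N - u j.-1 <= w d.+2.
  case: j {ji S1 S2 D1 D2 Hp} => [|j] /=.
    by have := uw 0%N d.+1; rewrite !add0n => /le_trans; apply; exact: wS.
  by have := uw j d.+2; rewrite !addnS !addSn.
have X1 : u (j + d.+1)%N - u j <= w d.+1 by exact: uw.
have X2 : u (j + d.+1).+1 - u j <= w d.+2 by have := uw j d.+2; rewrite !addnS.
have X3 : u (j + d.+1).+1 - u j.+1 <= w d.+1 by have := uw j.+1 d.+1; rewrite !addSn.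
have X4 : u (j + d.+1)%N - u j.+1 <= w d.+1.
  by have := uw j.+1 d; rewrite addSn -addnS => /le_trans; apply; exact: wS.
have X5 : u (j + d)%N - u j <= w d.+1.
  by apply: le_trans (wS d); exact: uw.
have -> : step u (j + d.+1)%N - step u j = (u (j + d.+1)%N - u j) + p *
   (((u (j + d.+1).+1 - u (j + d.+1)%N) *
       (1 + m%:R / (j + d.+1).+1%:R - h / 2 * psi (j + d.+1))
     + (u (j + d)%N - u (j + d.+1)%N) * (1 + h / 2 * psi (j + d.+1)))
    - ((u j.+1 - u j) * (1 + m%:R / j.+1%:R - h / 2 * psi j)
      + (u j.-1 - u j) * (1 + h / 2 * psi j))).
  by rewrite !stepE; rewrite [in LHS]addnS succnK -addnS; ring.
have wS1 := wS d.+1.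
case: d => [|d] in Hfar Hnear ji S1 D1 Hp Hp' X1 X2 X3 X4 X5 wS1 *.
  move: (Hnear erefl) => Hn.
  rewrite addn0 addn1 in S1 D1 Hp Hp' X1 X2 X3 X4 X5 *.
  have W0 := w_ge0 1%N.
  rewrite (_ : u j - u j.+1 = - (u j.+1 - u j)) ; last by rewrite opprB.
  rewrite mulNr.
  apply: (pair_near (w1 := w 2) (w2 := w 3)) => //; lra.
have X6 : u (j + d.+1)%N - u j.+1 <= w d.
  by have := uw j.+1 d; rewrite addSn -addnS.
have {}Hfar := Hfar isT.
apply: (pair_far (w1 := w d.+3) (w2 := w d.+4) (w_ := w d)) => //; lra.
Qed.

End Scheme.

(** * Propagation of moduli of continuity and of barriers along the scheme *)

Section SchemeEstimates.
Variables (R : realFieldType) (m : nat) (h : R) (psi : nat -> R) (B : R).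
Hypotheses (h0 : 0 < h) (B0 : 0 < B) (Bh : 8 * B * h <= 1).
Hypothesis psiB : forall i, `|psi i| <= B.
Implicit Types u : nat -> R.

Local Notation gen := (gen m h psi).
Local Notation step := (step m h psi).

Let Bh1 : B * h <= 1.
Proof.
by have := Bh; have := mulr_ge0 (ltW B0) (ltW h0); lra.
Qed.

Lemma iter_step_bound u (M : R) k : (forall i, `|u i| <= M) -> forall i, `|iter k step u i| <= M.
Proof.
move=> uM; elim: k => //= k IH i.
exact: (step_bound m h0 Bh1 psiB).
Qed.

Lemma iter_step_ge0 u k : (forall i, 0 <= u i) -> forall i, 0 <= iter k step u i.
Proof.
move=> u0; elim: k => //= k IH i.
exact: (step_ge0 m h0 Bh1 psiB).
Qed.

(** The coupling with modulus zero, for which its balance conditions are trivial. *)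
Lemma iter_step_decr u k : (forall j d, u (j + d)%N <= u j) ->
  forall j d, iter k step u (j + d)%N <= iter k step u j.
Proof.
move=> u0; elim: k => //= k IH j [|d]; first by rewrite addn0.
rewrite -subr_le0.
apply: (step_pair m h0 (ltW B0) Bh1 psiB (w := fun=> 0)) => //; try by move=> _; lra.
by move=> {}j {}d; rewrite subr_le0.
Qed.

(** The vertex of the parabola [phi] below; the modulus [w] is frozen beyond it and so stays
    nondecreasing. *)
Let x1 : R := (2 * B)^-1.
(* A concave function of the distance whose second differences compensate a
   drift of size at most [B]. *)
Let phi (x : R) := x - B * x ^+ 2.
Let w (c L : R) (d : nat) := c + L * phi (Num.min (d%:R * h) x1).

Let x1_gt0 : 0 < x1. Proof. by rewrite invr_gt0 mulr_gt0. Qed.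
Let Bx1 : B * x1 = 1 / 2.
Proof. by rewrite /x1; field; rewrite gt_eqF. Qed.
Let hx1 : 4 * h <= x1.
Proof.
have H := ler_wpM2r (ltW x1_gt0) Bh.
by move: H; rewrite mul1r => /(le_trans _); apply; rewrite mulrAC -(mulrA 8) Bx1; lra.
Qed.

Let phi_incr (x y : R) : 0 <= x -> x <= y -> y <= x1 -> phi x <= phi y.
Proof.
move=> x0 xy yx; have := Bx1; have := B0 => Bp E.
have : 0 <= (y - x) * (2 * (B * x1) - B * (x + y)).
  apply: mulr_ge0; first lra.
  by rewrite mulrCA -mulrBr; apply: mulr_ge0; [lra|lra].
rewrite E /phi; lra.
Qed.

Let phi_ge (x : R) : 0 <= x -> x <= x1 -> x / 2 <= phi x.
Proof.
move=> x0 xx; have E := Bx1; have := B0 => Bp.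
have : 0 <= x * (B * x1 - B * x) by rewrite -mulrBr !mulr_ge0//; lra.
rewrite E /phi; lra.
Qed.

Let phi_le (x : R) : phi x <= x.
Proof. by rewrite /phi gerBl mulr_ge0 ?sqr_ge0// ltW. Qed.

Let min_ge0 (d : nat) : 0 <= Num.min (d%:R * h) x1.
Proof. by rewrite le_min (ltW x1_gt0) andbT mulr_ge0// ltW. Qed.

Let w_incr (c L : R) d : 0 <= L -> w c L d <= w c L d.+1.
Proof.
move=> L0; rewrite /w lerD2l ler_wpM2l// phi_incr//; last by rewrite ge_min lexx orbT.
rewrite le_min ge_min ge_min lexx orbT andbT.
by apply/orP; left; rewrite ler_wpM2r ?ler_nat// ltW.
Qed.

(** Once [(d + 3) h] passes the vertex, the distance [(d + 1) h] is at least [x1 / 2] because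
    [4 h <= x1]; there [phi >= x1 / 4] and the sup bound [2 M] already fits below [w]. Before that,
    the second difference of [- B x^2] with step [2 h] is [- 8 B h^2], while the drift contributes
    at most [4 (h / 2) B h = 2 B h^2] through the slope of [phi]: the surplus is the 6 in the
    identity below. *)
Let modulus_step u (M c L : R) : (forall i, `|u i| <= M) -> 0 <= c -> 0 <= L ->
  2 * M <= c + L * (x1 / 4) ->
  (forall j d, u (j + d)%N - u j <= w c L d) ->
  forall j d, step u (j + d)%N - step u j <= w c L d.
Proof.
move=> uM c0 L0 HM Hw j [|d].
  rewrite addn0 subrr /w addr_ge0// mulr_ge0//.
  have := @phi_ge _ (min_ge0 0); rewrite ge_min lexx orbT => /(_ isT).
  by apply: le_trans; rewrite divr_ge0// min_ge0.
have su := step_bound m h0 Bh1 psiB uM.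
have hp := h0; have xp := x1_gt0; have hx := hx1; have Bp := B0.
have [far|near] := ltP x1 (d.+3%:R * h).
  have y0 := min_ge0 d.+1.
  have y1 : Num.min (d.+1%:R * h) x1 <= x1 by rewrite ge_min lexx orbT.
  have y2 : x1 / 2 <= Num.min (d.+1%:R * h) x1.
    rewrite le_min; apply/andP; split; last lra.
    by move: far; rewrite -(natr1 d.+2) -(natr1 d.+1) -(natr1 d); lra.
  have : L * (x1 / 4) <= L * phi (Num.min (d.+1%:R * h) x1).
    by rewrite ler_wpM2l//; have := phi_ge y0 y1; lra.
  have := su (j + d.+1)%N; have := su j;  rewrite !ler_norml /w => /andP[? ?] /andP[? ?].
  lra.
have wE k : (k <= d.+3)%N -> w c L k = c + L * phi (k%:R * h).
  move=> kd; rewrite /w min_l// (le_trans _ near)// ler_wpM2r ?ler_nat//; exact: ltW.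
have b1 : 0 <= 1 / 2 - h / 2 * B by have := Bh1; lra.
have LBh : 0 <= L * B * h ^+ 2 by rewrite !mulr_ge0// ?sqr_ge0// ltW.
have bLB := mulr_ge0 b1 LBh.
have b2 : 0 <= h / 2 * B by rewrite mulr_ge0 ?divr_ge0// ltW.
have LBh2 : 0 <= L * B * h * (h * B * h).
  by rewrite !mulr_ge0// ltW.
apply: (step_pair m h0 (ltW B0) Bh1 psiB (w := w c L)) => //.
- by move=> k; exact: w_incr.
- have := @phi_ge _ (min_ge0 0); rewrite ge_min lexx orbT => /(_ isT) P.
  by rewrite addr_ge0// mulr_ge0// (le_trans _ P)// divr_ge0// min_ge0.
- case: d wE {near} => // d wE _; rewrite succnK.
  have E0 := wE d (leqW (leqW (leqW (leqnSn d)))); have E4 := wE d.+4 (leqnn _).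
  have E2 := wE d.+2 (leqW (leqnSn d.+2)); have E3 := wE d.+3 (leqnSn d.+3).
  move: (w c L d) (w c L d.+2) (w c L d.+3) (w c L d.+4) E0 E2 E3 E4 => ? ? ? ? -> -> -> ->.
  rewrite /phi.
  have d0 : 0 <= d%:R :> R by [].
  rewrite -(natr1 d.+3) -(natr1 d.+2) -(natr1 d.+1) -(natr1 d).
  rewrite [leLHS](_ : _ = - (L * B * h ^+ 2 * (6 + h / 2 * B * (8 * d%:R + 12)))); last by field.
  by rewrite oppr_le0 mulr_ge0// addr_ge0// mulr_ge0// addr_ge0// mulr_ge0.
- move=> d0; rewrite d0 in wE *.
  have E1 := wE 1%N isT; have E2 := wE 2%N isT; have E3 := wE 3%N isT.
  move: (w c L 1) (w c L 2) (w c L 3) E1 E2 E3 => ? ? ? -> -> ->; rewrite /phi.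
  rewrite [leLHS](_ : _ = - (2 * (c * (1 - h / 2 * B)) + L * B * h ^+ 2 * (4 + 6 * (h / 2 * B)))); last by field.
  have c1 : 0 <= c * (1 - h / 2 * B) by apply: mulr_ge0 => //; lra.
  have c2 : 0 <= L * B * h ^+ 2 * (4 + 6 * (h / 2 * B)) by apply: mulr_ge0 => //; lra.
  lra.
Qed.

(** The slope doubles once and not at each step: [x / 2 <= phi x] up to the vertex puts the initial
    modulus below [w], [w] itself is preserved, and [phi x <= x] is used only at the end. *)
Lemma iter_step_modulus u (M c L : R) : (forall i, `|u i| <= M) -> 0 <= c -> 0 <= L ->
  2 * M <= c + L * ((2 * B)^-1 / 4) ->
  (forall j d, u (j + d)%N - u j <= c + L / 2 * (d%:R * h)) ->
  forall k j d, iter k step u (j + d)%N - iter k step u j <= c + L * (d%:R * h).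
Proof.
move=> uM c0 L0 HM Hu k j d.
have x0 (l : nat) : 0 <= l%:R * h by rewrite mulr_ge0// ltW.
apply: (@le_trans _ _ (w c L d)); last first.
  rewrite /w lerD2l ler_wpM2l// (le_trans (phi_le _))// ge_min lexx//.
elim: k j d => /= [|k IH] j d; last first.
  exact: (modulus_step (iter_step_bound k uM)).
rewrite /w; have [l|l] := leP (d%:R * h) x1.
  apply: (le_trans (Hu j d)); rewrite lerD2l -mulrA ler_wpM2l// mulrC.
  exact: phi_ge.
have xp := x1_gt0.
have : L * (x1 / 4) <= L * phi x1.
  by rewrite ler_wpM2l//; have := phi_ge (ltW xp) (lexx _); lra.
have := uM (j + d)%N; have := uM j; rewrite !ler_norml /w => /andP[? ?] /andP[? ?].
rewrite /x1 in xp *; lra.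
Qed.

(** A parabola centred at node [i0] bounds the growth in time at that node. The drift acts on it
    with a strength growing with the distance, so its generator is bounded only within distance one,
    by 2 from the second difference, [2 m] from the radial term and [2 B] from the drift; further
    out [M <= c + L] takes over. *)
Lemma iter_step_barrier (g : nat -> R) (i0 : nat) (M c L : R) :
  (forall i, `|g i| <= M) -> M <= c + L -> 0 <= L ->
  (forall i, g i <= c + L * ((i%:R - i0%:R) * h) ^+ 2) ->
  forall k i, iter k step g i <= c + L * ((i%:R - i0%:R) * h) ^+ 2
    + L * (k%:R * (h ^+ 2 / m.+4%:R) * (2 * m%:R + 2 + 2 * B)).
Proof.
move=> gM ML L0 Hg; set C := 2 * m%:R + 2 + 2 * B; set t := _ / m.+4%:R.
pose beta (i : nat) : R := ((i%:R - i0%:R) * h) ^+ 2.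
have t0 : 0 <= t by rewrite divr_ge0 ?sqr_ge0.
have C0 : 0 <= C by rewrite /C; have := B0; have : 0 <= m%:R :> R by []; lra.
elim=> [|k IH] i; first by rewrite !mul0r mulr0 addr0.
have [b1|b1] := leP 1 (beta i).
  have := iter_step_bound k.+1 gM i; rewrite ler_norml => /andP[_] /le_trans; apply.
  have := mulr_ge0 L0 (mulr_ge0 (mulr_ge0 (ler0n R k.+1) t0) C0).
  have : L * 1 <= L * beta i by rewrite ler_wpM2l.
  rewrite /beta; lra.
pose v i : R := L * beta i + 1 * (c + L * (k%:R * t * C)).
have Hv : step (iter k step g) i <= step v i.
  apply: (step_le m h0 Bh1 psiB) => l.
  by rewrite /v mul1r; apply: (le_trans (IH l)); rewrite /beta; lra.
apply: (le_trans Hv).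
rewrite /v (step_lin _ _ _ L 1 beta (fun=> c + L * (k%:R * t * C))) step_cst.
suff H : gen beta i <= C.
  have := ler_wpM2l L0 (ler_wpM2l t0 H).
  rewrite /step -/t /beta -natr1; lra.
have xb : `|(i%:R - i0%:R) * h| <= 1.
  have x2 : `|(i%:R - i0%:R) * h| ^+ 2 <= 1 by rewrite real_normK ?num_real// ltW.
  by rewrite -(@ler_pXn2r _ 2)// ?nnegrE// expr1n.
set b := h / 2 * psi i.
have bb : `|b| <= 1 / 2.
  rewrite /b normrM ger0_norm ?divr_ge0 ?(ltW h0)//.
  have := ler_wpM2l (ltW h0) (psiB i); have := Bh1; lra.
have s0 : 0 <= m%:R / i.+1%:R :> R by rewrite divr_ge0.
(* The radial term is bounded uniformly in [i] because [2 (i - i0) + 1 <= 2 (i + 1)]. *)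
have sx : m%:R / i.+1%:R * (2 * (i%:R - i0%:R) + 1) <= 2 * m%:R :> R.
  rewrite mulrAC ler_pdivrMr ?ltr0n// [leRHS](_ : _ = m%:R * (2 * i.+1%:R)); last by ring.
  by rewrite ler_wpM2l// -natr1; have : 0 <= i0%:R :> R by []; lra.
have drift : - (4 * (i%:R - i0%:R) * b) <= 2 * B.
  apply: (@le_trans _ _ (2 * `|(i%:R - i0%:R) * h| * `|psi i|)).
    have := ler_norm (- ((i%:R - i0%:R) * h * psi i)); rewrite normrN normrM.
    by rewrite /b; lra.
  by rewrite -mulrA ler_wpM2l// -[leRHS]mul1r ler_pM.
have hN : h != 0 by rewrite gt_eqF.
have D1 : dif beta i.+1 = h ^+ 2 * (2 * (i%:R - i0%:R) + 1).
  by rewrite /dif /beta succnK -natr1; ring.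
have D0 : h ^+ 2 * (2 * (i%:R - i0%:R) - 1) <= dif beta i.
  have i00 : 0 <= i0%:R :> R by [].
  rewrite /dif /beta; case: (i) => [|j]; last by rewrite succnK -natr1; lra.
  by rewrite subrr sub0r mulr_ge0_le0 ?sqr_ge0//; lra.
have D2 : h ^+ 2 * (2 * (i%:R - i0%:R) - 1) * (1 + b) <= dif beta i * (1 + b).
  by rewrite ler_wpM2r//; move: bb; rewrite ler_norml => /andP[? ?]; lra.
have hh : 0 <= h ^+ 2 by rewrite sqr_ge0.
have K1 := ler_wpM2l hh sx.
have K2 := ler_wpM2l hh drift.
rewrite /gen -/b; move: (dif beta i.+1) (dif beta i) D1 D2 => ? d -> D2.
rewrite ler_pdivrMl ?exprn_gt0// /C.
by move: K1 K2 D2; set s := _ / i.+1%:R; lra.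
Qed.

End SchemeEstimates.

(** * Discrete Hölder and Schauder estimates *)

Section DiscreteHolder.
Variables (R : realType) (a h : R).
Hypotheses (a01 : 0 < a < 1) (h0 : 0 < h).
Implicit Types f g e u v : nat -> R.

Definition seq_holder (K : R) f :=
  forall j d : nat, `|f (j + d)%N - f j| <= K * (d%:R * h) `^ a.

Lemma seq_holder_ge0 (K : R) f : seq_holder K f -> 0 <= K.
Proof.
move=> /(_ 0%N 1%N) H; have := le_trans (normr_ge0 _) H.
by rewrite pmulr_lge0// powR_gt0// mul1r.
Qed.

Lemma seq_holder_le (K K' : R) f : K <= K' -> seq_holder K f -> seq_holder K' f.
Proof.
by move=> KK Kf j d; apply: (le_trans (Kf j d)); rewrite ler_wpM2r// powR_ge0.
Qed.

Lemma seq_holderD (K K' : R) f g : seq_holder K f -> seq_holder K' g ->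
  seq_holder (K + K') (fun i => f i + g i).
Proof.
move=> Kf Kg j d; rewrite mulrDl opprD addrACA.
exact: (le_trans (ler_normD _ _) (lerD (Kf j d) (Kg j d))).
Qed.

Lemma seq_holderZ (K c : R) f : seq_holder K f -> seq_holder (`|c| * K) (fun i => c * f i).
Proof. by move=> Kf j d; rewrite -mulrBr normrM -mulrA ler_wpM2l. Qed.

Lemma seq_holderM (K K' M M' : R) f g : (forall i, `|f i| <= M) -> (forall i, `|g i| <= M') ->
  seq_holder K f -> seq_holder K' g ->
  seq_holder (K * M' + M * K') (fun i => f i * g i).
Proof.
move=> fM gM Kf Kg j d.
rewrite (_ : _ - _ = (f (j + d)%N - f j) * g (j + d)%N + f j * (g (j + d)%N - g j)); last by ring.
apply: (le_trans (ler_normD _ _)); rewrite !normrM mulrDl mulrAC -[M * K' * _]mulrA.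
by rewrite lerD// ler_pM.
Qed.

Lemma seq_holder_lip (L K : R) f : (forall i, `|f i| <= L) ->
  (forall j d : nat, `|f (j + d)%N - f j| <= K * (d%:R * h)) -> seq_holder (2 * L + K) f.
Proof.
move=> fL fK j [|d]; first by rewrite addn0 subrr normr0 mul0r powR0 ?mulr0//; case/andP: a01 => /gt_eqF ->.
have L0 : 0 <= L := le_trans (normr_ge0 _) (fL 0%N).
have K0 : 0 <= K.
  have := le_trans (normr_ge0 _) (fK 0%N 1%N).
  by rewrite pmulr_lge0// mul1r.
have x0 : 0 < d.+1%:R * h by rewrite mulr_gt0.
have [x1|x1] := leP (d.+1%:R * h) 1.
  apply: (le_trans (fK _ _)); rewrite mulrDl ler_wpDl ?mulr_ge0 ?powR_ge0//.
  rewrite ler_wpM2l// -[leLHS]powRr1 ?(ltW x0)//.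
  by apply: ger_powR; [rewrite x0 x1|case/andP: a01 => _ /ltW].
have : 1 <= (d.+1%:R * h) `^ a.
  rewrite -[leLHS](powRr0 (d.+1%:R * h)); apply: ler_powR; first exact: ltW.
  by case/andP: a01 => /ltW.
set y := _ `^ a => y1.
have := ler_normB (f (j + d.+1)%N) (f j); have := fL (j + d.+1)%N; have := fL j.
have : L * 1 <= L * y by rewrite ler_wpM2l.
have : 0 <= K * y by rewrite mulr_ge0// (le_trans _ y1).
lra.
Qed.

Lemma lip_of_steps (L : R) f : (forall i, `|f i.+1 - f i| <= L * h) ->
  forall j d : nat, `|f (j + d)%N - f j| <= L * (d%:R * h).
Proof.
move=> fL j; elim=> [|d IH]; first by rewrite addn0 subrr normr0 mul0r mulr0.
have -> : f (j + d.+1)%N - f j = (f (j + d).+1 - f (j + d)%N) + (f (j + d)%N - f j).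
  by rewrite addnS; ring.
apply: (le_trans (ler_normD _ _)); have := fL (j + d)%N; rewrite -natr1; lra.
Qed.

Lemma discrete_taylor f (c w : R) (j D : nat) :
  (forall l, (l < D)%N -> `|f (j + l).+1 - f (j + l)%N - c| <= w) ->
  `|f (j + D)%N - f j - D%:R * c| <= D%:R * w.
Proof.
elim: D => [|D IH] H; first by rewrite addn0 subrr !mul0r subrr normr0.
have {}IH := IH (fun l lD => H l (ltnW lD)).
have -> : f (j + D.+1)%N - f j - D.+1%:R * c =
   (f (j + D).+1 - f (j + D)%N - c) + (f (j + D)%N - f j - D%:R * c).
  by rewrite addnS -natr1; ring.
apply: (le_trans (ler_normD _ _)); have := H D (ltnSn D); rewrite -natr1; lra.
Qed.

(** * Discrete form of [r e' + q e = q f], whose regular solution is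
    [e = q r^(- q) \int_0^r s^(q - 1) f] *)

Section WeightedAverage.
Variables (q : R) (e f : nat -> R).
Hypotheses (q0 : 0 < q) (e0 : e 0%N = f 0%N).
Hypothesis eS : forall i : nat, (i.+1%:R + q) * e i.+1 = i.+1%:R * e i + q * f i.+1.

(** Each [e i.+1] is a convex combination of [e i] and [f i.+1]. *)
Lemma avg_bound (M : R) : (forall i, `|f i| <= M) -> forall i, `|e i| <= M.
Proof.
move=> fM; elim=> [|i IH]; first by rewrite e0.
have p0 : 0 < i.+1%:R + q by rewrite addr_gt0.
rewrite -(ler_pM2l p0) -{1}(gtr0_norm p0) -normrM eS.
apply: (le_trans (ler_normD _ _)).
rewrite !normrM normr_nat (gtr0_norm q0) mulrDl.
by apply: lerD; [rewrite ler_wpM2l|apply: ler_wpM2l => //; exact: ltW].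
Qed.

(** [e i] averages values of [f] at nodes up to [i], all within distance [l h] of node [l]. *)
Lemma avg_near (K : R) : seq_holder K f ->
  forall i l, (i <= l)%N -> `|f l - e i| <= K * (l%:R * h) `^ a.
Proof.
move=> fK; have K0 := seq_holder_ge0 fK.
have fl i l : (i <= l)%N -> `|f l - f i| <= K * (l%:R * h) `^ a.
  move=> il; rewrite -{1}(subnKC il); apply: (le_trans (fK _ _)).
  rewrite ler_wpM2l//; apply: ge0_ler_powR; rewrite ?nnegrE ?mulr_ge0 ?(ltW h0)//.
    by case/andP: a01 => /ltW.
  by rewrite ler_wpM2r ?(ltW h0)// ler_nat leq_subr.
elim=> [|i IH] l il; first by rewrite e0; exact: fl.
have p0 : 0 < i.+1%:R + q by rewrite addr_gt0.
rewrite -(ler_pM2l p0) -{1}(gtr0_norm p0) -normrM mulrBr eS.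
have -> : (i.+1%:R + q) * f l - (i.+1%:R * e i + q * f i.+1) =
   i.+1%:R * (f l - e i) + q * (f l - f i.+1) by ring.
apply: (le_trans (ler_normD _ _)).
rewrite !normrM normr_nat (gtr0_norm q0) mulrDl.
apply: lerD; first by rewrite ler_wpM2l// IH// ltnW.
by rewrite ler_wpM2l ?fl// ltW.
Qed.

(** The increments of [e] are [q (f - e) / (i + 1 + q)], of order [h^a (i + 1)^(a - 1)] by the
    previous lemma; they telescope against [(r^a)' = a r^(a - 1)], which produces the factor
    [1 / a]. *)
Lemma avg_holder (K : R) : seq_holder K f -> seq_holder (q * K / a) e.
Proof.
move=> fK; have K0 := seq_holder_ge0 fK.
have a0 : 0 < a by case/andP: a01.
suff H j d : `|e (j + d)%N - e j| <=
    q * K / a * (((j + d)%:R * h) `^ a - (j%:R * h) `^ a).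
  move=> j d; apply: (le_trans (H j d)).
  rewrite ler_wpM2l ?mulr_ge0 ?invr_ge0 ?(ltW a0) ?(ltW q0)//.
  have -> : d%:R * h = (j + d)%:R * h - j%:R * h by rewrite natrD; ring.
  apply: powR_diff_le => //.
  by rewrite mulr_ge0 ?(ltW h0)//= ler_wpM2r ?(ltW h0)// ler_nat leq_addr.
elim: d => [|d IH]; first by rewrite addn0 !subrr normr0 mulr0.
rewrite addnS; set i := (j + d)%N in IH *.
have p0 : 0 < i.+1%:R + q by rewrite addr_gt0.
have D : `|e i.+1 - e i| <= q * K / a * ((i.+1%:R * h) `^ a - (i%:R * h) `^ a).
  have -> : e i.+1 - e i = q / (i.+1%:R + q) * (f i.+1 - e i).
    apply: (mulfI (lt0r_neq0 p0)).
    rewrite mulrBr eS [RHS]mulrA [_ * (q / _)]mulrCA mulfV ?lt0r_neq0// mulr1.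
    by ring.
  rewrite normrM ger0_norm ?divr_ge0 ?(ltW q0) ?(ltW p0)//.
  have E := avg_near fK (leqnSn i).
  have Q : q / (i.+1%:R + q) <= q / i.+1%:R.
    rewrite ler_wpM2l ?(ltW q0)// lef_pV2 ?posrE ?addr_gt0//.
    by rewrite lerDl ltW.
  have Q0 : 0 <= q / (i.+1%:R + q) by rewrite divr_ge0 ?(ltW q0) ?(ltW p0).
  apply: (le_trans (ler_pM Q0 (normr_ge0 _) Q E)).
  rewrite !powRM ?(ltW h0)// -mulrBl.
  rewrite (_ : q / _ * _ = q * K * h `^ a * (i.+1%:R `^ a / i.+1%:R)); last first.
    by ring.
  rewrite (_ : q * K / a * _ = q * K * h `^ a * (a^-1 * (i.+1%:R `^ a - i%:R `^ a))); last by ring.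
  by rewrite ler_wpM2l ?mulr_ge0 ?powR_ge0 ?(ltW q0)// powR_sum_step.
rewrite (_ : e i.+1 - e j = (e i.+1 - e i) + (e i - e j)); last by ring.
apply: (le_trans (ler_normD _ _)); lra.
Qed.

End WeightedAverage.
End DiscreteHolder.

(** * Hölder bounds in space and time along the iteration *)

Section DiscreteSchauder.
Variables (R : realType) (a h : R) (m : nat) (psi : nat -> R) (B Kp : R).
Hypotheses (a01 : 0 < a < 1) (h0 : 0 < h) (B0 : 0 < B) (Bh : 8 * B * h <= 1).
Hypothesis psiB : forall i, `|psi i| <= B.
Hypothesis psiK : seq_holder a h Kp psi.
Implicit Types f g e u v : nat -> R.

Local Notation gen := (gen m h psi).
Local Notation step := (step m h psi).
Local Notation seq_holder := (seq_holder a h).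

Lemma iter_step_opp u k : forall i, iter k step (fun i => - u i) i = - iter k step u i.
Proof.
elim: k => //= k IH i; rewrite (@eq_step _ _ _ _ _ (fun i => (-1) * iter k step u i + 0 * 0)).
  by rewrite (step_lin _ _ _ (-1) 0 _ (fun=> 0)) mul0r addr0 mulN1r.
by move=> l; rewrite IH; ring.
Qed.

(** The modulus is taken with [c = 0]; the summand [16 M B] makes its value at the vertex, at least
    slope / (8 B), exceed [2 M]. The lower bound follows by applying the upper one to [- u]. *)
Lemma iter_step_lip u (M L : R) : (forall i, `|u i| <= M) -> 0 <= L ->
  (forall j d : nat, `|u (j + d)%N - u j| <= L * (d%:R * h)) ->
  forall k (j d : nat),
  `|iter k step u (j + d)%N - iter k step u j| <= (2 * L + 16 * M * B) * (d%:R * h).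
Proof.
move=> uM L0 uL k j d.
have M0 : 0 <= M := le_trans (normr_ge0 _) (uM 0%N).
have MB : 0 <= M * B by rewrite mulr_ge0// ltW.
have cond : 2 * M <= 0 + (2 * L + 16 * M * B) * ((2 * B)^-1 / 4).
  have -> : 0 + (2 * L + 16 * M * B) * ((2 * B)^-1 / 4) = L / (4 * B) + 2 * M.
    by field; rewrite gt_eqF.
  by rewrite lerDr divr_ge0// mulr_ge0// ltW.
have C0 : 0 <= 2 * L + 16 * M * B by lra.
have x0 (l : nat) : 0 <= l%:R * h by rewrite mulr_ge0// ltW.
have init v : (forall j d : nat, `|v (j + d)%N - v j| <= L * (d%:R * h)) ->
    forall j d : nat, v (j + d)%N - v j <= 0 + (2 * L + 16 * M * B) / 2 * (d%:R * h).
  move=> vL i l; apply: (le_trans (ler_norm _)); apply: (le_trans (vL i l)).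
  have := mulr_ge0 MB (x0 l); lra.
rewrite ler_norml; apply/andP; split.
  have := @iter_step_modulus _ m _ _ _ h0 B0 Bh psiB (fun i => - u i) M 0 (2 * L + 16 * M * B) _ _ _ _ _ k j d.
  rewrite !iter_step_opp => H.
  suff : - iter k step u (j + d)%N - - iter k step u j <= 0 + (2 * L + 16 * M * B) * (d%:R * h) by lra.
  apply: H => //; first by move=> i; rewrite normrN.
  by apply: init => i l; rewrite -opprD normrN.
have := @iter_step_modulus _ m _ _ _ h0 B0 Bh psiB u M 0 (2 * L + 16 * M * B) uM (lexx _) C0 cond (init _ uL) k j d.
by rewrite add0r.
Qed.

(** For each distance [e], the Hölder bound is weakened to [K e^a + K e^(a - 1) x]; this modulus is
    propagated with twice the slope and read off at [x = e] only, which gives [3 K e^a] plus terms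
    from the sup bound. *)
Lemma iter_step_holder g (M K : R) : (forall i, `|g i| <= M) -> seq_holder K g ->
  forall k, seq_holder (3 * K + 16 * M * B + 2 * M) (iter k step g).
Proof.
move=> gM gK k.
have K0 := seq_holder_ge0 h0 gK.
have M0 : 0 <= M := le_trans (normr_ge0 _) (gM 0%N).
have MB : 0 <= M * B by rewrite mulr_ge0// ltW.
have half v : (forall i, `|v i| <= M) -> seq_holder K v -> forall j d : nat,
   iter k step v (j + d)%N - iter k step v j <= (3 * K + 16 * M * B + 2 * M) * (d%:R * h) `^ a.
  move=> vM vK j [|d].
    by rewrite addn0 subrr mulr_ge0 ?powR_ge0//; lra.
  have e0 : 0 < d.+1%:R * h by rewrite mulr_gt0.
  set e := d.+1%:R * h in e0 *.
  have ea := powR_gt0 a e0.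
  have [e1|e1] := leP e 1; last first.
    have : 1 <= e `^ a.
      rewrite -[leLHS](powRr0 e); apply: ler_powR; first exact: ltW.
      by case/andP: a01 => /ltW.
    move=> H; have := iter_step_bound m h0 B0 Bh psiB k vM.
    move=> V; have := V (j + d.+1)%N; have := V j; rewrite !ler_norml => /andP[? ?] /andP[? ?].
    have := ler_wpM2l M0 H; have : 0 <= (3 * K + 16 * M * B) * e `^ a by rewrite mulr_ge0 ?(ltW ea)//; lra.
    lra.
  set L := 2 * (K * (e `^ a / e)) + 16 * M * B.
  have KL : 0 <= K * (e `^ a / e) by rewrite mulr_ge0 ?divr_ge0 ?(ltW ea) ?(ltW e0).
  have c0 : 0 <= K * e `^ a by rewrite mulr_ge0// ltW.
  have cond : 2 * M <= K * e `^ a + L * ((2 * B)^-1 / 4).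
    have -> : L * ((2 * B)^-1 / 4) = K * (e `^ a / e) / (4 * B) + 2 * M.
      by rewrite /L; field; rewrite !gt_eqF.
    have : 0 <= K * (e `^ a / e) / (4 * B) by rewrite divr_ge0// mulr_ge0// ltW.
    lra.
  have L0 : 0 <= L by rewrite /L; lra.
  have := @iter_step_modulus _ m _ _ _ h0 B0 Bh psiB v M (K * e `^ a) L vM c0 L0 cond _ k j d.+1.
  rewrite -/e => H; apply: (le_trans (H _)).
    move=> i l; apply: (le_trans (ler_norm _)); apply: (le_trans (vK i l)).
    have x0 : 0 <= l%:R * h by rewrite mulr_ge0// ltW.
    have := ler_wpM2l K0 (powR_interp1 a01 e0 x0).
    have := mulr_ge0 MB x0; rewrite /L; lra.
  have -> : K * e `^ a + L * e = 3 * (K * e `^ a) + 16 * (M * B) * e.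
    by rewrite /L; field; rewrite gt_eqF.
  have : e <= e `^ a.
    rewrite -[leLHS]powRr1 ?(ltW e0)//.
    by apply: ger_powR; [rewrite e0 e1|case/andP: a01 => _ /ltW].
  move=> /(ler_wpM2l MB); have := mulr_ge0 M0 (ltW ea); lra.
move=> j d; rewrite ler_norml; apply/andP; split; last exact: half.
have := half (fun i => - g i) _ _ j d; rewrite !iter_step_opp => H.
suff : - iter k step g (j + d)%N - - iter k step g j <= (3 * K + 16 * M * B + 2 * M) * (d%:R * h) `^ a by lra.
apply: H; first by move=> i; rewrite normrN.
by move=> i l; rewrite -opprD normrN.
Qed.

(** Parabolic scaling: with [e = sqrt t], the datum lies below its value at [i0] plus
    [K e^a + K e^(a - 2) x^2], and running this barrier for time [t = e^2] raises it by a multiple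
    of [e^a]. *)
Lemma iter_step_time_holder g (M K : R) : (forall i, `|g i| <= M) -> seq_holder K g ->
  forall k i, `|iter k step g i - g i| <=
    (K + (K + 2 * M) * (2 * m%:R + 2 + 2 * B) + 2 * M) *
      (k%:R * (h ^+ 2 / m.+4%:R)) `^ (a / 2).
Proof.
move=> gM gK k i0; set C := 2 * m%:R + 2 + 2 * B; set t := k%:R * _.
have K0 := seq_holder_ge0 h0 gK.
have M0 : 0 <= M := le_trans (normr_ge0 _) (gM 0%N).
have C0 : 0 <= C by rewrite /C; have := B0; have : 0 <= m%:R :> R by []; lra.
have t0 : 0 <= t by rewrite /t mulr_ge0// mulr_ge0 ?sqr_ge0// invr_ge0.
have a0 : 0 < a by case/andP: a01.
have M20 : 0 <= 2 * M by rewrite mulr_ge0.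
have D0 : 0 <= K + (K + 2 * M) * C := addr_ge0 K0 (mulr_ge0 (addr_ge0 K0 M20) C0).
have [k0|kN0] := eqVneq k 0%N.
  by rewrite k0 /= subrr normr0 mulr_ge0 ?powR_ge0// addr_ge0.
have tp : 0 < t by rewrite /t mulr_gt0 ?ltr0n ?lt0n// mulr_gt0 ?exprn_gt0// invr_gt0.
pose e := Num.sqrt t.
have ep : 0 < e by rewrite sqrtr_gt0.
have e2 : e ^+ 2 = t by rewrite sqr_sqrtr.
have -> : t `^ (a / 2) = e `^ a by rewrite /e -powR12_sqrt// -powRrM mulrC.
have ea := powR_gt0 a ep.
set D := _ + 2 * M.
have [e1|e1] := leP e 1; last first.
  have ea1 : 1 <= e `^ a.
    rewrite -[leLHS](powRr0 e); apply: ler_powR; exact: ltW.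
  have := ler_normB (iter k step g i0) (g i0).
  have := iter_step_bound m h0 B0 Bh psiB k gM i0; have := gM i0.
  have := ler_wpM2l M0 ea1; have := mulr_ge0 D0 (ltW ea); rewrite /D; lra.
have half v : (forall i, `|v i| <= M) -> seq_holder K v ->
   iter k step v i0 - v i0 <= D * e `^ a.
  move=> vM vK.
  (* The extra [2 * M] makes the barrier exceed [M] at distance one, where it has to dominate
     trivially. *)
  have L0 : 0 <= K * (e `^ a / e ^+ 2) + 2 * M.
    by apply: addr_ge0 M20; rewrite mulr_ge0// divr_ge0 ?sqr_ge0// ltW.
  have := @iter_step_barrier _ m _ _ _ h0 B0 Bh psiB v i0 M (v i0 + K * e `^ a)
    (K * (e `^ a / e ^+ 2) + 2 * M) vM _ L0 _ k i0.
  rewrite subrr mul0r expr0n /= mulr0 addr0 -/C -/t => H.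
  rewrite lerBlDr; apply: (le_trans (H _ _)).
  - have := vM i0; rewrite ler_norml => /andP[? _].
    have : 0 <= K * (e `^ a / e ^+ 2) by rewrite mulr_ge0// divr_ge0 ?sqr_ge0// ltW.
    have := mulr_ge0 K0 (ltW ea); lra.
  - move=> i.
    have K1 : `|v i - v i0| <= K * (`|i%:R - i0%:R| * h) `^ a.
      have [ii|ii] := leqP i0 i.
        by rewrite -natrB// normr_nat -{1}(subnKC ii).
      by rewrite distrC (distrC i%:R) -natrB ?(ltnW ii)// normr_nat -{1}(subnKC (ltnW ii)).
    have x0 : 0 <= `|i%:R - i0%:R| * h by rewrite mulr_ge0// ltW.
    have := ler_wpM2l K0 (powR_interp2 a01 ep x0).
    rewrite !exprMn real_normK ?num_real//.
    have := mulr_ge0 M0 (mulr_ge0 (sqr_ge0 (i%:R - i0%:R)) (sqr_ge0 h)).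
    have := le_trans (ler_norm _) K1; lra.
  have -> : (K * (e `^ a / e ^+ 2) + 2 * M) * (t * C) = (K * e `^ a + 2 * (M * e ^+ 2)) * C.
    by rewrite -e2; field; rewrite gt_eqF.
  have : e ^+ 2 <= e `^ a.
    rewrite -powR_mulrn ?(ltW ep)//.
    apply: ger_powR; first by rewrite ep e1.
    by case/andP: a01; lra.
  move=> /(ler_wpM2l M0) /(ler_wpM2r C0).
  have := mulr_ge0 M0 (ltW ea).
  rewrite /D; lra.
rewrite ler_norml; apply/andP; split; last exact: half.
have := half (fun i => - g i) _ _; rewrite !iter_step_opp => H.
suff : - iter k step g i0 - - g i0 <= D * e `^ a by lra.
apply: H; first by move=> i; rewrite normrN.
by move=> i l; rewrite -opprD normrN.
Qed.

End DiscreteSchauder.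

(** * From a Hölder bound on the generator to bounds on second differences *)

Section DiscreteRegularity.
Variables (R : realType) (a h : R) (m : nat) (psi : nat -> R).
Implicit Types u : nat -> R.

(* Discrete versions of [u_r], [u_rr] and [u_r / r]. *)
Definition dvel u i : R := dif u i.+1 / h.
Definition dsec u i : R := (dif u i.+1 - dif u i) / h ^+ 2.
Definition drat u i : R := dif u i.+1 / (h ^+ 2 * i.+1%:R).

Definition discrete_bounds (C : R) u :=
  [/\ forall i, `|u i| <= C,
      forall i, `|dif u i| <= C * h,
      forall i, `|drat u i| <= C,
      forall i, `|dsec u i| <= C &
      forall i, `|gen m h psi u i| <= C] /\
  [/\ seq_holder a h C (drat u),
      seq_holder a h C (dsec u),
      seq_holder a h C (gen m h psi u) &
      forall i : nat, `|dsec u i - drat u i| <= C * (i%:R * h) `^ a].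

Hypothesis h0 : 0 < h.

Lemma dvelE u i : dvel u i = i.+1%:R * h * drat u i.
Proof.
rewrite /dvel /drat; have : i.+1%:R != 0 :> R by rewrite pnatr_eq0.
have hN : h != 0 by rewrite gt_eqF.
by move: (i.+1%:R : R) => I IN; field; rewrite ?IN ?hN.
Qed.

(** The combination [dvel - h / 2 * dsec] is the centred difference quotient at node [i]. *)
Lemma genE u i : gen m h psi u i =
  (dsec u i + m%:R * drat u i) - psi i * (dvel u i - h / 2 * dsec u i).
Proof.
rewrite /gen /dvel /drat /dsec; have : i.+1%:R != 0 :> R by rewrite pnatr_eq0.
have hN : h != 0 by rewrite gt_eqF.
by move: (i.+1%:R : R) => I IN; field; rewrite ?IN ?hN.
Qed.

(** For [W = U_r / r] and [Z = U_rr] one has [r W' = Z - W], hence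
    [r (q W)' + q (q W) = q (Z + (q - 1) W)]; this is its exact discrete counterpart. With
    [q = m + 1] the right side is the radial Laplacian, with [q = 1] it is [U_rr]. *)
Lemma drat_rec u (q : R) : 0 < q -> forall i : nat,
  (i.+1%:R + q) * (q * drat u i.+1) =
    i.+1%:R * (q * drat u i) + q * (dsec u i.+1 + (q - 1) * drat u i.+1).
Proof.
move=> q0 i; rewrite /drat /dsec -(natr1 i.+1).
have : i.+1%:R != 0 :> R by rewrite pnatr_eq0.
have : i.+1%:R + 1 != 0 :> R by rewrite natr1 pnatr_eq0.
have hN : h != 0 by rewrite gt_eqF.
by move: (i.+1%:R : R) => I IN IN1; field; rewrite ?hN ?IN ?IN1.
Qed.

Lemma drat_rec0 u (q : R) : q * drat u 0%N = dsec u 0%N + (q - 1) * drat u 0%N.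
Proof.
rewrite /drat /dsec /dif /= subrr subr0 mulr1; ring.
Qed.

Hypothesis a01 : 0 < a < 1.
Let a0 : 0 < a. Proof. by case/andP: a01. Qed.

Variables (B Kp : R).
Hypotheses (B0 : 0 < B).
Hypothesis psiB : forall i, `|psi i| <= B.
Hypothesis psiK : seq_holder a h Kp psi.

Lemma drift_holder u (L S : R) : (forall i, `|dif u i| <= L * h) ->
  (forall i, `|dsec u i| <= S) ->
  (forall i, `|psi i * (dvel u i - h / 2 * dsec u i)| <= B * L) /\
  seq_holder a h (Kp * L + B * (2 * L + S))
    (fun i => psi i * (dvel u i - h / 2 * dsec u i)).
Proof.
move=> uL uS.
have hN : h != 0 by rewrite gt_eqF.
have vE i : dvel u i - h / 2 * dsec u i = (dif u i.+1 + dif u i) / (2 * h).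
  by rewrite /dvel /dsec; field.
have vL i : `|dvel u i - h / 2 * dsec u i| <= L.
  rewrite vE normrM [`|_^-1|]gtr0_norm ?invr_gt0 ?mulr_gt0// ler_pdivrMr ?mulr_gt0//.
  apply: (le_trans (ler_normD _ _)); have := uL i; have := uL i.+1; lra.
have difS i : `|dif u i.+1 - dif u i| <= S * h ^+ 2.
  have := uS i; rewrite /dsec normrM [`|_^-1|]gtr0_norm ?invr_gt0 ?exprn_gt0//.
  by rewrite ler_pdivrMr ?exprn_gt0.
have B0' := ltW B0.
split=> [i|]; first by rewrite normrM ler_pM.
apply: seq_holderM => //; apply: seq_holder_lip => //; apply: lip_of_steps => i.
rewrite !vE -mulrBl normrM [`|_^-1|]gtr0_norm ?invr_gt0 ?mulr_gt0// ler_pdivrMr ?mulr_gt0//.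
have := difS i; have := difS i.+1.
have := ler_normD (dif u i.+2 - dif u i.+1) (dif u i.+1 - dif u i).
rewrite (_ : dif u i.+2 + dif u i.+1 - (dif u i.+1 + dif u i) = dif u i.+2 - dif u i.+1 + (dif u i.+1 - dif u i)); last by ring.
lra.
Qed.

(** The radial Laplacian [f] is the generator plus the drift term, and [(m + 1) * drat] is its
    weighted average. Bounds come before Hölder bounds, because the drift term is Hölder only once
    [dsec] is bounded. Comparing [f] with its average controls [dsec - drat] near the origin. *)
Lemma discrete_schauder u (L C K : R) :
  (forall i, `|dif u i| <= L * h) -> (forall i, `|gen m h psi u i| <= C) ->
  seq_holder a h K (gen m h psi u) ->
  let F := C + B * L in let S := (m%:R + 1) * F in
  let K' := K + (Kp * L + B * (2 * L + S)) in
  [/\ forall i, `|drat u i| <= F, forall i, `|dsec u i| <= S,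
   seq_holder a h (K' / a) (drat u), seq_holder a h (K' + m%:R * (K' / a)) (dsec u) &
   forall i : nat, `|dsec u i - drat u i| <= K' * (i%:R * h) `^ a].
Proof.
move=> uL uC uK F S K'.
pose q : R := m%:R + 1.
have q0 : 0 < q by rewrite /q natr1.
have L0 : 0 <= L by have := le_trans (normr_ge0 _) (uL 0%N); rewrite pmulr_lge0.
have C0 : 0 <= C := le_trans (normr_ge0 _) (uC 0%N).
have F0 : 0 <= F by rewrite addr_ge0// mulr_ge0// ltW.
pose f i := dsec u i + m%:R * drat u i.
have m0 : 0 <= m%:R :> R by [].
have fE i : f i = gen m h psi u i + psi i * (dvel u i - h / 2 * dsec u i).
  by rewrite genE /f; ring.
have hN : h != 0 by rewrite gt_eqF.
have vL i : `|dvel u i - h / 2 * dsec u i| <= L.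
  have -> : dvel u i - h / 2 * dsec u i = (dif u i.+1 + dif u i) / (2 * h).
    by rewrite /dvel /dsec; field.
  rewrite normrM [`|_^-1|]gtr0_norm ?invr_gt0 ?mulr_gt0// ler_pdivrMr ?mulr_gt0//.
  apply: (le_trans (ler_normD _ _)); have := uL i; have := uL i.+1; lra.
have fF i : `|f i| <= F.
  rewrite fE; apply: (le_trans (ler_normD _ _)); apply: lerD => //.
  by rewrite normrM ler_pM.
pose e i := q * drat u i.
have e0 : e 0%N = f 0%N by rewrite /e drat_rec0 /q addrK.
have eS (i : nat) : (i.+1%:R + q) * e i.+1 = i.+1%:R * e i + q * f i.+1.
  by rewrite /e drat_rec// /q addrK.
have eF := avg_bound q0 e0 eS fF.
have wF i : `|drat u i| <= F.
  have := eF i; rewrite /e normrM gtr0_norm//; apply: le_trans.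
  by rewrite ler_peMl// /q lerDr.
have sS i : `|dsec u i| <= S.
  have -> : dsec u i = f i - m%:R * drat u i by rewrite /f; ring.
  apply: (le_trans (ler_normB _ _)); rewrite [`|m%:R * _|]normrM normr_nat.
  have := ler_wpM2l m0 (wF i); have := fF i; rewrite /S; lra.
have fK : seq_holder a h K' f.
  have [_ dK] := drift_holder uL sS.
  by have := seq_holderD uK dK; rewrite /seq_holder => H j d; rewrite !fE; exact: H.
have eK := avg_holder a01 h0 q0 e0 eS fK.
have wK : seq_holder a h (K' / a) (drat u).
  by move=> j d; have := eK j d; rewrite /e -mulrBr normrM gtr0_norm// -!mulrA ler_pM2l// mulrA.
split=> //.
- move=> j d; have := seq_holderD fK (seq_holderZ (- m%:R) wK) j d.
  rewrite normrN normr_nat.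
  rewrite (_ : f (j + d)%N + _ - _ = dsec u (j + d)%N - dsec u j)//.
  by rewrite /f; ring.
- move=> i; have := avg_near a01 h0 q0 e0 eS fK (leqnn i).
  rewrite (_ : f i - e i = dsec u i - drat u i)//.
  by rewrite /f /e /q; ring.
Qed.

End DiscreteRegularity.

(** [C] is fixed before [h], [psi] and [u], as the limit of vanishing mesh requires; it sums the
    absolute values of all constants that occur. *)
Lemma discrete_bounds_iter (R : realType) (a : R) (m : nat) (B Kp M0 L0 S0 K0 : R) :
  0 < a < 1 -> 0 < B -> exists C : R, forall (h : R) (psi u : nat -> R),
  0 < h -> 8 * B * h <= 1 -> (forall i, `|psi i| <= B) -> seq_holder a h Kp psi ->
  (forall i, `|u i| <= M0) -> (forall i, `|dif u i| <= L0 * h) ->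
  (forall i, `|dsec h u i| <= S0) -> seq_holder a h K0 (dsec h u) ->
  (forall k, discrete_bounds a h m psi C (iter k (step m h psi) u)) /\
  (forall k l i, `|gen m h psi (iter (l + k)%N (step m h psi) u) i
                 - gen m h psi (iter k (step m h psi) u) i|
      <= C * (l%:R * (h ^+ 2 / m.+4%:R)) `^ (a / 2)).
Proof.
move=> a01 B0; have a0 : 0 < a by case/andP: a01.
pose G := (m%:R + 1) * S0 + B * L0.
pose KG := K0 + m%:R * (K0 / a) + (Kp * L0 + B * (2 * L0 + S0)).
pose KG' := 3 * KG + 16 * G * B + 2 * G.
pose KT := KG' + (KG' + 2 * G) * (2 * m%:R + 2 + 2 * B) + 2 * G.
pose L := 2 * L0 + 16 * M0 * B.
pose F := G + B * L; pose S := (m%:R + 1) * F.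
pose K' := KG' + (Kp * L + B * (2 * L + S)).
pose s := [:: M0; G; KG'; KT; L; F; S; K'; K' / a; K' + m%:R * (K' / a)].
pose C := \sum_(x <- s) `|x|.
have sC x : x \in s -> x <= C.
  move=> xs; apply: (le_trans (ler_norm _)); rewrite /C (big_rem x)//=.
  by rewrite lerDl sumr_ge0.
exists C => h psi u h0 Bh psiB psiK uM uL uS uK.
have hS0 : 0 <= S0 := le_trans (normr_ge0 _) (uS 0%N).
have hL0 : 0 <= L0 by have := le_trans (normr_ge0 _) (uL 0%N); rewrite pmulr_lge0.
have m0 : 0 <= m%:R :> R by [].
(* The averaging identity with [q = 1]: regularity of [dsec] alone gives that of [drat], and so of
   the generator at the initial time. *)
have [w0 wS] : drat h u 0%N = dsec h u 0%N /\ forall i : nat,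
    (i.+1%:R + 1) * drat h u i.+1 = i.+1%:R * drat h u i + 1 * dsec h u i.+1.
  split; first by have := drat_rec0 h u 1; rewrite subrr mul0r addr0 mul1r.
  by move=> i; have := drat_rec h0 u ltr01 i; rewrite subrr mul0r addr0 !mul1r.
have wB := avg_bound ltr01 w0 wS uS.
have wK := avg_holder a01 h0 ltr01 w0 wS uK.
rewrite mul1r in wK.
have [dB dK] := drift_holder h0 a01 B0 psiB psiK uL uS.
have gB i : `|gen m h psi u i| <= G.
  rewrite genE//; apply: (le_trans (ler_normB _ _)); apply: lerD => //.
  apply: (le_trans (ler_normD _ _)); rewrite [`|m%:R * _|]normrM normr_nat.
  by have := ler_wpM2l m0 (wB i); have := uS i; lra.
have gK : seq_holder a h KG (gen m h psi u).
  move=> j d; have H := seq_holderD (seq_holderD uK (seq_holderZ m%:R wK)) (seq_holderZ (-1) dK) j d.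
  move: H; rewrite normrN normr1 mul1r normr_nat !genE// !mulN1r.
  exact: le_trans.
have gIter k i : gen m h psi (iter k (step m h psi) u) i =
    iter k (step m h psi) (gen m h psi u) i.
  elim: k i => //= k IH i; rewrite gen_step; exact: eq_step.
have gKk k := iter_step_holder m a01 h0 B0 Bh psiB gB gK k.
have gBk k := iter_step_bound m h0 B0 Bh psiB k gB.
split=> [k|k l i]; last first.
  rewrite !gIter iterD; apply: (le_trans (iter_step_time_holder m a01 h0 B0 Bh psiB (gBk k) (gKk k) l i)).
  by rewrite ler_wpM2r ?powR_ge0// sC// !inE eqxx ?orbT.
have ukL i : `|dif (iter k (step m h psi) u) i| <= L * h.
  have := iter_step_lip m h0 B0 Bh psiB uM hL0 _ k i.-1 1%N.
  rewrite mul1r addn1 /dif; case: i => [|i] H /=.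
    rewrite subrr normr0 (le_trans (normr_ge0 _) (H _))//.
    apply: lip_of_steps => // j; exact: (uL j.+1).
  apply: H; apply: lip_of_steps => // j; exact: (uL j.+1).
have gkB i : `|gen m h psi (iter k (step m h psi) u) i| <= G by rewrite gIter.
have gkK : seq_holder a h KG' (gen m h psi (iter k (step m h psi) u)).
  by move=> j d; rewrite !gIter; exact: gKk.
have [H1 H2 H3 H4 H5] := discrete_schauder h0 a01 B0 psiB psiK ukL gkB gkK.
split; split.
- move=> i; apply: (le_trans (iter_step_bound m h0 B0 Bh psiB k uM i)).
  by rewrite sC// !inE eqxx ?orbT.
- move=> i; apply: (le_trans (ukL i)).
  by rewrite ler_wpM2r ?(ltW h0)// sC// !inE eqxx ?orbT.
- by move=> i; apply: (le_trans (H1 i)); rewrite sC// !inE eqxx ?orbT.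
- by move=> i; apply: (le_trans (H2 i)); rewrite sC// !inE eqxx ?orbT.
- by move=> i; apply: (le_trans (gkB i)); rewrite sC// !inE eqxx ?orbT.
- by apply: (seq_holder_le _ H3); rewrite sC// !inE eqxx ?orbT.
- by apply: (seq_holder_le _ H4); rewrite sC// !inE eqxx ?orbT.
- by apply: (seq_holder_le _ gkK); rewrite sC// !inE eqxx ?orbT.
- move=> i; apply: (le_trans (H5 i)).
  by rewrite ler_wpM2r ?powR_ge0// sC// !inE eqxx ?orbT.
Qed.

(** * The continuum limit *)

(* [V], [W], [Z], [G] stand for [U_r], [U_r / r], [U_rr] and [U_t]. *)
Record radial_profile (R : realType) (a : R) (m : nat) (psi : R -> R) (C : R)
    (U V W Z G : R -> R -> R) : Prop := RadialProfile {
  prof_C : 0 <= C;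
  prof_bound : forall r t : R, 0 <= r -> 0 <= t ->
    [/\ `|U r t| <= C, `|V r t| <= C, `|W r t| <= C, `|Z r t| <= C & `|G r t| <= C];
  prof_V : forall r t : R, 0 <= r -> 0 <= t -> V r t = r * W r t;
  prof_eq : forall r t : R, 0 <= r -> 0 <= t ->
    Z r t + m%:R * W r t - psi r * V r t = G r t;
  prof_holder : forall r s t : R, 0 <= r -> r <= s -> 0 <= t ->
    [/\ `|W s t - W r t| <= C * (s - r) `^ a, `|Z s t - Z r t| <= C * (s - r) `^ a &
     `|G s t - G r t| <= C * (s - r) `^ a];
  prof_ZW : forall r t : R, 0 <= r -> 0 <= t -> `|Z r t - W r t| <= C * r `^ a;
  prof_dU : forall r s t : R, 0 <= r -> r <= s -> 0 <= t ->
    `|U s t - U r t - (s - r) * V r t| <= C * (s - r) ^+ 2;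
  prof_dV : forall r s t : R, 0 <= r -> r <= s -> 0 <= t ->
    `|V s t - V r t - (s - r) * Z r t| <= C * ((s - r) * (s - r) `^ a);
  prof_Gt : forall r s t : R, 0 <= r -> 0 <= s -> s <= t ->
    `|G r t - G r s| <= C * (t - s) `^ (a / 2);
  prof_dUt : forall r s t : R, 0 <= r -> 0 <= s -> s <= t ->
    `|U r t - U r s - (t - s) * G r s| <= C * ((t - s) * (t - s) `^ (a / 2))
}.

Section ContinuumLimit.
Variables (R : realType) (a : R) (m : nat) (psi U0 U2 : R -> R).
Variables (B Kp M0 L0 M2 K2 : R).
Hypotheses (a01 : 0 < a < 1) (B1 : 1 <= B).
Hypothesis psiB : forall r : R, 0 <= r -> `|psi r| <= B.
Hypothesis psiK : forall r s : R, 0 <= r -> 0 <= s -> `|psi r - psi s| <= Kp * `|r - s| `^ a.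
Hypothesis U0M : forall r, `|U0 r| <= M0.
Hypothesis U0even : forall r, U0 (- r) = U0 r.
Hypothesis U0L : forall r s, `|U0 r - U0 s| <= L0 * `|r - s|.
Hypothesis U2M : forall r, `|U2 r| <= M2.
Hypothesis U2K : forall r s, `|U2 r - U2 s| <= K2 * `|r - s| `^ a.
Hypothesis U02 : forall r h : R, 0 < h ->
  `|U0 (r + h) - 2 * U0 r + U0 (r - h) - h ^+ 2 * U2 r| <= K2 * h ^+ 2 * h `^ a.

Let a0 : 0 < a. Proof. by case/andP: a01. Qed.
Let B0 : 0 < B. Proof. by apply: lt_le_trans B1. Qed.

(** Mesh widths satisfying the condition [8 * B * h <= 1] of the coupling. *)
Let hh (N : nat) : R := (8 * B * N.+1%:R)^-1.
Let tau (N : nat) : R := hh N ^+ 2 / m.+4%:R.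
Let node (N i : nat) : R := (i%:R + 1 / 2) * hh N.
Let un (N k : nat) := iter k (step m (hh N) (psi \o node N)) (U0 \o node N).

Let hh_gt0 N : 0 < hh N. Proof. by rewrite invr_gt0 !mulr_gt0. Qed.
Let tau_gt0 N : 0 < tau N. Proof. by rewrite divr_gt0// exprn_gt0. Qed.
Let node_ge0 N i : 0 <= node N i.
Proof. by rewrite mulr_ge0 ?(ltW (hh_gt0 N))// addr_ge0. Qed.

Let hh_le N : 8 * B * hh N <= 1.
Proof.
have B8 : 8 * B != 0 by rewrite mulf_neq0// gt_eqF.
by rewrite /hh invfM mulrA mulfV// mul1r invf_le1// ler1n.
Qed.

Let hh_le1 N : hh N <= 1.
Proof.
have := hh_le N; have := hh_gt0 N; have := B1 => H1 H2.
have : 1 * hh N <= B * hh N by rewrite ler_wpM2r// ltW.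
lra.
Qed.

Let cvg_hh : hh @ \oo --> (0 : R).
Proof.
rewrite (_ : hh = fun N => (8 * B)^-1 * N.+1%:R^-1); last by apply/funext => N; rewrite /hh invfM.
rewrite -(mulr0 (8 * B)^-1); apply: cvgMr; exact: cvg_harmonic.
Qed.

Let discrete : exists2 C : R, 0 <= C & forall N,
  (forall k, discrete_bounds a (hh N) m (psi \o node N) C (un N k)) /\
  (forall k l i, `|gen m (hh N) (psi \o node N) (un N (l + k)) i
                 - gen m (hh N) (psi \o node N) (un N k) i|
      <= C * (l%:R * tau N) `^ (a / 2)).
Proof.
have [C HC] := @discrete_bounds_iter R a m B Kp M0 L0 (M2 + K2) (3 * K2) a01 B0.
have K20 : 0 <= K2.
  have := le_trans (normr_ge0 _) (U2K 1 0).
  by rewrite subr0 normr1 powR1 mulr1.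
have H N : (forall k, discrete_bounds a (hh N) m (psi \o node N) C (un N k)) /\
  (forall k l i, `|gen m (hh N) (psi \o node N) (un N (l + k)) i
                 - gen m (hh N) (psi \o node N) (un N k) i|
      <= C * (l%:R * tau N) `^ (a / 2)).
  have h0 := hh_gt0 N; set h := hh N in h0 *.
  have dnode j d : `|node N (j + d) - node N j| = d%:R * h.
    rewrite /node -/h natrD -mulrBl (_ : _ - _ = d%:R); last by ring.
    by rewrite normrM normr_nat gtr0_norm.
  have secE i : dsec h (U0 \o node N) i * h ^+ 2 =
     U0 (node N i + h) - 2 * U0 (node N i) + U0 (node N i - h).
    rewrite /dsec -mulrA mulVf ?mulr1 ?expf_neq0 ?gt_eqF//.
    have -> : node N i + h = node N i.+1 by rewrite /node -/h -natr1; ring.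
    case: i => [|i].
      rewrite /dif /= subrr subr0.
      (* The ghost node [- h / 2] mirrors node 0, so for the even function [U0] the reflected
         difference is a genuine second difference. *)
      have -> : node N 0 - h = - node N 0 by rewrite /node -/h; field.
      by rewrite U0even; ring.
    have -> : node N i.+1 - h = node N i by rewrite /node -/h -natr1; ring.
    by rewrite /dif /=; ring.
  have secB i : `|dsec h (U0 \o node N) i - U2 (node N i)| <= K2 * h `^ a.
    have h2 : 0 < h ^+ 2 by rewrite exprn_gt0.
    rewrite -(ler_pM2r h2) -{1}(gtr0_norm h2) -normrM mulrBl secE.
    have := @U02 (node N i) h h0; rewrite [U2 _ * _]mulrC => /le_trans; apply.
    by rewrite mulrAC.
  apply: HC => //; first exact: hh_le.
  - by move=> i; apply: psiB.
  - by move=> j d /=; have := @psiK _ _ (node_ge0 N (j + d)) (node_ge0 N j); rewrite dnode.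
  - by move=> i; exact: U0M.
  - case=> [|i]; rewrite /dif /=.
      rewrite subrr normr0 mulr_ge0 ?(ltW h0)//.
      by have := le_trans (normr_ge0 _) (U0L 1 0); rewrite subr0 normr1 mulr1.
    by have := U0L (node N i.+1) (node N i); rewrite -{2}addn1 dnode mul1r.
  - move=> i; have := secB i; have := U2M (node N i).
    have := ler_normD (dsec h (U0 \o node N) i - U2 (node N i)) (U2 (node N i)).
    have : K2 * h `^ a <= K2 * 1.
      rewrite ler_wpM2l//; have <- : 1 `^ a = 1 :> R by rewrite powR1.
      by apply: ge0_ler_powR; rewrite ?nnegrE ?(ltW a0) ?(ltW h0)// hh_le1.
    rewrite subrK; lra.
  - move=> j [|d]; first by rewrite addn0 subrr normr0 mulr_ge0 ?powR_ge0//; lra.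
    (* Distinct nodes are at least [h] apart, so two consistency errors [K2 h^a] and the modulus of
       [U2] add up to [3 * K2]. *)
    have : K2 * h `^ a <= K2 * (d.+1%:R * h) `^ a.
      rewrite ler_wpM2l//; apply: ge0_ler_powR; rewrite ?nnegrE ?mulr_ge0 ?(ltW a0) ?(ltW h0)//.
      by rewrite ler_peMl ?(ltW h0)// ler1n.
    have := U2K (node N (j + d.+1)) (node N j); rewrite dnode.
    have := secB j; have := secB (j + d.+1)%N.
    set x := dsec _ _ _; set y := dsec _ _ _; set x' := U2 _; set y' := U2 _.
    have := ler_normD (x - x') ((x' - y') - (y - y')).
    have := ler_normB (x' - y') (y - y').
    rewrite (_ : x - x' + _ = x - y); last by ring.
    lra.
exists C => //; have [[H1 _ _ _ _] _] := (H 0%N).1 0%N.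
exact: le_trans (normr_ge0 _) (H1 0%N).
Qed.

Let taylor (f : nat -> R) (d c w : R) (j D : nat) :
  (forall l, (l < D)%N -> `|f (j + l).+1 - f (j + l)%N - d * c| <= d * w) ->
  `|f (j + D)%N - f j - D%:R * d * c| <= D%:R * d * w.
Proof. by move/discrete_taylor; rewrite !mulrA. Qed.

Let idx (x d : R) : nat := Num.truncn (x / d).

Let idx_le (x d : R) : 0 <= x -> 0 < d -> (idx x d)%:R * d <= x.
Proof.
move=> x0 d0; rewrite -ler_pdivlMr//.
by have /andP[] := truncn_itv (divr_ge0 x0 (ltW d0)).
Qed.

Let idx_gt (x d : R) : 0 <= x -> 0 < d -> x < (idx x d)%:R * d + d.
Proof.
move=> x0 d0; have -> : (idx x d)%:R * d + d = (idx x d).+1%:R * d by rewrite -natr1; ring.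
rewrite -ltr_pdivrMr//.
by have /andP[] := truncn_itv (divr_ge0 x0 (ltW d0)).
Qed.

Let idx_mono (x y d : R) : 0 <= x -> x <= y -> 0 < d -> (idx x d <= idx y d)%N.
Proof. by move=> x0 xy d0; apply: le_truncn; rewrite ler_wpM2r// invr_ge0 ltW. Qed.

Let idx_dist (x y d : R) : 0 <= x -> x <= y -> 0 < d ->
  `|(idx y d - idx x d)%:R * d - (y - x)| <= d.
Proof.
move=> x0 xy d0; rewrite natrB ?idx_mono//.
have := idx_le x0 d0; have := idx_gt x0 d0.
have := idx_le (le_trans x0 xy) d0; have := idx_gt (le_trans x0 xy) d0.
by rewrite ler_norml => ? ? ? ?; apply/andP; split; lra.
Qed.

Let cvg_tau : tau @ \oo --> (0 : R).
Proof.
rewrite (_ : tau = fun N => m.+4%:R^-1 * (hh N * hh N)); last first.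
  by apply/funext => N; rewrite /tau expr2 mulrC.
have := @cvgMr _ _ _ _ _ m.+4%:R^-1 _ (cvgM cvg_hh cvg_hh).
by rewrite !mulr0; apply.
Qed.

Let cvg_pow (d : nat -> R) (b : R) : (forall N, 0 < d N) -> 0 < b ->
  d @ \oo --> (0 : R) -> (d N) `^ b @[N --> \oo] --> (0 : R).
Proof.
move=> dp b0 d0.
have dr : d @ \oo --> (0 : R)^'+.
  move=> A; rewrite /at_right /within /= => /d0; rewrite /nbhs/= => H.
  near=> N; apply: (near H N) => //; exact: dp.
exact: (cvg_comp _ _ dr (powR_cvg0 b0)).
Unshelve. all: by end_near. Qed.

(** Limits are pointwise, at the rounded indices of [r] and [t], and no equicontinuity is invoked:
    every field of the record is the limit of a discrete inequality with constants independent of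
    the mesh. *)
Lemma radial_profile_exists : exists (C : R) (U V W Z G : R -> R -> R),
  [/\ radial_profile a m psi C U V W Z G,
      forall r : R, 0 <= r -> U r 0 = U0 r,
      (forall r : R, 0 <= r -> 0 <= U0 r) -> forall r t : R, 0 <= r -> 0 <= t -> 0 <= U r t &
      (forall r s : R, 0 <= r -> r <= s -> U0 s <= U0 r) ->
        forall r s t : R, 0 <= r -> r <= s -> 0 <= t -> U s t <= U r t].
Proof.
have [C C0 HC] := discrete.
(* One ultrafilter makes all the bounded sequences below converge at once. *)
have [F [UF FF]] := ultraFilterLemma eventually_filter.
have PF : ProperFilter F by case: UF.
have toF (x : nat -> R) (l : R) : x @ \oo --> l -> x @ F --> l.
  by move=> xl A /xl; exact: FF.
have ulimP (x : nat -> R) (M : R) : (forall N, `|x N| <= M) -> x @ F --> lim (x @ F).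
  move=> xM; suff: cvg (x @ F) by [].
  have cpt := @segment_compact R (- M) M.
  have [|p [_ pF]] := cpt (x @ F) (fmap_proper_filter x PF).
    by apply: (@filterE _ F) => N; have := xM N; rewrite ler_norml /= in_itv/=.
  apply/cvg_ex; exists p => A nA.
  have [//|FA] := in_ultra_setVsetC (x @^-1` A) UF.
  by have [q [/= nq qA]] := pF (~` A) A FA nA; case: (nq qA).
have squeeze (x e : nat -> R) (l : R) : (forall N, `|x N - l| <= e N) -> e @ \oo --> (0 : R) ->
    x @ F --> l.
  move=> xe e0; apply: toF.
  apply: (@squeeze_cvgr _ _ _ _ (fun N => l - e N) (fun N => l + e N)).
  - by apply: nearW => N; have := xe N; rewrite ler_norml => /andP[? ?]; apply/andP; split; lra.
  - rewrite -[X in _ --> X]subr0; apply: cvgB => //; exact: cvg_cst.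
  - rewrite -[X in _ --> X]addr0; apply: cvgD => //; exact: cvg_cst.
have le_lim (x y : nat -> R) (lx ly : R) : x @ F --> lx -> y @ F --> ly ->
    (forall N, x N <= y N) -> lx <= ly.
  by move=> xl yl xy; apply: (ler_cvg_to xl yl); exact: nearW.
pose Iq r N := idx r (hh N); pose Kq t N := idx t (tau N).
pose Uq r t N := un N (Kq t N) (Iq r N).
pose Vq r t N := dvel (hh N) (un N (Kq t N)) (Iq r N).
pose Wq r t N := drat (hh N) (un N (Kq t N)) (Iq r N).
pose Zq r t N := dsec (hh N) (un N (Kq t N)) (Iq r N).
pose Gq r t N := gen m (hh N) (psi \o node N) (un N (Kq t N)) (Iq r N).
have bU r t N : `|Uq r t N| <= C by have [[H1 _ _ _ _] _] := (HC N).1 (Kq t N); exact: H1.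
have bV r t N : `|Vq r t N| <= C.
  have [[_ H _ _ _] _] := (HC N).1 (Kq t N).
  rewrite /Vq /dvel normrM normfV (gtr0_norm (hh_gt0 N)) ler_pdivrMr ?hh_gt0//; exact: H.
have bW r t N : `|Wq r t N| <= C by have [[_ _ H1 H2 H3] _] := (HC N).1 (Kq t N); exact: H1.
have bZ r t N : `|Zq r t N| <= C by have [[_ _ H1 H2 H3] _] := (HC N).1 (Kq t N); exact: H2.
have bG r t N : `|Gq r t N| <= C by have [[_ _ H1 H2 H3] _] := (HC N).1 (Kq t N); exact: H3.
have lU r t := ulimP _ _ (bU r t).
have lV r t := ulimP _ _ (bV r t).
have lW r t := ulimP _ _ (bW r t).
have lZ r t := ulimP _ _ (bZ r t).
have lG r t := ulimP _ _ (bG r t).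
have cC (c : R) : (fun _ : nat => c) @ F --> c by exact: cvg_cst.
have bnd (x : nat -> R) (l : R) : x @ F --> l -> (forall N, `|x N| <= C) -> `|l| <= C.
  by move=> xl xC; apply: (le_lim _ _ _ _ (cvg_norm xl) (cC C)).
have hh0 := toF _ _ cvg_hh.
have ha0 := toF _ _ (cvg_pow hh_gt0 a0 cvg_hh).
have ta0 := toF _ _ (cvg_pow tau_gt0 (divr_gt0 a0 (ltr0Sn _ 1)) cvg_tau).
have a201 : 0 < a / 2 < 1 by case/andP: a01 => ? ?; apply/andP; split; lra.
have dI (r s : R) : 0 <= r -> r <= s -> (Iq s N - Iq r N)%:R * hh N @[N --> F] --> s - r.
  move=> r0 rs; apply: (squeeze _ hh) => // N; exact: idx_dist.
have dK (s t : R) : 0 <= s -> s <= t -> (Kq t N - Kq s N)%:R * tau N @[N --> F] --> t - s.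
  move=> s0 st; apply: (squeeze _ tau) => // N; exact: idx_dist.
(* Rounding changes a distance by at most one mesh width; subadditivity of the power splits this off
   as a term that vanishes in the limit. *)
have pw (b x y : R) (d : nat -> R) N : 0 < b < 1 -> 0 <= x -> x <= y -> 0 < d N ->
    ((idx y (d N) - idx x (d N))%:R * d N) `^ b <= (y - x) `^ b + (d N) `^ b.
  move=> b01 x0 xy dp; have xy0 : 0 <= y - x by rewrite subr_ge0.
  apply: le_trans (powR_subadd b01 xy0 (ltW dp)).
  apply: ge0_ler_powR; rewrite ?nnegrE.
  - by case/andP: b01 => /ltW.
  - by rewrite mulr_ge0// ltW.
  - by rewrite addr_ge0// ltW.
  - by have := idx_dist x0 xy dp; rewrite ler_norml => /andP[? ?]; lra.
have lP (x b : R) (d : nat -> R) : d @ F --> (0 : R) -> C * (x `^ b + d N) @[N --> F] --> C * x `^ b.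
  move=> d0; have -> : C * x `^ b = C * (x `^ b + 0) by rewrite addr0.
  apply: cvgMr; exact: cvgD.
have holdq (f : nat -> nat -> R) (lf : R -> R) (r s : R) : 0 <= r -> r <= s ->
    (forall N, seq_holder a (hh N) C (f N)) ->
    (forall x, f N (Iq x N) @[N --> F] --> lf x) -> `|lf s - lf r| <= C * (s - r) `^ a.
  move=> r0 rs fH fl.
  apply: (le_lim _ _ _ _ (cvg_norm (cvgB (fl s) (fl r))) (lP (s - r) a _ ha0)) => N.
  have IJ : (Iq r N <= Iq s N)%N by exact: idx_mono.
  have := fH N (Iq r N) (Iq s N - Iq r N)%N; rewrite subnKC// => /le_trans; apply.
  by rewrite ler_wpM2l//; exact: (pw a r s hh N).
exists C, (fun r t => lim (Uq r t @ F)), (fun r t => lim (Vq r t @ F)),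
  (fun r t => lim (Wq r t @ F)), (fun r t => lim (Zq r t @ F)), (fun r t => lim (Gq r t @ F)).
have cI (r : R) : 0 <= r -> (Iq r N)%:R * hh N @[N --> F] --> r.
  move=> r0; apply: (squeeze _ hh) => // N.
  have := idx_le r0 (hh_gt0 N); have := idx_gt r0 (hh_gt0 N).
  by rewrite ler_norml => ? ?; apply/andP; split; lra.
have nodeB (r : R) N : 0 <= r -> `|node N (Iq r N) - r| <= hh N.
  move=> r0; have := idx_le r0 (hh_gt0 N); have := idx_gt r0 (hh_gt0 N).
  by rewrite /node ler_norml => ? ?; apply/andP; split; lra.
have VqE r t N : Vq r t N = ((Iq r N)%:R * hh N + hh N) * Wq r t N.
  by rewrite /Vq dvelE ?hh_gt0// -natr1 mulrDl mul1r.
split; first split=> //.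
- by move=> r t r0 t0; split; [exact: bnd (lU r t) _|exact: bnd (lV r t) _|
    exact: bnd (lW r t) _|exact: bnd (lZ r t) _|exact: bnd (lG r t) _].
- move=> r t r0 t0; apply/(cvg_lim (@Rhausdorff R)).
  rewrite (_ : Vq r t = fun N => ((Iq r N)%:R * hh N + hh N) * Wq r t N); last first.
    by apply/funext => N.
  have -> : r * lim (Wq r t @ F) = (r + 0) * lim (Wq r t @ F) by rewrite addr0.
  by apply: cvgM => //; apply: cvgD => //; exact: cI.
- move=> r t r0 t0; apply/esym/(cvg_lim (@Rhausdorff R)).
  rewrite (_ : Gq r t = fun N => (Zq r t N + m%:R * Wq r t N)
      - psi (node N (Iq r N)) * (Vq r t N - hh N / 2 * Zq r t N)); last first.
    by apply/funext => N; rewrite /Gq genE ?hh_gt0.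
  (* The written-out zero is the limit of the centring correction [h / 2 * dsec]. *)
  have -> : psi r * lim (Vq r t @ F) = psi r * (lim (Vq r t @ F) - 0 / 2 * lim (Zq r t @ F)).
    by rewrite mul0r mul0r subr0.
  apply: cvgB; first by apply: cvgD => //; exact: cvgMr.
  apply: cvgM.
    apply: (squeeze _ (fun N => Kp * hh N `^ a)) => [N|].
      have Kp0 : 0 <= Kp.
        have := le_trans (normr_ge0 _) (psiK ler01 (lexx 0)).
        by rewrite subr0 normr1 powR1 mulr1.
      apply: (le_trans (psiK _ _)) => //; rewrite ler_wpM2l//.
      by apply: ge0_ler_powR; rewrite ?nnegrE ?(ltW a0) ?(ltW (hh_gt0 N)) ?nodeB.
    by rewrite -(mulr0 Kp); apply: cvgMr; exact: cvg_pow.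
  apply: cvgB => //; apply: cvgM => //; exact: (cvgM hh0 (cC 2^-1)).
- move=> r s t r0 rs t0; split.
  + apply: (holdq (fun N => drat (hh N) (un N (Kq t N))) (fun r => lim (Wq r t @ F))) => //.
      by move=> N; have [_ []] := (HC N).1 (Kq t N).
    by move=> x; exact: lW.
  + apply: (holdq (fun N => dsec (hh N) (un N (Kq t N))) (fun r => lim (Zq r t @ F))) => //.
      by move=> N; have [_ []] := (HC N).1 (Kq t N).
    by move=> x; exact: lZ.
  + apply: (holdq (fun N => gen m (hh N) (psi \o node N) (un N (Kq t N))) (fun r => lim (Gq r t @ F))) => //.
      by move=> N; have [_ []] := (HC N).1 (Kq t N).
    by move=> x; exact: lG.
- move=> r t r0 t0; apply: (le_lim _ _ _ _ (cvg_norm (cvgB (lZ r t) (lW r t))) (cC (C * r `^ a))) => N.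
  have [_ [_ _ _ H]] := (HC N).1 (Kq t N); apply: (le_trans (H _)).
  rewrite ler_wpM2l//; apply: ge0_ler_powR; rewrite ?nnegrE ?mulr_ge0 ?(ltW a0) ?(ltW (hh_gt0 N))//.
  exact: idx_le.
- move=> r s t r0 rs t0.
  have L := dI r s r0 rs.
  rewrite expr2 mulrCA.
  apply: (le_lim _ _ _ _ (cvg_norm (cvgB (cvgB (lU s t) (lU r t)) (cvgM L (lV r t))))
    (cvgM L (cvgMr L))) => N.
  have [[_ _ _ H _] _] := (HC N).1 (Kq t N).
  have IJ : (Iq r N <= Iq s N)%N by exact: idx_mono.
  set D := (Iq s N - Iq r N)%N; have h0 := hh_gt0 N.
  suff : `|un N (Kq t N) (Iq s N) - un N (Kq t N) (Iq r N) - D%:R * hh N * Vq r t N|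
      <= D%:R * hh N * (C * (D%:R * hh N)) by apply.
  have := @taylor (un N (Kq t N)) (hh N) (Vq r t N) (C * (D%:R * hh N)) (Iq r N) D.
  rewrite subnKC//; apply => l lD.
  have E j : un N (Kq t N) j.+1 - un N (Kq t N) j = hh N * dvel (hh N) (un N (Kq t N)) j.
    by rewrite /dvel mulrC divfK ?gt_eqF.
  rewrite E -mulrBr normrM gtr0_norm// ler_wpM2l ?(ltW h0)//.
  apply: (@le_trans _ _ (C * (l%:R * hh N))); last first.
    by rewrite ler_wpM2l// ler_wpM2r ?(ltW h0)// ler_nat ltnW.
  apply: lip_of_steps => j.
  have -> : dvel (hh N) (un N (Kq t N)) j.+1 - dvel (hh N) (un N (Kq t N)) j =
    dsec (hh N) (un N (Kq t N)) j.+1 * hh N by rewrite /dvel /dsec; field; rewrite gt_eqF.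
  by rewrite normrM (gtr0_norm h0) ler_wpM2r// ltW.
- move=> r s t r0 rs t0.
  have L := dI r s r0 rs.
  rewrite mulrCA.
  apply: (le_lim _ _ _ _ (cvg_norm (cvgB (cvgB (lV s t) (lV r t)) (cvgM L (lZ r t))))
    (cvgM L (lP (s - r) a _ ha0))) => N.
  have [_ [_ H _ _]] := (HC N).1 (Kq t N).
  have IJ : (Iq r N <= Iq s N)%N by exact: idx_mono.
  set D := (Iq s N - Iq r N)%N; have h0 := hh_gt0 N.
  apply: (@le_trans _ _ (D%:R * hh N * (C * (D%:R * hh N) `^ a))); last first.
    apply: ler_wpM2l; first by rewrite mulr_ge0// ltW.
    by apply: ler_wpM2l => //; exact: (pw a r s hh N).
  suff : `|dvel (hh N) (un N (Kq t N)) (Iq s N) - dvel (hh N) (un N (Kq t N)) (Iq r N)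
       - D%:R * hh N * Zq r t N| <= D%:R * hh N * (C * (D%:R * hh N) `^ a) by apply.
  have := @taylor (dvel (hh N) (un N (Kq t N))) (hh N) (Zq r t N) (C * (D%:R * hh N) `^ a) (Iq r N) D.
  rewrite subnKC//; apply => l lD.
  have -> : dvel (hh N) (un N (Kq t N)) (Iq r N + l).+1 - dvel (hh N) (un N (Kq t N)) (Iq r N + l) =
    hh N * dsec (hh N) (un N (Kq t N)) (Iq r N + l).+1 by rewrite /dvel /dsec; field; rewrite gt_eqF.
  rewrite -mulrBr normrM gtr0_norm// ler_wpM2l ?(ltW h0)//.
  rewrite -addnS; apply: (le_trans (H _ _)); rewrite ler_wpM2l//.
  apply: ge0_ler_powR; rewrite ?nnegrE ?mulr_ge0 ?(ltW a0) ?(ltW h0)//.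
  by rewrite ler_wpM2r ?(ltW h0)// ler_nat.
- move=> r s t r0 s0 st.
  apply: (le_lim _ _ _ _ (cvg_norm (cvgB (lG r t) (lG r s))) (lP (t - s) (a / 2) _ ta0)) => N.
  have IJ : (Kq s N <= Kq t N)%N by exact: idx_mono.
  have := (HC N).2 (Kq s N) (Kq t N - Kq s N)%N (Iq r N).
  rewrite subnK// => /le_trans; apply; rewrite ler_wpM2l//; exact: (pw (a / 2) s t tau N).
- move=> r s t r0 s0 st.
  have L := dK s t s0 st.
  rewrite mulrCA.
  apply: (le_lim _ _ _ _ (cvg_norm (cvgB (cvgB (lU r t) (lU r s)) (cvgM L (lG r s))))
    (cvgM L (lP (t - s) (a / 2) _ ta0))) => N.
  have IJ : (Kq s N <= Kq t N)%N by exact: idx_mono.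
  set D := (Kq t N - Kq s N)%N; have h0 := tau_gt0 N.
  apply: (@le_trans _ _ (D%:R * tau N * (C * (D%:R * tau N) `^ (a / 2)))); last first.
    apply: ler_wpM2l; first by rewrite mulr_ge0// ltW.
    by apply: ler_wpM2l => //; exact: (pw (a / 2) s t tau N).
  suff : `|un N (Kq t N) (Iq r N) - un N (Kq s N) (Iq r N) - D%:R * tau N * Gq r s N|
      <= D%:R * tau N * (C * (D%:R * tau N) `^ (a / 2)) by apply.
  have := @taylor (fun k => un N k (Iq r N)) (tau N) (Gq r s N) (C * (D%:R * tau N) `^ (a / 2)) (Kq s N) D.
  rewrite subnKC//; apply => l lD.
  have -> : un N (Kq s N + l).+1 (Iq r N) - un N (Kq s N + l) (Iq r N) =
    tau N * gen m (hh N) (psi \o node N) (un N (Kq s N + l)) (Iq r N).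
    by rewrite /un iterS {1}/step [LHS]addrC addKr.
  rewrite -mulrBr normrM gtr0_norm// ler_wpM2l ?(ltW h0)//.
  rewrite addnC; apply: (le_trans ((HC N).2 _ _ _)); rewrite ler_wpM2l//.
  apply: ge0_ler_powR; rewrite ?nnegrE.
  + by case/andP: a201 => /ltW.
  + by rewrite mulr_ge0// ltW.
  + by rewrite mulr_ge0// ltW.
  + by rewrite ler_wpM2r ?(ltW h0)// ler_nat ltnW.
- move=> r r0; apply/(cvg_lim (@Rhausdorff R)); apply: (squeeze _ (fun N => L0 * hh N)) => [N|].
    have -> : Uq r 0 N = U0 (node N (Iq r N)) by rewrite /Uq /Kq /idx mul0r truncn0.
    apply: (le_trans (U0L _ _)) => /=; rewrite ler_wpM2l ?nodeB//.
    by have := le_trans (normr_ge0 _) (U0L 1 0); rewrite subr0 normr1 mulr1.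
  by rewrite -(mulr0 L0); exact: cvgMr.
- move=> U00 r t r0 t0; apply: (le_lim _ _ _ _ (cC 0) (lU r t)) => N.
  have Bh1 : B * hh N <= 1.
    by have := hh_le N; have := mulr_ge0 (ltW B0) (ltW (hh_gt0 N)); lra.
  apply: (iter_step_ge0 m (hh_gt0 N) B0 (hh_le N)).
    by move=> i; apply: psiB.
  by move=> i; apply: U00.
- move=> U0d r s t r0 rs t0; apply: (le_lim _ _ _ _ (lU s t) (lU r t)) => N.
  have IJ : (Iq r N <= Iq s N)%N by exact: idx_mono.
  have := @iter_step_decr _ m _ (psi \o node N) _ (hh_gt0 N) B0 (hh_le N) _ (U0 \o node N)
    (Kq t N) _ (Iq r N) (Iq s N - Iq r N)%N.
  rewrite subnKC//; apply; first by move=> i; apply: psiB.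
  move=> j d; apply: U0d => //; rewrite /node ler_wpM2r ?(ltW (hh_gt0 N))// lerD2r ler_nat.
  exact: leq_addr.
Qed.

End ContinuumLimit.

(** * Euclidean geometry and line derivatives *)

Section Euclid.
Variables (R : realType) (n : nat).
Implicit Types (x y z : 'rV[R]_n) (i j : 'I_n).

Lemma edotC x y : edot x y = edot y x.
Proof. by apply: eq_bigr => i _; rewrite mulrC. Qed.

Lemma edotDl x y z : edot (x + y) z = edot x z + edot y z.
Proof. by rewrite /edot -big_split; apply: eq_bigr => i _; rewrite mxE mulrDl. Qed.

Lemma edotZl (c : R) x z : edot (c *: x) z = c * edot x z.
Proof. by rewrite /edot big_distrr; apply: eq_bigr => i _; rewrite mxE /= mulrA. Qed.

Lemma edotDr x y z : edot z (x + y) = edot z x + edot z y.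
Proof. by rewrite edotC edotDl !(edotC z). Qed.

Lemma edotZr (c : R) x z : edot z (c *: x) = c * edot z x.
Proof. by rewrite edotC edotZl (edotC z). Qed.

Lemma edotBr x y z : edot z (x - y) = edot z x - edot z y.
Proof. by rewrite edotDr -[- y]scaleN1r edotZr mulN1r. Qed.

Lemma edot_delta x i : edot x (delta_mx 0 i) = x 0 i.
Proof.
rewrite /edot (bigD1 i)//= mxE !eqxx mulr1 big1 ?addr0// => j ji.
by rewrite mxE (negbTE ji) andbF mulr0.
Qed.

Lemma edot_ge0 x : 0 <= edot x x.
Proof. by apply: sumr_ge0 => i _; rewrite -expr2 sqr_ge0. Qed.

Lemma enorm_ge0 x : 0 <= enorm x. Proof. exact: sqrtr_ge0. Qed.

Lemma sqr_enorm x : enorm x ^+ 2 = edot x x.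
Proof. by rewrite sqr_sqrtr// edot_ge0. Qed.

Lemma enorm0 : enorm (0 : 'rV[R]_n) = 0.
Proof.
by rewrite /enorm /edot big1 ?sqrtr0// => i _; rewrite mxE mul0r.
Qed.

Lemma enorm0_eq0 x : enorm x = 0 -> x = 0.
Proof.
move=> x0; have : edot x x = 0 by rewrite -sqr_enorm x0 expr0n.
move=> /psumr_eq0P H; apply/rowP => i; rewrite mxE.
by apply/eqP; rewrite -sqrf_eq0 expr2; apply/eqP/H => // j _; rewrite -expr2 sqr_ge0.
Qed.

Lemma enormZ (c : R) x : enorm (c *: x) = `|c| * enorm x.
Proof. by rewrite /enorm edotZl edotZr mulrA -expr2 sqrtrM ?sqr_ge0// sqrtr_sqr. Qed.

Lemma enormN x : enorm (- x) = enorm x.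
Proof. by rewrite -scaleN1r enormZ normrN1 mul1r. Qed.

Lemma enorm_delta i : enorm (delta_mx 0 i : 'rV[R]_n) = 1.
Proof. by rewrite /enorm edot_delta mxE !eqxx sqrtr1. Qed.

Lemma sqr_enorm_line x (s : R) i :
  enorm (s *: delta_mx 0 i + x) ^+ 2 = enorm x ^+ 2 + 2 * s * x 0 i + s ^+ 2.
Proof.
rewrite !sqr_enorm edotDl !edotDr !edotZl !edotZr [edot (delta_mx _ _) x]edotC.
rewrite !edot_delta mxE !eqxx /=; ring.
Qed.

Lemma coord_le_enorm x i : `|x 0 i| <= enorm x.
Proof.
rewrite -(@ler_pXn2r _ 2)// ?nnegrE ?enorm_ge0// sqr_enorm real_normK ?num_real//.
rewrite /edot (bigD1 i)//= -expr2 lerDl.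
by apply: sumr_ge0 => j _; rewrite -expr2 sqr_ge0.
Qed.

Lemma edot_le x y : `|edot x y| <= enorm x * enorm y.
Proof.
have [y0|y0] := eqVneq (enorm y) 0.
  rewrite (enorm0_eq0 y0) enorm0 mulr0 /edot big1 ?normr0// => i _.
  by rewrite mxE mulr0.
have yp : 0 < enorm y ^+ 2 by rewrite exprn_gt0// lt_def y0 enorm_ge0.
rewrite -(@ler_pXn2r _ 2)// ?nnegrE ?mulr_ge0 ?enorm_ge0//.
rewrite real_normK ?num_real// exprMn.
have := edot_ge0 (enorm y ^+ 2 *: x + (- edot x y) *: y).
rewrite edotDl !edotDr !edotZl !edotZr -!sqr_enorm (edotC y x).
rewrite [X in 0 <= X](_ : _ =
   enorm y ^+ 2 * (enorm x ^+ 2 * enorm y ^+ 2 - edot x y ^+ 2)); last by ring.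
by rewrite pmulr_rge0// subr_ge0.
Qed.

Lemma enormD_le x y : enorm (x + y) <= enorm x + enorm y.
Proof.
rewrite -(@ler_pXn2r _ 2)// ?nnegrE ?addr_ge0 ?enorm_ge0//.
rewrite sqr_enorm edotDl !edotDr -!sqr_enorm (edotC y x).
have := le_trans (ler_norm _) (edot_le x y); lra.
Qed.

Lemma dist_enorm x y : `|enorm x - enorm y| <= enorm (x - y).
Proof.
rewrite ler_norml; apply/andP; split.
  by have := enormD_le (y - x) x; rewrite subrK -opprB enormN; lra.
by have := enormD_le (x - y) y; rewrite subrK; lra.
Qed.

Lemma enorm_line_dist x (s : R) i :
  `|enorm (s *: delta_mx 0 i + x) - enorm x| <= `|s|.
Proof.
by apply: le_trans (dist_enorm _ _) _; rewrite addrK enormZ enorm_delta mulr1.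
Qed.

Lemma mulmx_trmx_edot x y : x *m y^T = (edot x y)%:M.
Proof.
rewrite [LHS]mx11_scalar; congr (_%:M); rewrite mxE; apply: eq_bigr => i _.
by rewrite mxE.
Qed.

Lemma enorm_orthogonal (Q : 'M[R]_n) x : orthogonal_mx Q -> enorm (x *m Q) = enorm x.
Proof.
move=> QQ; congr Num.sqrt.
have dE y : edot y y = (y *m y^T) 0 0 by rewrite mulmx_trmx_edot mxE eqxx mulr1n.
by rewrite !dE trmx_mul mulmxA -(mulmxA x) QQ mulmx1.
Qed.

(* The Householder reflection exchanging two vectors of equal length. *)
Lemma orthogonal_transitive x y : enorm x = enorm y ->
  exists2 Q : 'M[R]_n, orthogonal_mx Q & x *m Q = y.
Proof.
move=> xy; pose v := x - y; have [v0|v0] := eqVneq v 0.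
  exists 1%:M; first by rewrite /orthogonal_mx trmx1 mulmx1.
  by rewrite mulmx1; apply/eqP; rewrite -subr_eq0 -/v v0.
have vv0 : edot v v != 0.
  apply: contra v0 => /eqP v0; apply/eqP/enorm0_eq0.
  by apply/eqP; rewrite -sqrf_eq0 sqr_enorm v0.
have vvE := mulmx_trmx_edot v v.
have xvE := mulmx_trmx_edot x v.
pose c := 2 / edot v v.
have [P PE] : exists P, P = v^T *m v by exists (v^T *m v).
have PT : P^T = P by rewrite PE trmx_mul trmxK.
have PP : P *m P = edot v v *: P.
  by rewrite PE mulmxA -(mulmxA _ v) vvE mul_mx_scalar -scalemxAl.
exists (1%:M - c *: P).
  have QT : (1%:M - c *: P)^T = 1%:M - c *: P.
    by apply/matrixP => i j; rewrite !mxE eq_sym; congr (_ - c * _); rewrite -{1}PT mxE.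
  rewrite /orthogonal_mx QT !(mulmxBl, mulmxBr, mul1mx, mulmx1).
  rewrite -scalemxAl -scalemxAr PP; apply/matrixP => i j; rewrite !mxE /c.
  by field.
rewrite mulmxBr mulmx1 -scalemxAr PE mulmxA xvE mul_scalar_mx scalerA.
have -> : c * edot x v = 1.
  have E : edot v v = 2 * edot x v.
    have : edot x x = edot y y by rewrite -!sqr_enorm xy.
    rewrite /v -scaleN1r edotDl !edotDr !edotZl !edotZr (edotC y x); lra.
  rewrite /c {1}E; have : edot x v != 0 by apply: contra vv0 => /eqP e; rewrite E e mulr0.
  by move=> e0; field.
by rewrite scale1r /v opprB addrC subrK.
Qed.

End Euclid.

(** * Mean value and Taylor estimates on the line *)

Section RealLine.
Variable R : realType.
Implicit Types (g : R -> R) (K s x : R).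

Lemma is_derive_continuous g (g1 : R -> R) : (forall x : R, is_derive x 1 g (g1 x)) -> continuous g.
Proof.
move=> dg x; apply: differentiable_continuous; apply/derivable1_diffP.
by have [] := dg x.
Qed.

Lemma mean_value0 g (g1 : R -> R) s : (forall x : R, is_derive x 1 g (g1 x)) ->
  exists2 c, `|c| <= `|s| & g s - g 0 = s * g1 c.
Proof.
move=> dg; have cg := is_derive_continuous dg.
have [s0|s0] := leP 0 s.
  have [c] := MVT_segment s0 (fun x _ => dg x) (continuous_subspaceT cg).
  rewrite in_itv/= => /andP[c0 cs] ->; exists c; last by rewrite subr0 mulrC.
  by rewrite !ger0_norm// (le_trans c0).
have [c] := MVT_segment (ltW s0) (fun x _ => dg x) (continuous_subspaceT cg).
rewrite in_itv/= => /andP[cs c0] E; exists c; last by rewrite -opprB E sub0r mulrN opprK mulrC.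
by rewrite !ler0_norm ?lerN2// ltW.
Qed.

Lemma mean_value_bound g (g1 : R -> R) K s : (forall x : R, is_derive x 1 g (g1 x)) ->
  (forall x, `|x| <= `|s| -> `|g1 x| <= K) -> `|g s - g 0| <= K * `|s|.
Proof.
move=> dg gK; have [c cs ->] := mean_value0 s dg.
by rewrite normrM mulrC ler_wpM2r// gK.
Qed.

Lemma second_order_expansion g (g1 g2 : R -> R) (a M s : R) : 0 < a ->
  (forall x : R, is_derive x 1 g (g1 x)) -> (forall x : R, is_derive x 1 g1 (g2 x)) ->
  (forall x, `|g2 x - g2 0| <= M * `|x| `^ a) ->
  `|g s - g 0 - s * g1 0 - s ^+ 2 / 2 * g2 0| <= M * (s ^+ 2 * `|s| `^ a).
Proof.
move=> a0 dg dg1 Hg2.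
pose f := g - (g1 0 \*: id + (g2 0 / 2) \*: (id ^+ 2)).
have df x : is_derive x 1 f (g1 x - g1 0 - x * g2 0).
  have d1 := is_deriveZ (g1 0) (@is_derive_id R R x 1).
  have d2 := is_deriveZ (g2 0 / 2) (@is_deriveX _ _ _ 2 x 1 _ (@is_derive_id R R x 1)).
  apply: (is_derive_eq (is_deriveB (dg x) (is_deriveD d1 d2))).
  rewrite /= expr1 /GRing.scale /= !mulr1; by field.
have M0 : 0 <= M.
  have := le_trans (normr_ge0 _) (Hg2 1).
  by rewrite normr1 powR1 mulr1.
rewrite [X in `|X|](_ : _ = f s - f 0); last first.
  by rewrite /f !fctE /= expr0n /= !scaler0 addr0 subr0 /GRing.scale/=; by field.
rewrite -(real_normK (num_real s)) expr2 -mulrA mulrCA [_ * (_ * _)]mulrC.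
apply: (mean_value_bound df) => x xs.
have [c cx E] := mean_value0 x dg1.
rewrite E -mulrBr normrM mulrCA; apply: ler_pM => //.
apply: (le_trans (Hg2 c)); rewrite ler_wpM2l//.
by apply: ge0_ler_powR; rewrite ?nnegrE ?(ltW a0)// (le_trans cx).
Qed.

End RealLine.

Section LineDerivative.
Variables (R : realType) (n : nat).
Implicit Types (f : 'rV[R]_n -> R) (x v : 'rV[R]_n).

Lemma small_power (C e c : R) : 0 < e -> 0 < c -> exists2 d : R, 0 < d &
  forall s, 0 <= s -> s <= d -> C * s `^ c <= e.
Proof.
move=> e0 c0; pose k := e / (`|C| + 1); have Cp : 0 < `|C| + 1 by rewrite ltr_wpDl.
have k0 : 0 < k by rewrite divr_gt0.
exists (k `^ c^-1); first exact: powR_gt0.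
move=> s s0 sd; have sk : s `^ c <= k.
  rewrite -[leRHS]powRr1 ?(ltW k0)// -(mulVf (lt0r_neq0 c0)) powRrM.
  by apply: ge0_ler_powR => //; rewrite ?nnegrE ?powR_ge0 ?(ltW c0).
have s1 := powR_ge0 s c.
have : (`|C| + 1) * s `^ c <= (`|C| + 1) * k by rewrite ler_wpM2l// ltW.
have -> : (`|C| + 1) * k = e by rewrite /k mulrCA mulfV ?mulr1// gt_eqF.
have : C * s `^ c <= `|C| * s `^ c by rewrite ler_wpM2r// ler_norm.
lra.
Qed.

Lemma derive_of_expansion (V : normedModType R) (f : V -> R) (x v : V) (L C c d : R) : 0 < c -> 0 < d ->
  (forall h : R, `|h| <= d -> `|f (h *: v + x) - f x - h * L| <= C * (`|h| * `|h| `^ c)) ->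
  derivable f x v /\ 'D_v f x = L.
Proof.
move=> c0 d0 H.
suff : h^-1 *: ((f \o shift x) (h *: v) - f x) @[h --> 0^'] --> L.
  by move=> HL; split; [apply/cvg_ex; exists L|exact: (cvg_lim (@Rhausdorff R))].
apply/cvgrPdist_le => e e0.
have [k k0 Hk] := small_power C e0 c0.
have dk : 0 < Num.min d k by rewrite lt_min d0 k0.
near=> h.
have h0 : h != 0 by near: h; exact: nbhs_dnbhs_neq.
have hd : `|h| <= Num.min d k.
  by near: h; exact: (dnbhs0_le (V:=R^o) dk).
move: hd; rewrite le_min => /andP[hd hk].
have hp : 0 < `|h| by rewrite normr_gt0.
rewrite distrC -(ler_pM2l hp) -normrM mulrBr /= mulrA mulfV// mul1r.
apply: (le_trans (H h hd)); rewrite mulrCA ler_wpM2l//.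
exact: Hk.
Unshelve. all: by end_near. Qed.

Lemma is_derive_line f v x (s : R) : derivable f (s *: v + x) v ->
  is_derive s 1 (fun s : R => f (s *: v + x)) ('D_v f (s *: v + x)).
Proof.
move=> df.
have E : (fun h : R => h^-1 *: (((fun s : R => f (s *: v + x)) \o shift s) (h *: 1) - f (s *: v + x)))
  = (fun h => h^-1 *: ((f \o shift (s *: v + x)) (h *: v) - f (s *: v + x))).
  by apply/funext => h /=; rewrite scaler1 scalerDl addrA.
apply: DeriveDef; first by rewrite /derivable E.
by rewrite /derive E.
Qed.

Lemma line_expansion f (i : 'I_n) x (M a s : R) : 0 < a ->
  has_partials f -> has_partials (partial i f) ->
  (forall y z, `|partial i (partial i f) y - partial i (partial i f) z| <=
     M * enorm (y - z) `^ a) ->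
  `|f (s *: delta_mx 0 i + x) - f x - s * partial i f x
     - s ^+ 2 / 2 * partial i (partial i f) x| <= M * (s ^+ 2 * `|s| `^ a).
Proof.
move=> a0 df ddf H; pose e : 'rV[R]_n := delta_mx 0 i.
have := @second_order_expansion _ (fun s : R => f (s *: e + x))
  (fun s : R => partial i f (s *: e + x)) (fun s : R => partial i (partial i f) (s *: e + x)) a M s a0.
rewrite scale0r add0r; apply.
- by move=> r; apply: is_derive_line; exact: df.
- by move=> r; apply: is_derive_line; exact: ddf.
- move=> r; have := H (r *: e + x) x; rewrite addrK enormZ enorm_delta mulr1.
  exact: le_trans.
Qed.

End LineDerivative.

(** * Radial lifting *)

Section RadialLift.
Variables (R : realType) (a : R) (m : nat) (psi : R -> R) (C : R).
Variables (U V W Z G : R -> R -> R).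
Hypothesis a01 : 0 < a < 1.
Hypothesis P : radial_profile a m psi C U V W Z G.
Implicit Types (x y : 'rV[R]_m.+1) (i j : 'I_m.+1).

Let a0 : 0 < a. Proof. by case/andP: a01. Qed.
Let C0 : 0 <= C := prof_C P.

Lemma prof_V_lipschitz (r s t : R) : 0 <= r -> 0 <= s -> 0 <= t -> `|V s t - V r t| <= 2 * C * `|s - r|.
Proof.
move=> r0 s0 t0.
wlog rs : r s r0 s0 / r <= s.
  by move=> H; have [|/ltW] := leP r s; [exact: H|rewrite distrC (distrC s); exact: H].
rewrite (ger0_norm (_ : 0 <= s - r)) ?subr_ge0//.
have [_ v1 _ _ _] := prof_bound P r0 t0; have [_ v2 _ z _] := prof_bound P s0 t0.
have [_ _ _ z1 _] := prof_bound P r0 t0.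
have sr : 0 <= s - r by rewrite subr_ge0.
have [d1|d1] := leP 1 (s - r).
  have := ler_normB (V s t) (V r t); have := ler_wpM2l C0 d1; lra.
have H := prof_dV P r0 rs t0.
have p1 : (s - r) `^ a <= 1.
  have <- : 1 `^ a = 1 :> R by rewrite powR1.
  by apply: ge0_ler_powR; rewrite ?nnegrE ?(ltW a0)// ltW.
have := ler_normD (V s t - V r t - (s - r) * Z r t) ((s - r) * Z r t).
rewrite subrK normrM (ger0_norm sr).
have := ler_wpM2l C0 (ler_wpM2l sr p1).
have := ler_wpM2l sr z1; lra.
Qed.

(** The profile expands only towards larger radii. In the other direction the expansion is based at
    [s] and the slope moved back to [r] by the Lipschitz bound on [V]. *)
Lemma prof_U_expansion (r s t : R) : 0 <= r -> 0 <= s -> 0 <= t ->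
  `|U s t - U r t - (s - r) * V r t| <= 3 * C * (s - r) ^+ 2.
Proof.
move=> r0 s0 t0; have Cs : 0 <= C * (s - r) ^+ 2 by rewrite mulr_ge0// sqr_ge0.
have [rs|/ltW sr] := leP r s; first by have := prof_dU P r0 rs t0; lra.
have H := prof_dU P s0 sr t0; have L := prof_V_lipschitz s0 r0 t0.
have -> : U s t - U r t - (s - r) * V r t =
   (r - s) * (V r t - V s t) - (U r t - U s t - (r - s) * V s t) by ring.
have rs : 0 <= r - s by rewrite subr_ge0.
apply: (le_trans (ler_normB _ _)); rewrite normrM (ger0_norm rs).
have := ler_wpM2l rs L; rewrite (ger0_norm rs).
have -> : (s - r) ^+ 2 = (r - s) * (r - s) by ring.
move: H; rewrite expr2; lra.
Qed.

Lemma prof_V_expansion (r s t : R) : 0 <= r -> 0 <= s -> 0 <= t ->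
  `|V s t - V r t - (s - r) * Z r t| <= 2 * C * (`|s - r| * `|s - r| `^ a).
Proof.
move=> r0 s0 t0; have Cs : 0 <= C * (`|s - r| * `|s - r| `^ a) by rewrite !mulr_ge0// powR_ge0.
have [rs|/ltW sr] := leP r s.
  have rs' : 0 <= s - r by rewrite subr_ge0.
  by have := prof_dV P r0 rs t0; move: Cs; rewrite (ger0_norm rs'); lra.
have H := prof_dV P s0 sr t0; have [_ L _] := prof_holder P s0 sr t0.
have -> : V s t - V r t - (s - r) * Z r t =
   (r - s) * (Z r t - Z s t) - (V r t - V s t - (r - s) * Z s t) by ring.
have rs : 0 <= r - s by rewrite subr_ge0.
rewrite (distrC s r) (ger0_norm rs).
apply: (le_trans (ler_normB _ _)); rewrite normrM (ger0_norm rs).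
by have := ler_wpM2l rs L; lra.
Qed.

Let sym_holder (F : R -> R -> R) (r s t : R) : 0 <= r -> 0 <= s -> 0 <= t ->
  (forall r s t : R, 0 <= r -> r <= s -> 0 <= t -> `|F s t - F r t| <= C * (s - r) `^ a) ->
  `|F s t - F r t| <= C * `|s - r| `^ a.
Proof.
move=> r0 s0 t0 H; have [rs|/ltW sr] := leP r s.
  have d0 : 0 <= s - r by rewrite subr_ge0.
  by rewrite (ger0_norm d0); exact: H.
have d0 : 0 <= r - s by rewrite subr_ge0.
by rewrite distrC (distrC s r) (ger0_norm d0); exact: H.
Qed.

Let Whold (r s t : R) : 0 <= r -> 0 <= s -> 0 <= t -> `|W s t - W r t| <= C * `|s - r| `^ a.
Proof.
by move=> r0 s0 t0; apply: sym_holder => // ? ? ? p q k; have [] := prof_holder P p q k.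
Qed.

Let Zhold (r s t : R) : 0 <= r -> 0 <= s -> 0 <= t -> `|Z s t - Z r t| <= C * `|s - r| `^ a.
Proof.
by move=> r0 s0 t0; apply: sym_holder => // ? ? ? p q k; have [] := prof_holder P p q k.
Qed.

Let Ghold (r s t : R) : 0 <= r -> 0 <= s -> 0 <= t -> `|G s t - G r t| <= C * `|s - r| `^ a.
Proof.
by move=> r0 s0 t0; apply: sym_holder => // ? ? ? p q k; have [] := prof_holder P p q k.
Qed.

Let ZW0 t : 0 <= t -> Z 0 t = W 0 t.
Proof.
move=> t0; have := prof_ZW P (lexx 0) t0; rewrite powR0 ?gt_eqF// mulr0 normr_le0.
by rewrite subr_eq0 => /eqP.
Qed.

Let u x t := U (enorm x) t.

Let e (i : 'I_m.+1) : 'rV[R]_m.+1 := delta_mx 0 i.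

(** Since [V = r W] and [r (s - r) = (s^2 - r^2) / 2 - (s - r)^2 / 2], where [s^2] is a polynomial
    in [h], the gradient [W x] appears without division by [r], at the origin as well. *)
Let lift_d1 x t i : 0 <= t ->
  derivable (u^~ t) x (e i) /\ partial i (u^~ t) x = W (enorm x) t * x 0 i.
Proof.
move=> t0; apply: (@derive_of_expansion _ _ _ _ _ _ (4 * C) 1 1) => // h _.
rewrite powRr1// -expr2 real_normK ?num_real//.
set r := enorm x; set s := enorm (h *: e i + x).
have r0 : 0 <= r by exact: enorm_ge0.
have s0 : 0 <= s by exact: enorm_ge0.
have sr : `|s - r| <= `|h| by exact: enorm_line_dist.
have s2 : s ^+ 2 = r ^+ 2 + 2 * h * x 0 i + h ^+ 2 by exact: sqr_enorm_line.
have sr2 : (s - r) ^+ 2 <= h ^+ 2.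
  by rewrite -(real_normK (num_real (s - r))) -(real_normK (num_real h)) ler_pXn2r ?nnegrE.
have H := prof_U_expansion r0 s0 t0.
have [_ _ w _ _] := prof_bound P r0 t0.
rewrite (_ : u _ t - u x t - _ = (U s t - U r t - (s - r) * V r t)
    + W r t * ((h ^+ 2 - (s - r) ^+ 2) / 2)); last first.
  rewrite (prof_V P r0 t0) /u -/r -/s.
  have -> : h * (W r t * x 0 i) = W r t * ((s ^+ 2 - r ^+ 2 - h ^+ 2) / 2) by rewrite s2; field.
  by field.
apply: (le_trans (ler_normD _ _)); rewrite normrM.
have q0 : 0 <= (s - r) ^+ 2 := sqr_ge0 _.
rewrite (ger0_norm (_ : 0 <= (h ^+ 2 - (s - r) ^+ 2) / 2)); last lra.
have := ler_wpM2r (_ : 0 <= (h ^+ 2 - (s - r) ^+ 2) / 2) w.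
have := ler_wpM2l C0 sr2; have := mulr_ge0 C0 q0.
move=> ? ? /(_ ltac:(lra)); lra.
Qed.

Let lift_p1 t i : 0 <= t -> partial i (u^~ t) = fun x => W (enorm x) t * x 0 i.
Proof. by move=> t0; apply/funext => x; have [_ ->] := lift_d1 x i t0. Qed.

(** The relation [r W' = Z - W] as an expansion, kept multiplied by [r]. *)
Let dW (r s t : R) : 0 <= r -> 0 <= s -> 0 <= t ->
  `|r * (W s t - W r t) - (s - r) * (Z r t - W r t)| <= 3 * C * (`|s - r| * `|s - r| `^ a).
Proof.
move=> r0 s0 t0.
have -> : r * (W s t - W r t) - (s - r) * (Z r t - W r t) =
    (V s t - V r t - (s - r) * Z r t) - (s - r) * (W s t - W r t).
  by rewrite (prof_V P r0 t0) (prof_V P s0 t0); ring.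
apply: (le_trans (ler_normB _ _)); rewrite normrM.
have := ler_wpM2l (normr_ge0 (s - r)) (Whold r0 s0 t0); have := prof_V_expansion r0 s0 t0; lra.
Qed.

(** The Hessian of a radial function. At the origin the quotient by [enorm x ^+ 2] reads 0, and [D]
    is [W] times the identity, in accordance with [Z = W] there. *)
Let D i j x t := W (enorm x) t * (i == j)%:R
  + (Z (enorm x) t - W (enorm x) t) * (x 0 i * x 0 j / enorm x ^+ 2).

(** Away from the origin the remainder constant contains [1 / r]; this is harmless, as only the
    value of the derivative at the given point is extracted. Uniform Hölder bounds are then proved
    for the formula [D]. *)
Let lift_d2 x t i j : 0 <= t ->
  derivable (partial i (u^~ t)) x (e j) /\ partial j (partial i (u^~ t)) x = D i j x t.
Proof.
move=> t0; rewrite lift_p1//; set r := enorm x.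
have r0 : 0 <= r by exact: enorm_ge0.
have [rE|rN0] := eqVneq r 0.
  have x0 : x = 0 by apply: enorm0_eq0.
  apply: (@derive_of_expansion _ _ _ _ _ _ C a 1) => // h _.
  rewrite x0 addr0 enorm0 /D enorm0 !mxE mulr0 subr0 !mul0r mulr0 addr0.
  rewrite enormZ enorm_delta mulr1 eqxx /=.
  rewrite (_ : _ - _ = h * (i == j)%:R * (W `|h| t - W 0 t)); last by ring.
  rewrite !normrM normr_nat -mulrA [leRHS]mulrCA ler_wpM2l//.
  have := Whold (lexx 0) (normr_ge0 h) t0; rewrite subr0 normr_id.
  by move=> H; case: (i == j); rewrite ?mul1r// mul0r mulr_ge0// powR_ge0.
have rp : 0 < r by rewrite lt_def rN0.
apply: (@derive_of_expansion _ _ _ _ _ _ (C + C / r + 3 * C / r + C / r + 3 * C) a 1) => // h h1.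
set s := enorm (h *: e j + x).
have s0 : 0 <= s by exact: enorm_ge0.
have sr : `|s - r| <= `|h| by exact: enorm_line_dist.
have s2 : s ^+ 2 = r ^+ 2 + 2 * h * x 0 j + h ^+ 2 by exact: sqr_enorm_line.
have sr2 : (s - r) ^+ 2 <= h ^+ 2.
  by rewrite -(real_normK (num_real (s - r))) -(real_normK (num_real h)) ler_pXn2r ?nnegrE.
have ha0 := powR_ge0 `|h| a.
have hha : h ^+ 2 <= `|h| * `|h| `^ a.
  rewrite -(real_normK (num_real h)) expr2 ler_wpM2l//.
  have [->|hN0] := eqVneq `|h| 0; first exact: powR_ge0.
  have hp : 0 < `|h| by rewrite lt_def hN0 normr_ge0.
  rewrite -[leLHS]powRr1//; apply: ger_powR; first by rewrite hp h1.
  by case/andP: a01 => _ /ltW.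
have sra : `|s - r| * `|s - r| `^ a <= `|h| * `|h| `^ a.
  apply: ler_pM => //; rewrite ?powR_ge0//.
  by apply: ge0_ler_powR; rewrite ?nnegrE ?(ltW a0).
have W1 := Whold r0 s0 t0.
have W2 := dW r0 s0 t0.
have zw : `|Z r t - W r t| <= 2 * C.
  have [_ _ w z _] := prof_bound P r0 t0; have := ler_normB (Z r t) (W r t); lra.
have xi : `|x 0 i| / r <= 1 by rewrite ler_pdivrMr// mul1r coord_le_enorm.
have xi0 : 0 <= `|x 0 i| / r by rewrite divr_ge0.
set w1 := W s t in W1 W2 *; set w0 := W r t in W1 W2 zw *; set zz := Z r t in W2 zw *.
set c := s - r in sr sr2 sra W1 W2.
rewrite /D -/r -/w0 -/zz !mxE eqxx /=.
have cE : c * r = h * x 0 j + (h ^+ 2 - c ^+ 2) / 2.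
  have : c ^+ 2 = s ^+ 2 - 2 * (c * r) - r ^+ 2 by rewrite /c; ring.
  rewrite s2; lra.
rewrite (_ : _ - _ - _ = h * (i == j)%:R * (w1 - w0)
   + x 0 i / r * ((r * (w1 - w0) - c * (zz - w0)) + (zz - w0) / r * ((h ^+ 2 - c ^+ 2) / 2))); last first.
  have -> : (h ^+ 2 - c ^+ 2) / 2 = c * r - h * x 0 j by rewrite cE; ring.
  have : r != 0 by rewrite gt_eqF.
  by move=> ?; field.
apply: (le_trans (ler_normD _ _)).
have A1 : `|h * (i == j)%:R * (w1 - w0)| <= C * (`|h| * `|h| `^ a).
  rewrite !normrM normr_nat -mulrA [leRHS]mulrCA ler_wpM2l//.
  apply: (@le_trans _ _ `|w1 - w0|); first by case: (i == j); rewrite ?mul1r// mul0r.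
  apply: (le_trans W1); rewrite ler_wpM2l//.
  by apply: ge0_ler_powR; rewrite ?nnegrE ?(ltW a0).
have A2 : `|(zz - w0) / r * ((h ^+ 2 - c ^+ 2) / 2)| <= C / r * (`|h| * `|h| `^ a).
  have c2 : 0 <= c ^+ 2 := sqr_ge0 _.
  rewrite normrM (ger0_norm (_ : 0 <= (h ^+ 2 - c ^+ 2) / 2)); last lra.
  rewrite normrM normfV (ger0_norm r0).
  rewrite [leRHS](_ : _ = 2 * C / r * ((`|h| * `|h| `^ a) / 2)); last by field; rewrite gt_eqF.
  apply: ler_pM; [by rewrite divr_ge0|lra| |lra].
  by rewrite ler_wpM2r// invr_ge0.
have A3 : `|x 0 i / r * ((r * (w1 - w0) - c * (zz - w0)) + (zz - w0) / r * ((h ^+ 2 - c ^+ 2) / 2))|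
   <= 3 * C * (`|h| * `|h| `^ a) + C / r * (`|h| * `|h| `^ a).
  rewrite normrM normrM normfV (ger0_norm r0).
  apply: (le_trans (ler_wpM2r (normr_ge0 _) xi)); rewrite mul1r.
  apply: (le_trans (ler_normD _ _)); apply: lerD => //.
  by apply: (le_trans W2); rewrite ler_wpM2l// mulr_ge0.
have hh0 : 0 <= `|h| * `|h| `^ a by rewrite mulr_ge0.
have Cr : 0 <= C / r by rewrite divr_ge0.
have := mulr_ge0 Cr hh0; have := mulr_ge0 C0 hh0.
have -> : 3 * C / r = 3 * (C / r) by ring.
lra.
Qed.

Let ratio_le1 x i j : `|x 0 i * x 0 j / enorm x ^+ 2| <= 1.
Proof.
have [x0|x0] := eqVneq (enorm x) 0; first by rewrite x0 expr0n invr0 mulr0 normr0.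
have xp : 0 < enorm x by rewrite lt_def x0 enorm_ge0.
rewrite normrM normfV (ger0_norm (sqr_ge0 (enorm x))) ler_pdivrMr ?exprn_gt0// mul1r normrM expr2.
by apply: ler_pM; rewrite ?coord_le_enorm.
Qed.

Let ratio_dist x y i j : 0 < enorm x -> 0 < enorm y ->
  `|x 0 i * x 0 j / enorm x ^+ 2 - y 0 i * y 0 j / enorm y ^+ 2|
    <= 4 * (enorm (x - y) / enorm x).
Proof.
set r := enorm x; set s := enorm y => rp sp.
have unit k : `|x 0 k / r - y 0 k / s| <= 2 * (enorm (x - y) / r).
  have rN : r != 0 by rewrite gt_eqF.
  have sN : s != 0 by rewrite gt_eqF.
  rewrite (_ : _ - _ = ((x - y) 0 k) / r + y 0 k / s * ((s - r) / r)); last first.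
    by rewrite !mxE; field; rewrite rN sN.
  apply: (le_trans (ler_normD _ _)); rewrite 3!normrM !normfV normrM !normfV.
  rewrite !(gtr0_norm rp) (gtr0_norm sp) mulr2n mulrDl mul1r.
  apply: lerD; first by rewrite ler_wpM2r ?invr_ge0 ?(ltW rp)// coord_le_enorm.
  have A1 : `|y 0 k| / s <= 1 by rewrite ler_pdivrMr// mul1r coord_le_enorm.
  have A2 : `|s - r| / r <= enorm (x - y) / r.
    by rewrite ler_wpM2r ?invr_ge0 ?(ltW rp)// distrC dist_enorm.
  rewrite -[leRHS]mul1r; apply: ler_pM => //; by rewrite divr_ge0 ?(ltW rp) ?(ltW sp).
rewrite (_ : _ - _ = (x 0 i / r - y 0 i / s) * (x 0 j / r) + y 0 i / s * (x 0 j / r - y 0 j / s)).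
  have A1 : `|y 0 i / s| <= 1.
    by rewrite normrM normfV (gtr0_norm sp) ler_pdivrMr// mul1r coord_le_enorm.
  have A2 : `|x 0 j / r| <= 1.
    by rewrite normrM normfV (gtr0_norm rp) ler_pdivrMr// mul1r coord_le_enorm.
  apply: (le_trans (ler_normD _ _)).
  rewrite (normrM (x 0 i / r - y 0 i / s)) (normrM (y 0 i / s)).
  have := ler_pM (normr_ge0 _) (normr_ge0 _) (unit i) A2.
  have := ler_pM (normr_ge0 _) (normr_ge0 _) A1 (unit j).
  rewrite mul1r mulr1; lra.
by field; rewrite !gt_eqF.
Qed.

(** The directions [px], [py] are discontinuous at the origin. If [r <= 2 d], both factors [Z - W]
    are themselves of order [d^a]; otherwise the directions differ by at most [4 d / r], and
    [r^a (d / r) <= d^a] because [d / r <= 1]. *)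
Let holder_combine (r s d wr ws zr zs px py q : R) :
  0 <= r -> 0 <= s -> 0 <= d -> `|r - s| <= d -> 0 <= q <= 1 ->
  `|wr - ws| <= C * `|r - s| `^ a -> `|zr - zs| <= C * `|r - s| `^ a ->
  `|zr - wr| <= C * r `^ a -> `|zs - ws| <= C * s `^ a -> `|px| <= 1 -> `|py| <= 1 ->
  (0 < r -> 0 < s -> `|px - py| <= 4 * (d / r)) ->
  `|(wr * q + (zr - wr) * px) - (ws * q + (zs - ws) * py)| <= 10 * C * d `^ a.
Proof.
move=> r0 s0 d0 rs /andP[q0 q1] Wd Zd zwr zws px1 py1 pxy.
have a1 : a <= 1 by case/andP: a01 => _ /ltW.
have mono (v w : R) : 0 <= v -> v <= w -> v `^ a <= w `^ a.
  by move=> p0 pq; apply: ge0_ler_powR; rewrite ?nnegrE ?(ltW a0)//; exact: le_trans pq.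
have rsa := ler_wpM2l C0 (mono _ _ (normr_ge0 _) rs).
have {}Wd := le_trans Wd rsa; have {}Zd := le_trans Zd rsa.
have da0 := powR_ge0 d a.
have Cd : 0 <= C * d `^ a by rewrite mulr_ge0.
have H1 : `|(wr - ws) * q| <= C * d `^ a.
  rewrite normrM (ger0_norm q0) -[leRHS]mulr1; exact: ler_pM.
suff H2 : `|(zr - wr) * px - (zs - ws) * py| <= 9 * (C * d `^ a).
  rewrite (_ : _ - _ = (wr - ws) * q + ((zr - wr) * px - (zs - ws) * py)); last by ring.
  by apply: (le_trans (ler_normD _ _)); lra.
have [rd|dr] := leP r (2 * d).
  have sd : s <= 3 * d by move: rs; rewrite ler_norml => /andP[? ?]; lra.
  have dpow k : 1 <= k -> (k * d) `^ a <= k * d `^ a.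
    move=> k1; have k0 : 0 <= k := le_trans ler01 k1.
    rewrite powRM// ler_wpM2r// -[leRHS]powRr1//; exact: ler_powR.
  have B1 : r `^ a <= 2 * d `^ a by apply: le_trans (dpow _ _); [exact: mono|rewrite ler1n].
  have B2 : s `^ a <= 3 * d `^ a by apply: le_trans (dpow _ _); [exact: mono|rewrite ler1n].
  apply: (le_trans (ler_normB _ _)); rewrite (normrM (zr - wr)) (normrM (zs - ws)).
  have := ler_pM (normr_ge0 _) (normr_ge0 _) zwr px1.
  have := ler_pM (normr_ge0 _) (normr_ge0 _) zws py1.
  have := ler_wpM2l C0 B1; have := ler_wpM2l C0 B2; rewrite !mulr1; lra.
have rp : 0 < r by lra.
have sp : 0 < s by move: rs; rewrite ler_norml => /andP[? ?]; lra.
rewrite (_ : _ - _ = ((zr - zs) - (wr - ws)) * py + (zr - wr) * (px - py)); last by ring.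
apply: (le_trans (ler_normD _ _)).
have T1 : `|((zr - zs) - (wr - ws)) * py| <= 2 * (C * d `^ a).
  rewrite normrM -[leRHS]mulr1; apply: ler_pM => //.
  by apply: (le_trans (ler_normB _ _)); lra.
have T2 : `|(zr - wr) * (px - py)| <= 4 * (C * d `^ a).
  rewrite normrM; have H := pxy rp sp.
  apply: (le_trans (ler_pM (normr_ge0 _) (normr_ge0 _) zwr H)).
  have -> : C * r `^ a * (4 * (d / r)) = 4 * (C * (r `^ a * (d / r))) by ring.
  rewrite ler_wpM2l// ler_wpM2l//.
  have dr0 : 0 <= d / r by rewrite divr_ge0.
  have dr1 : d / r <= 1 by rewrite ler_pdivrMr// mul1r; lra.
  apply: (@le_trans _ _ (r `^ a * (d / r) `^ a)); last first.
    by rewrite -powRM// mulrCA mulfV ?mulr1// gt_eqF.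
  rewrite ler_wpM2l ?powR_ge0//; have [->|q'0] := eqVneq (d / r) 0; first exact: powR_ge0.
  have qp : 0 < d / r by rewrite lt_def q'0.
  by rewrite -[leLHS]powRr1//; apply: ger_powR; rewrite ?qp ?dr1.
lra.
Qed.

Let Dhold x y t i j : 0 <= t -> `|D i j x t - D i j y t| <= 10 * C * enorm (x - y) `^ a.
Proof.
move=> t0; apply: (holder_combine (enorm_ge0 x) (enorm_ge0 y) (enorm_ge0 _) (dist_enorm x y)).
- by case: (i == j); rewrite lexx ler01.
- exact: Whold (enorm_ge0 _) (enorm_ge0 _) t0.
- exact: Zhold (enorm_ge0 _) (enorm_ge0 _) t0.
- exact: (prof_ZW P (enorm_ge0 x) t0).
- exact: (prof_ZW P (enorm_ge0 y) t0).
- exact: ratio_le1.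
- exact: ratio_le1.
- exact: ratio_dist.
Qed.

Let p2E t i j : 0 <= t -> partial j (partial i (u^~ t)) = D i j ^~ t.
Proof. by move=> t0; apply/funext => x; have [_ ->] := lift_d2 x i j t0. Qed.

Let hp t : 0 <= t -> has_partials (u^~ t).
Proof. by move=> t0 i x; have [] := lift_d1 x i t0. Qed.

Let hpp t i : 0 <= t -> has_partials (partial i (u^~ t)).
Proof. by move=> t0 j x; have [] := lift_d2 x i j t0. Qed.

Let expand x (t : R) i (s : R) : 0 <= t ->
  `|u (s *: e i + x) t - u x t - s * partial i (u^~ t) x - s ^+ 2 / 2 * D i i x t|
    <= 10 * C * (s ^+ 2 * `|s| `^ a).
Proof.
move=> t0; have := @line_expansion R _ (u^~ t) i x (10 * C) a s a0 (hp t0) (@hpp t i t0).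
by rewrite p2E//; apply => y z; exact: Dhold.
Qed.

(** [up], [um], [u0] are values at the later time at displacements [k], [- k], 0, the [v] those at
    the earlier time, the [g] the time derivatives there. The change of the second difference is
    computed twice: the four space expansions cost 40 units [C A], the time expansions 4 and the
    differences of [g] 2; 50 is a round bound. *)
Let interpolate (k A up um u0 vp vm v0 gp gm g0 pt ps dt ds : R) : 0 < k ->
  `|up - vp - k ^+ 2 * gp| <= C * (k ^+ 2 * A) ->
  `|um - vm - k ^+ 2 * gm| <= C * (k ^+ 2 * A) ->
  `|u0 - v0 - k ^+ 2 * g0| <= C * (k ^+ 2 * A) ->
  `|gp - g0| <= C * A -> `|gm - g0| <= C * A ->
  `|up - u0 - k * pt - k ^+ 2 / 2 * dt| <= 10 * C * (k ^+ 2 * A) ->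
  `|um - u0 - (- k) * pt - k ^+ 2 / 2 * dt| <= 10 * C * (k ^+ 2 * A) ->
  `|vp - v0 - k * ps - k ^+ 2 / 2 * ds| <= 10 * C * (k ^+ 2 * A) ->
  `|vm - v0 - (- k) * ps - k ^+ 2 / 2 * ds| <= 10 * C * (k ^+ 2 * A) ->
  0 <= A -> `|dt - ds| <= 50 * C * A.
Proof.
move=> kp X1 X2 X0 K1 K2 E1 E2 E3 E4 A0.
have k20 : 0 < k ^+ 2 by rewrite exprn_gt0.
have {}K1 := ler_wpM2l (ltW k20) K1; have {}K2 := ler_wpM2l (ltW k20) K2.
rewrite -{1}(gtr0_norm k20) -normrM in K1.
rewrite -{1}(gtr0_norm k20) -normrM in K2.
rewrite -(ler_pM2l k20) -{1}(gtr0_norm k20) -normrM.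
have : 0 <= C * (k ^+ 2 * A) by rewrite mulr_ge0// mulr_ge0// ltW.
move: E1 E2 E3 E4 K1 K2 X1 X2 X0; rewrite !ler_norml; move: (k ^+ 2) => k2.
move=> /andP[? ?] /andP[? ?] /andP[? ?] /andP[? ?] /andP[? ?] /andP[? ?].
move=> /andP[? ?] /andP[? ?] /andP[? ?] ?.
apply/andP; split; lra.
Qed.

(* Interpolation: the second difference of step sqrt (t - s) is controlled both
   by the second derivative and, through the equation in time, by G. *)
Let Dtime x (s t : R) i : 0 <= s -> s <= t ->
  `|D i i x t - D i i x s| <= 50 * C * (t - s) `^ (a / 2).
Proof.
move=> s0 st; have t0 := le_trans s0 st.
have [->|ts] := eqVneq t s; first by rewrite !subrr normr0 mulr_ge0 ?powR_ge0// mulr_ge0.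
have d0 : 0 < t - s by rewrite subr_gt0 lt_def ts.
have [k kp k2] : exists2 k, 0 < k & k ^+ 2 = t - s.
  by exists (Num.sqrt (t - s)); [rewrite sqrtr_gt0|rewrite sqr_sqrtr// ltW].
have ka : (t - s) `^ (a / 2) = k `^ a.
  by rewrite -k2 -powR_mulrn ?(ltW kp)// -powRrM; congr (_ `^ _); field.
rewrite ka.
have Gx y : `|u y t - u y s - k ^+ 2 * G (enorm y) s| <= C * (k ^+ 2 * k `^ a).
  by have := prof_dUt P (enorm_ge0 y) s0 st; rewrite ka k2.
have Gd y : `|enorm y - enorm x| <= k -> `|G (enorm y) s - G (enorm x) s| <= C * k `^ a.
  move=> yk; apply: (le_trans (Ghold (enorm_ge0 _) (enorm_ge0 _) s0)); rewrite ler_wpM2l//.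
  by apply: ge0_ler_powR; rewrite ?nnegrE ?(ltW a0) ?(ltW kp).
have E1 := expand x i k t0; have E2 := expand x i (- k) t0.
have E3 := expand x i k s0; have E4 := expand x i (- k) s0.
rewrite normrN sqrrN in E2; rewrite normrN sqrrN in E4.
rewrite (gtr0_norm kp) in E1 E2 E3 E4.
apply: (interpolate kp (Gx (k *: e i + x)) (Gx ((- k) *: e i + x)) (Gx x)
  _ _ E1 E2 E3 E4 (powR_ge0 _ _)).
- by apply: Gd; apply: (le_trans (enorm_line_dist _ _ _)); rewrite gtr0_norm.
- by apply: Gd; apply: (le_trans (enorm_line_dist _ _ _)); rewrite normrN gtr0_norm.
Qed.

Let e00 (r : R) i : (r *: e ord0) 0 i = r * (i == ord0)%:R.
Proof. by rewrite !mxE eqxx. Qed.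

Let enorm_e0 (r : R) : enorm (r *: e ord0) = `|r|.
Proof. by rewrite enormZ enorm_delta mulr1. Qed.

Let D00 (r t : R) : 0 <= t -> D ord0 ord0 (r *: e ord0) t = Z `|r| t.
Proof.
move=> t0; rewrite /D enorm_e0 e00 !eqxx !mulr1.
have [->|r0] := eqVneq r 0; first by rewrite normr0 !mul0r mulr0 addr0 ?mulr1 ZW0.
by rewrite real_normK ?num_real// -expr2 mulfV ?expf_neq0//; ring.
Qed.

Let Ztime (r s t : R) : 0 <= r -> 0 <= s -> s <= t ->
  `|Z r t - Z r s| <= 50 * C * (t - s) `^ (a / 2).
Proof.
move=> r0 s0 st; have := Dtime (r *: e ord0) ord0 s0 st.
by rewrite !D00// ?(le_trans s0)// (ger0_norm r0).
Qed.

(** Along the first axis the first partial derivative is [r W] and has derivative [Z], so [W] is the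
    mean of [Z] over [[0, r]] and inherits its modulus in time. *)
Let Wtime (r s t : R) : 0 <= r -> 0 <= s -> s <= t ->
  `|W r t - W r s| <= 50 * C * (t - s) `^ (a / 2).
Proof.
move=> r0 s0 st; have t0 := le_trans s0 st.
have [->|rN0] := eqVneq r 0; first by rewrite -!ZW0//; exact: Ztime.
have rp : 0 < r by rewrite lt_def rN0.
pose g t' (q : R) := partial ord0 (u^~ t') (q *: e ord0 + 0).
have dg t' : 0 <= t' -> forall q : R, is_derive q 1 (g t') (Z `|q| t').
  move=> t'0 q; have := @is_derive_line R _ (partial ord0 (u^~ t')) (e ord0) 0 q (@hpp t' ord0 t'0 _ _).
  have -> : 'D_(e ord0) (partial ord0 (u^~ t')) (q *: e ord0 + 0) = Z `|q| t'.
    by rewrite addr0 -D00//; have [_ <-] := lift_d2 (q *: e ord0) ord0 ord0 t'0.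
  by [].
have gE t' q : 0 <= t' -> g t' q = W `|q| t' * q.
  by move=> t'0; rewrite /g addr0 lift_p1// enorm_e0 e00 eqxx mulr1.
have := @mean_value_bound R (g t - g s) (fun q => Z `|q| t - Z `|q| s)
  (50 * C * (t - s) `^ (a / 2)) r (fun q => is_deriveB (dg t t0 q) (dg s s0 q)).
rewrite !fctE !gE// normr0 !mulr0 subrr subr0 (ger0_norm r0) -mulrBl normrM (ger0_norm r0).
rewrite ler_pM2r//; apply => q _; exact: Ztime.
Qed.

Let Dhold_time x (s t : R) i j : 0 <= s -> s <= t ->
  `|D i j x t - D i j x s| <= 150 * C * (t - s) `^ (a / 2).
Proof.
move=> s0 st; have := Wtime (enorm_ge0 x) s0 st; have := Ztime (enorm_ge0 x) s0 st.
have := ratio_le1 x i j; rewrite /D; move: (x 0 i * x 0 j / _) => q q1.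
have : 0 <= C * (t - s) `^ (a / 2) by rewrite mulr_ge0// powR_ge0.
move: (W _ t) (W _ s) (Z _ t) (Z _ s) => wt ws zt zs; set X := _ `^ _ => CX Hz Hw.
rewrite (_ : _ - _ = (wt - ws) * (i == j)%:R + ((zt - zs) - (wt - ws)) * q); last by ring.
apply: (le_trans (ler_normD _ _)).
have : `|(wt - ws) * (i == j)%:R| <= 50 * C * X.
  rewrite normrM normr_nat; case: (i == j); rewrite ?mulr1// mulr0.
  exact: le_trans Hw.
have : `|((zt - zs) - (wt - ws)) * q| <= 100 * C * X.
  rewrite normrM -[leRHS]mulr1; apply: ler_pM => //.
  by apply: (le_trans (ler_normB _ _)); lra.
lra.
Qed.

Let symt (F : R -> R) (K s t : R) : 0 <= s -> 0 <= t ->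
  (forall s t : R, 0 <= s -> s <= t -> `|F t - F s| <= K * (t - s) `^ (a / 2)) ->
  `|F t - F s| <= K * `|t - s| `^ (a / 2).
Proof.
move=> s0 t0 H; have [rs|/ltW sr] := leP s t.
  have d0 : 0 <= t - s by rewrite subr_ge0.
  by rewrite (ger0_norm d0); exact: H.
have d0 : 0 <= s - t by rewrite subr_ge0.
by rewrite distrC (distrC t s) (ger0_norm d0); exact: H.
Qed.

Let holder_xt (F : 'rV[R]_m.+1 -> R -> R) (K : R) : 0 <= K ->
  (forall x y t, 0 <= t -> `|F x t - F y t| <= K * enorm (x - y) `^ a) ->
  (forall x s t, 0 <= s -> s <= t -> `|F x t - F x s| <= K * (t - s) `^ (a / 2)) ->
  holder_spacetime a F.
Proof.
move=> K0 Hx Ht; exists K => x y s t s0 t0.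
rewrite (_ : F x s - F y t = (F x s - F y s) + (F y s - F y t)); last by ring.
apply: (le_trans (ler_normD _ _)); rewrite mulrDr; apply: lerD; first exact: Hx.
by apply: symt => // s' t' p q; exact: Ht.
Qed.

(** Properness of the filter makes the limit unique: positive increments are always admissible, also
    at [t = 0]. For negative increments the expansion is based at [t + h] and [G] moved back to
    [t]. *)
Let dt_lim x (t : R) : 0 <= t -> ProperFilter (within [set h : R | 0 <= t + h] 0^') /\
  time_quotient u x t --> G (enorm x) t.
Proof.
move=> t0; have r0 := enorm_ge0 x.
have PW : ProperFilter (within [set h : R | 0 <= t + h] 0^').
  apply: Build_ProperFilter_ex => A; rewrite /within /= => H.
  have H' : nbhs (0 : R) (fun h => 0 < h -> 0 <= t + h -> A h).
    apply: (filterS _ (H : nbhs (0 : R) (fun h => h != 0 -> 0 <= t + h -> A h))) => h hA h0.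
    by apply: hA; rewrite gt_eqF.
  have /filter_ex [h [h0 Ah]] : \forall h \near (0 : R)^'+,
      0 < h /\ (0 < h -> 0 <= t + h -> A h).
    near=> h; split; first by near: h; exact: nbhs_right_gt.
    by near: h; apply: cvg_within; exact: H'.
  by exists h; apply: Ah => //; rewrite addr_ge0// ltW.
split; first exact: PW.
have a2 : 0 < a / 2 by rewrite divr_gt0.
have key (h : R) : 0 <= t + h ->
    `|u x (t + h) - u x t - h * G (enorm x) t| <= 2 * C * (`|h| * `|h| `^ (a / 2)).
  move=> th; have Ch : 0 <= C * (`|h| * `|h| `^ (a / 2)) by rewrite !mulr_ge0// powR_ge0.
  have [h0|h0] := leP 0 h.
    have := prof_dUt P r0 t0 (_ : t <= t + h); rewrite lerDl => /(_ h0).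
    rewrite (_ : t + h - t = h) ?(ger0_norm h0)//; last by ring.
    by move: Ch; rewrite (ger0_norm h0) /u; lra.
  have tht : t + h <= t by lra.
  have := prof_dUt P r0 th tht; have := prof_Gt P r0 th tht.
  have k0 : 0 <= - h by lra.
  rewrite (_ : t - (t + h) = - h); last by ring.
  move: Ch; rewrite (ltr0_norm h0) => Ch /(ler_wpM2l k0) H1 H2.
  rewrite (_ : u x (t + h) - u x t - h * G (enorm x) t =
    (- h) * (G (enorm x) t - G (enorm x) (t + h))
    - (U (enorm x) t - U (enorm x) (t + h) - (- h) * G (enorm x) (t + h))); last by rewrite /u; ring.
  by apply: (le_trans (ler_normB _ _)); rewrite normrM (ger0_norm k0); lra.
apply/cvgrPdist_le => eps eps0.
have [d dp Hd] := @small_power R (2 * C) eps (a / 2) eps0 a2.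
have nd : \forall h \near (0 : R)^', `|h| <= d by exact: (dnbhs0_le (V := R^o)).
rewrite near_withinE; near=> h => th.
have h0 : h != 0 by near: h; exact: nbhs_dnbhs_neq.
have habs : 0 < `|h| by rewrite normr_gt0.
rewrite distrC -(ler_pM2l habs) -normrM mulrBr mulrA mulfV// mul1r.
apply: (le_trans (key h th)); rewrite mulrCA ler_wpM2l//.
by apply: Hd => //; near: h.
Unshelve. all: by end_near. Qed.

Let dtimeE x t : 0 <= t -> dtime u x t = G (enorm x) t.
Proof. by move=> t0; have [PF H] := dt_lim x t0; apply: cvg_lim H; exact: Rhausdorff. Qed.

Lemma radial_lift_parabolic : C_2alpha_parabolic a (fun x t => U (enorm x) t).
Proof.
split.
- by move=> t t0; split; [exact: hp|move=> i; exact: hpp].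
- by move=> x t t0; apply/cvg_ex; exists (G (enorm x) t); have [] := dt_lim x t0.
- split.
  + by exists C => x t t0; have [] := prof_bound P (enorm_ge0 x) t0.
  + move=> i; exists C => x t t0; rewrite lift_p1//.
    have [_ v _ _ _] := prof_bound P (enorm_ge0 x) t0; apply: le_trans v.
    rewrite (prof_V P (enorm_ge0 x) t0) !normrM mulrC ler_wpM2r// (ger0_norm (enorm_ge0 x)).
    exact: coord_le_enorm.
  + move=> i j; exists (3 * C) => x t t0; rewrite p2E//.
    have [_ _ w z _] := prof_bound P (enorm_ge0 x) t0; rewrite /D.
    have := ratio_le1 x i j; move: (x 0 i * x 0 j / _) => q q1.
    apply: (le_trans (ler_normD _ _)).
    have A1 : `|W (enorm x) t * (i == j)%:R| <= C.
      by rewrite normrM normr_nat; case: (i == j); rewrite ?mulr1// mulr0.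
    have A2 : `|(Z (enorm x) t - W (enorm x) t) * q| <= 2 * C.
      rewrite normrM -[leRHS]mulr1; apply: ler_pM => //.
      by apply: (le_trans (ler_normB _ _)); lra.
    lra.
  + by exists C => x t t0; rewrite dtimeE//; have [] := prof_bound P (enorm_ge0 x) t0.
- move=> i j.
  have [K HK] : holder_spacetime a (D i j).
    apply: (@holder_xt _ (150 * C)); first by rewrite mulr_ge0.
      move=> x y t t0; apply: (le_trans (Dhold x y i j t0)).
      by rewrite ler_wpM2r ?powR_ge0//; have := C0; lra.
    by move=> x s t; exact: Dhold_time.
  by exists K => x y s t s0 t0; rewrite !p2E//; exact: HK.
- have [K HK] : holder_spacetime a (fun x t => G (enorm x) t).
    apply: (@holder_xt _ C) => //.
      move=> x y t t0; apply: (le_trans (Ghold (enorm_ge0 y) (enorm_ge0 x) t0)).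
      rewrite ler_wpM2l//; apply: ge0_ler_powR; rewrite ?nnegrE ?(ltW a0) ?enorm_ge0//.
      exact: dist_enorm.
    by move=> x s t s0 st; exact: (prof_Gt P (enorm_ge0 x) s0 st).
  by exists K => x y s t s0 t0; rewrite !dtimeE//; exact: HK.
Qed.

Lemma radial_lift_equation (b : 'rV[R]_m.+1 -> 'rV[R]_m.+1) x t :
  (forall x, x != 0 -> b x = - (psi (enorm x) *: ((enorm x)^-1 *: x))) -> 0 <= t ->
  dtime u x t = laplacian (u^~ t) x + edot (b x) (gradient (u^~ t) x).
Proof.
move=> bE t0; have r0 := enorm_ge0 x.
have gE : gradient (u^~ t) x = W (enorm x) t *: x.
  by apply/rowP => i; rewrite !mxE lift_p1.
have lE : laplacian (u^~ t) x = Z (enorm x) t + m%:R * W (enorm x) t.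
  rewrite /laplacian (eq_bigr (fun i => D i i x t)) => [|i _]; last by rewrite p2E.
  rewrite /D big_split/= (eq_bigr (fun=> W (enorm x) t)) => [|i _]; last by rewrite eqxx mulr1.
  rewrite sumr_const card_ord -mulr_sumr.
  have -> : \sum_(i < m.+1) x 0 i * x 0 i / enorm x ^+ 2 = edot x x / enorm x ^+ 2.
    by rewrite /edot mulr_suml.
  (* The trace of [x x^T / |x|^2] is 1 off the origin and reads 0 at it, where [Z = W] makes both
     cases agree. *)
  rewrite -sqr_enorm -[W (enorm x) t *+ m.+1]mulr_natl -natr1; have [x0|x0] := eqVneq (enorm x) 0.
    by rewrite x0 ZW0// subrr mul0r addr0; ring.
  by rewrite mulfV ?expf_neq0//; ring.
rewrite dtimeE// lE gE edotZr -(prof_eq P r0 t0).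
have [x0|x0] := eqVneq x 0.
  rewrite x0 (prof_V P)// enorm0// mul0r mulr0 subr0.
  by rewrite /edot big1 ?mulr0 ?addr0// => i _; rewrite mxE mulr0.
have xp : enorm x != 0 by apply: contra x0 => /eqP/enorm0_eq0 ->.
rewrite bE// scalerA -[- (_ *: x)]scaleNr edotZl -sqr_enorm (prof_V P r0 t0); field.
exact: xp.
Qed.

End RadialLift.

(** * Maximum principle and uniqueness *)

(* No maximum point is needed: at a point where [w - delta t] is within [e s^2]
   of its supremum, Taylor expansions with step [s] bound the first and second
   derivatives from above by multiples of [e]. *)
Lemma max_principle (R : realType) (n : nat) (B Q L M T : R)
    (w : 'rV[R]_n -> R -> R) (p q : 'I_n -> 'rV[R]_n -> R -> R) (mt : 'rV[R]_n -> R -> R) :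
  0 <= B -> 0 < T ->
  (forall x t, 0 <= t -> t <= T -> w x t <= M) ->
  (forall x t, 0 <= t -> t <= T -> w x t <= L * t) ->
  (forall x t, 0 < t -> t <= T -> 0 < w x t ->
     mt x t <= \sum_i (q i x t + B * `|p i x t|)) ->
  (forall i x t, 0 < t -> t <= T -> 0 < w x t -> `|q i x t| <= Q) ->
  (forall th e : R, 0 < th -> 0 < e -> exists2 s1, 0 < s1 & forall s, 0 < s -> s <= s1 ->
     forall x t, 0 < t -> t <= T -> th <= w x t ->
     (forall i, w x t + s * p i x t + s ^+ 2 / 2 * q i x t - e * s ^+ 2
                <= w (s *: delta_mx 0 i + x) t /\
                w x t - s * p i x t + s ^+ 2 / 2 * q i x t - e * s ^+ 2
                <= w (- s *: delta_mx 0 i + x) t) /\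
     (2 * s <= t -> w x t - s * mt x t - e * s <= w x (t - s))) ->
  forall x t, 0 <= t -> t <= T -> w x t <= 0.
Proof.
move=> B0 T0 wM wL Hm Hq He x1 t1 t10 t1T; apply/negP => /negP; rewrite -ltNge => sg0.
set sg := w x1 t1 in sg0.
have {}wM := wM; have Q0 : 0 <= `|Q| by [].
(* Subtracting [de * t] costs at most [sg / 2], so the supremum stays positive, and it forces a time
   derivative of about [de] near a maximum. *)
pose de := sg / (2 * T).
have de0 : 0 < de by rewrite divr_gt0// mulr_gt0.
have deT : de * T = sg / 2 by rewrite /de; field; rewrite gt_eqF.
have L0 : 0 < L.
  have H := wL x1 t1 t10 t1T; rewrite ltNge; apply/negP => L0.
  by have := mulr_le0_ge0 L0 t10; rewrite -/sg in H; lra.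
pose E := [set y | exists x t, [/\ 0 <= t, t <= T & y = w x t - de * t]].
have E1 : E (sg - de * t1) by exists x1, t1.
have supE : has_sup E.
  split; first by exists (sg - de * t1).
  exists M => _ [x [t [t0 tT ->]]].
  by have := wM x t t0 tT; have := mulr_ge0 (ltW de0) t0; lra.
pose S := sup E.
have SE x t : 0 <= t -> t <= T -> w x t - de * t <= S.
  by move=> t0 tT; apply: ub_le_sup; [case: supE|exists x, t].
have S1 : sg / 2 <= S.
  have H1 : sg - de * t1 <= S by exact: SE.
  have : de * t1 <= de * T by rewrite ler_wpM2l// ltW.
  rewrite deT; move: H1; clearbody S sg; lra.
(* Near the supremum one finds [mt <= (K - 2) e], and the time expansion gives [de <= mt + 2 e]; so
   [K e <= de / 2] is a contradiction. *)
pose K := n%:R * (4 + B * (2 + `|Q|)) + 2.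
have K0 : 0 < K by rewrite ltr_wpDl// mulr_ge0// addr_ge0// mulr_ge0// addr_ge0.
pose e := Num.min 1 (Num.min (sg / 4) (de / (2 * K))).
have e0 : 0 < e by rewrite !lt_min ltr01 !divr_gt0// mulr_gt0.
have e1 : e <= 1 by rewrite ge_min lexx.
have e2 : e <= sg / 4 by rewrite !ge_min lexx !orbT.
have e3 : K * e <= de / 2.
  have : e <= de / (2 * K) by rewrite !ge_min lexx !orbT.
  move=> /(ler_wpM2l (ltW K0)) /le_trans; apply; apply: le_of_eq.
  by field; rewrite gt_eqF.
clearbody e.
have [|s1 s10 Hs] := He (sg / 4) e _ e0; first by rewrite divr_gt0.
(* The last bound places the almost maximal point at a time at least [2 s], since [w] is small near
   time 0; the backward step to [t - s] is then admissible. *)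
pose s := Num.min s1 (Num.min e (sg / 4 / (2 * L))).
have s0 : 0 < s by rewrite !lt_min s10 e0 !divr_gt0// mulr_gt0.
have ss1 : s <= s1 by rewrite ge_min lexx.
have se : s <= e by rewrite !ge_min lexx !orbT.
have sL : L * (2 * s) <= sg / 4.
  have : s <= sg / 4 / (2 * L) by rewrite !ge_min lexx !orbT.
  rewrite ler_pdivlMr ?mulr_gt0//; lra.
clearbody s.
have s20 : 0 < s ^+ 2 by rewrite exprn_gt0.
have s2e : e * s ^+ 2 <= sg / 4.
  apply: le_trans e2; rewrite -[leRHS]mulr1 ler_wpM2l ?(ltW e0)// expr_le1 ?(ltW s0)//.
  exact: le_trans se e1.
have [_ [x [t [t0 tT ->]]] near] := sup_adherent (mulr_gt0 e0 s20) supE.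
rewrite -/S in near.
have wx : sg / 4 <= w x t by have := mulr_ge0 (ltW de0) t0; lra.
have tp : 2 * s <= t.
  rewrite -(ler_pM2l L0); apply: (le_trans sL); apply: (le_trans wx); exact: wL.
have tpos : 0 < t by lra.
have wpos : 0 < w x t by lra.
have [Hx Ht] := Hs s s0 ss1 x t tpos tT wx.
have {}Ht := Ht tp.
have qb i : q i x t <= 4 * e.
  have [H1 H2] := Hx i.
  have := SE (s *: delta_mx 0 i + x) t t0 tT; have := SE (- s *: delta_mx 0 i + x) t t0 tT.
  move=> H3 H4; rewrite -(ler_pM2l s20); lra.
have pb i : `|p i x t| <= e * (2 + `|Q|).
  have [H1 H2] := Hx i.
  have := SE (s *: delta_mx 0 i + x) t t0 tT; have := SE (- s *: delta_mx 0 i + x) t t0 tT.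
  move=> H3 H4; have qq : - `|Q| <= q i x t.
    have := Hq i x t tpos tT wpos; rewrite ler_norml => /andP[? _].
    by apply: le_trans (_ : - Q <= _) => //; rewrite lerN2 ler_norm.
  have qs := ler_wpM2l (ltW s20) qq.
  have Hb : s * `|p i x t| <= 2 * e * s ^+ 2 + s ^+ 2 / 2 * `|Q|.
    rewrite -[s * _](_ : `|s * p i x t| = _); last by rewrite normrM gtr0_norm.
    by rewrite ler_norml; apply/andP; split; lra.
  have : `|p i x t| <= s * (2 * e + `|Q| / 2).
    by rewrite -(ler_pM2l s0); apply: (le_trans Hb); apply: le_of_eq; field.
  move=> /le_trans; apply; apply: ler_pM => //; first exact: ltW.
    by rewrite addr_ge0// ?divr_ge0// mulr_ge0// ltW.
  lra.
have mtb : mt x t <= n%:R * (e * (4 + B * (2 + `|Q|))).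
  apply: (le_trans (Hm x t tpos tT wpos)).
  apply: (@le_trans _ _ (\sum_(i < n) e * (4 + B * (2 + `|Q|)))).
    apply: ler_sum => i _; have := qb i; have := ler_wpM2l B0 (pb i); lra.
  by rewrite sumr_const card_ord mulr_natl.
have ts0 : 0 <= t - s by lra.
have tsT : t - s <= T by lra.
have := SE x (t - s) ts0 tsT => Hts.
have D : de <= mt x t + e + e * s by rewrite -(ler_pM2l s0); lra.
have : e * s <= e * 1 by rewrite ler_wpM2l ?(ltW e0)// (le_trans se).
move: e3; rewrite /K; lra.
Qed.

(** * Uniform Taylor estimates in the parabolic Hölder class *)

Section ParabolicClass.
Variables (R : realType) (n : nat) (a : R) (v : 'rV[R]_n -> R -> R).
Hypotheses (a0 : 0 < a) (Hv : C_2alpha_parabolic a v).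

Lemma is_derive_dtime x (t : R) : 0 < t -> is_derive t 1 (v x) (dtime v x t).
Proof.
move=> t0; have [_ dt _ _ _] := Hv.
have H : time_quotient v x t --> dtime v x t by exact: dt x t (ltW t0).
have H' : h^-1 *: ((v x \o shift t) (h *: 1) - v x t) @[h --> 0^'] --> dtime v x t.
  move=> A /H HA.
  have {}HA : \forall h \near (0 : R)^', 0 <= t + h -> A (h^-1 * (v x (t + h) - v x t)) := HA.
  suff : \forall h \near (0 : R)^', A (h^-1 *: ((v x \o shift t) (h *: 1) - v x t)) by [].
  near=> h; rewrite /= scaler1 (addrC h t).
  have th : 0 <= t + h.
    have : `|h| <= t by near: h; exact: (dnbhs0_le (V := R^o)).
    by rewrite ler_norml => /andP[? _]; lra.
  by move: th; near: h.
apply: DeriveDef; first by apply/cvg_ex; exists (dtime v x t).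
by apply: cvg_lim H'; exact: Rhausdorff.
Unshelve. all: by end_near. Qed.

(** The one-sided derivative at time 0 supplies arbitrarily small times at which [v] is close to its
    initial value; this extends the Lipschitz bound in time down to [t = 0]. *)
Lemma time_right_continuous x (e d : R) : 0 < e -> 0 < d ->
  exists2 s, 0 < s <= d & `|v x s - v x 0| <= e.
Proof.
move=> e0 d0; have [_ dt _ _ _] := Hv.
have H : time_quotient v x 0 --> dtime v x 0 by exact: dt x 0 (lexx _).
set l := dtime v x 0 in H.
have HA : \forall h \near (0 : R)^', 0 <= 0 + h -> ball l 1 (h^-1 * (v x (0 + h) - v x 0)).
  exact: H (nbhsx_ballx _ _ ltr01).
have lp : 0 < `|l| + 1 by rewrite ltr_wpDl.
have : \forall h \near (0 : R)^'+, [/\ 0 < h, h <= d, h <= e / (`|l| + 1) &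
    ball l 1 (h^-1 * (v x (0 + h) - v x 0))].
  near=> h; have h0 : 0 < h by near: h; exact: nbhs_right_gt.
  split => //.
  - by near: h; exact: nbhs_right_le.
  - by near: h; apply: nbhs_right_le; rewrite divr_gt0.
  - have : 0 <= 0 + h by rewrite add0r ltW.
    near: h; have HA' : nbhs (0 : R) (fun h => h != 0 -> 0 <= 0 + h ->
      ball l 1 (h^-1 * (v x (0 + h) - v x 0))) := HA.
    have : nbhs (0 : R) (fun h => 0 < h -> 0 <= 0 + h ->
      ball l 1 (h^-1 * (v x (0 + h) - v x 0))).
      by apply: filterS HA' => h hA h0; apply: hA; rewrite gt_eqF.
    by [].
move=> /filter_ex [h [h0 hd he]]; rewrite /ball /= add0r => Hb.
exists h; first by rewrite h0 hd.
have : `|h^-1 * (v x h - v x 0)| <= `|l| + 1.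
  have := ler_normB l (l - h^-1 * (v x h - v x 0)).
  by rewrite opprB addrC subrK; lra.
rewrite normrM normfV (gtr0_norm h0) mulrC ler_pdivrMr// => /le_trans; apply.
by rewrite mulrC -ler_pdivlMr.
Unshelve. all: by end_near. Qed.

(** One constant serves all points and indices, as the maximum principle has no fixed point to
    expand at. The time expansion goes backwards and keeps [2 s <= t], so that the mean value
    theorem stays at positive times. *)
Lemma parabolic_expansion : exists2 C : R, 0 <= C &
  [/\ forall x t, 0 <= t -> `|v x t| <= C,
      forall x s t, 0 <= s -> s <= t -> `|v x t - v x s| <= C * (t - s),
      forall x t i (s : R), 0 <= t ->
        `|v (s *: delta_mx 0 i + x) t - v x t - s * partial i (v^~ t) x
          - s ^+ 2 / 2 * partial i (partial i (v^~ t)) x| <= C * (s ^+ 2 * `|s| `^ a),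
      forall x (t s : R), 0 < s -> 2 * s <= t ->
        `|v x (t - s) - v x t + s * dtime v x t| <= C * (s * s `^ (a / 2)) &
      forall x t i, 0 <= t -> `|partial i (partial i (v^~ t)) x| <= C].
Proof.
have [dv _ [[C1 H1] _ H2 [C3 H3]] H4 [C5 H5]] := Hv.
have [F2 HF2] := choice (fun i => H2 i i).
have [F4 HF4] := choice (fun i => H4 i i).
have le_sum (F : 'I_n -> R) i : F i <= \sum_i `|F i|.
  by apply: (le_trans (ler_norm _)); rewrite (bigD1 i)//= lerDl sumr_ge0.
have [C2 {}H2] : exists C, forall i x t, 0 <= t -> `|partial i (partial i (v^~ t)) x| <= C.
  by exists (\sum_i `|F2 i|) => i x t t0; exact: le_trans (HF2 i x t t0) (le_sum F2 i).
have [C4 {}H4] : exists C, forall i x y t, 0 <= t ->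
    `|partial i (partial i (v^~ t)) x - partial i (partial i (v^~ t)) y| <= C * enorm (x - y) `^ a.
  exists (\sum_i `|F4 i|) => i x y t t0; apply: (le_trans (HF4 i x y t t t0 t0)).
  have E : `|t - t| `^ (a / 2) = 0.
    by rewrite subrr normr0 powR0// mulf_neq0 ?invr_eq0// gt_eqF.
  rewrite E addr0; apply: ler_wpM2r; [exact: powR_ge0|exact: le_sum].
pose s := [:: C1; C2; C3; C4; C5].
pose C := \sum_(x <- s) `|x|.
have sC x : x \in s -> x <= C.
  move=> xs; apply: (le_trans (ler_norm _)); rewrite /C (big_rem x)//=.
  by rewrite lerDl sumr_ge0.
have C0 : 0 <= C by rewrite sumr_ge0.
have [c1 c2 c3 c4 c5] : [/\ C1 <= C, C2 <= C, C3 <= C, C4 <= C & C5 <= C].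
  by split; apply: sC; rewrite !inE eqxx ?orbT.
clearbody C; exists C => //.
have mv x (r t : R) : 0 < r -> r <= t ->
    exists2 c, r <= c <= t & v x t - v x r = (t - r) * dtime v x c.
  move=> r0 rt.
  have [||c] := @MVT_segment R (v x) (dtime v x) r t rt.
  - by move=> y; rewrite in_itv/= => /andP[ry _]; apply: is_derive_dtime; exact: lt_trans ry.
  - apply: continuous_in_subspaceT => y; rewrite inE/= in_itv/= => /andP[ry _].
    apply: differentiable_continuous; apply/derivable1_diffP.
    by have [] := @is_derive_dtime x y (lt_le_trans r0 ry).
  by rewrite in_itv/= => ct ->; exists c => //; rewrite mulrC.
split.
- by move=> x t t0; exact: le_trans (H1 x t t0) c1.
- have lip x (r t : R) : 0 < r -> r <= t -> `|v x t - v x r| <= C * (t - r).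
    move=> r0 rt; have [c /andP[rc _] E] := mv x r t r0 rt.
    rewrite E normrM ger0_norm ?subr_ge0// mulrC; apply: ler_wpM2r; first by rewrite subr_ge0.
    exact: le_trans (H3 x c (le_trans (ltW r0) rc)) c3.
  move=> x r t; rewrite le_eqVlt => /orP[/eqP <-|r0]; last exact: lip.
  rewrite le_eqVlt => /orP[/eqP <-|t0]; first by rewrite !subrr normr0 mulr0.
  apply/ler_addgt0Pr => e e0.
  have [r' /andP[r0 rt] Hr] := time_right_continuous x e0 t0.
  rewrite (_ : v x t - v x 0 = (v x t - v x r') + (v x r' - v x 0)); last by ring.
  apply: (le_trans (ler_normD _ _)); apply: lerD => //.
  apply: (le_trans (lip x r' t r0 rt)); apply: ler_wpM2l => //; lra.
- move=> x t i r t0; have [d1 d2] := dv t t0.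
  apply: (le_trans (@line_expansion R n (v^~ t) i x C4 a r a0 d1 (d2 i) _)).
    by move=> y z; exact: H4.
  by apply: ler_wpM2r => //; apply: mulr_ge0; [exact: sqr_ge0|exact: powR_ge0].
- move=> x t r r0 rt.
  have tr0 : 0 < t - r by lra.
  have trt : t - r <= t by lra.
  have [c /andP[k1 k2] E] := mv x (t - r) t tr0 trt.
  rewrite (_ : t - (t - r) = r) in E; last by ring.
  rewrite (_ : _ - _ + _ = r * (dtime v x t - dtime v x c)); last by move: E; lra.
  rewrite normrM gtr0_norm// mulrCA; apply: ler_wpM2l; first exact: ltW.
  have c0' : 0 <= c by lra.
  have t0 : 0 <= t by lra.
  have H := H5 x x t c t0 c0'; rewrite subrr enorm0 powR0 ?gt_eqF// add0r in H.
  apply: (le_trans H); apply: (@le_trans _ _ (C * `|t - c| `^ (a / 2))).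
    by apply: ler_wpM2r => //; exact: powR_ge0.
  apply: ler_wpM2l => //; apply: ge0_ler_powR; rewrite ?nnegrE//; first by rewrite divr_ge0// ltW.
    exact: ltW.
  by rewrite ger0_norm; lra.
- by move=> x t i t0; exact: le_trans (H2 i x t t0) c2.
Qed.

End ParabolicClass.

Lemma edot_le_sum (R : realType) (n : nat) (B : R) (b g : 'rV[R]_n) :
  enorm b <= B -> edot b g <= \sum_i B * `|g 0 i|.
Proof.
move=> bB; apply: ler_sum => i _; apply: (le_trans (ler_norm _)); rewrite normrM.
by rewrite ler_wpM2r// (le_trans (coord_le_enorm _ _)).
Qed.

Lemma expansion_diff_le (R : realType) (A1 A2 w1 w2 P1 P2 Q1 Q2 h k K1 K2 E : R) :
  `|A1 - w1 - h * P1 - k * Q1| <= K1 -> `|A2 - w2 - h * P2 - k * Q2| <= K2 ->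
  K1 + K2 <= E -> w1 - w2 + h * (P1 - P2) + k * (Q1 - Q2) - E <= A1 - A2.
Proof. rewrite !ler_norml => /andP[? ?] /andP[? ?] ?; lra. Qed.

Lemma time_expansion_diff_le (R : realType) (A1 A2 w1 w2 m1 m2 h K1 K2 E : R) :
  `|A1 - w1 + h * m1| <= K1 -> `|A2 - w2 + h * m2| <= K2 ->
  K1 + K2 <= E -> w1 - w2 - h * (m1 - m2) - E <= A1 - A2.
Proof. rewrite !ler_norml => /andP[? ?] /andP[? ?] ?; lra. Qed.

Lemma parabolic_solution_le (R : realType) (n : nat) (a B : R)
    (b : 'rV[R]_n -> 'rV[R]_n) (v1 v2 : 'rV[R]_n -> R -> R) :
  0 < a -> (forall x, enorm (b x) <= B) ->
  C_2alpha_parabolic a v1 -> C_2alpha_parabolic a v2 ->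
  (forall x t, 0 <= t -> dtime v1 x t = laplacian (v1^~ t) x + edot (b x) (gradient (v1^~ t) x)) ->
  (forall x t, 0 <= t -> dtime v2 x t = laplacian (v2^~ t) x + edot (b x) (gradient (v2^~ t) x)) ->
  (forall x, v1 x 0 = v2 x 0) -> forall x t, 0 <= t -> v1 x t <= v2 x t.
Proof.
move=> a0 bB c1 c2 e1 e2 init x t t0.
have B0 : 0 <= B := le_trans (enorm_ge0 _) (bB 0).
have [C1 C10 [b1 t1 s1 d1 q1]] := parabolic_expansion a0 c1.
have [C2 C20 [b2 t2 s2 d2 q2]] := parabolic_expansion a0 c2.
pose T := t + 1; have T0 : 0 < T by rewrite ltr_wpDl.
rewrite -subr_le0.
apply: (@max_principle R n B (C1 + C2) (C1 + C2) (C1 + C2) T (fun x t => v1 x t - v2 x t)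
  (fun i x t => partial i (v1^~ t) x - partial i (v2^~ t) x)
  (fun i x t => partial i (partial i (v1^~ t)) x - partial i (partial i (v2^~ t)) x)
  (fun x t => dtime v1 x t - dtime v2 x t) B0 T0) => //.
- move=> y s sge _; have := b1 y s sge; have := b2 y s sge.
  by rewrite !ler_norml => /andP[? ?] /andP[? ?]; lra.
- move=> y s sge _; have := t1 y 0 s (lexx _) sge; have := t2 y 0 s (lexx _) sge; have := init y.
  by rewrite subr0 !ler_norml => ? /andP[? ?] /andP[? ?]; lra.
- move=> y s sge _ _; have s0 := ltW sge; rewrite e1// e2//.
  rewrite (_ : _ - _ = (laplacian (v1^~ s) y - laplacian (v2^~ s) y)
     + edot (b y) (gradient (v1^~ s) y - gradient (v2^~ s) y)); last first.
    by rewrite edotBr opprD addrACA.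
  rewrite big_split/=; apply: lerD; first by rewrite /laplacian -sumrB.
  apply: (le_trans (edot_le_sum _ (bB y))); apply: le_of_eq.
  by apply: eq_bigr => i _; rewrite !mxE.
- move=> i y s s0 _ _; apply: (le_trans (ler_normB _ _)); apply: lerD.
    exact: q1 (ltW s0).
  exact: q2 (ltW s0).
- move=> th e th0 e0.
  have [k1 k10 K1] := @small_power R (C1 + C2) e a e0 a0.
  have a2 : 0 < a / 2 by rewrite divr_gt0.
  have [k2 k20 K2] := @small_power R (C1 + C2) e (a / 2) e0 a2.
  exists (Num.min k1 k2) => [|s s0]; first by rewrite lt_min k10.
  rewrite le_min => /andP[sk1 sk2] y r r0 _ _.
  have {}K1 := ler_wpM2l (sqr_ge0 s) (K1 s (ltW s0) sk1).
  have {}K2 := ler_wpM2l (ltW s0) (K2 s (ltW s0) sk2).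
  have {}K1 : C1 * (s ^+ 2 * s `^ a) + C2 * (s ^+ 2 * s `^ a) <= e * s ^+ 2.
    by rewrite -mulrDl mulrCA [leRHS]mulrC.
  have {}K2 : C1 * (s * s `^ (a / 2)) + C2 * (s * s `^ (a / 2)) <= e * s.
    by rewrite -mulrDl mulrCA [leRHS]mulrC.
  split=> [i|sr]; first split.
  + have H1 := s1 y r i s (ltW r0); have H2 := s2 y r i s (ltW r0).
    rewrite (gtr0_norm s0) in H1 H2.
    exact: (expansion_diff_le H1 H2 K1).
  + have H1 := s1 y r i (- s) (ltW r0); have H2 := s2 y r i (- s) (ltW r0).
    rewrite normrN sqrrN (gtr0_norm s0) in H1; rewrite normrN sqrrN (gtr0_norm s0) in H2.
    have := expansion_diff_le H1 H2 K1; rewrite mulNr; exact.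
  + have H1 := d1 y r s s0 sr; have H2 := d2 y r s s0 sr.
    exact: (time_expansion_diff_le H1 H2 K2).
- by rewrite /T lerDl.
Qed.

(** * Spreading of positivity *)

(* All that the maximum principle needs of a solution: [P], [Q] and [m] play the part of
   its first and pure second space derivatives and of its time derivative. *)
Record expandable (R : realType) (n : nat) (a : R) (b : 'rV[R]_n -> 'rV[R]_n) (C : R)
    (v : 'rV[R]_n -> R -> R) (P Q : 'I_n -> 'rV[R]_n -> R -> R)
    (m : 'rV[R]_n -> R -> R) : Prop := Expandable {
  exp_C : 0 <= C;
  exp_bound : forall x t, 0 <= t -> `|v x t| <= C;
  exp_lip : forall x t, 0 <= t -> `|v x t - v x 0| <= C * t;
  exp_Q : forall x t i, 0 <= t -> `|Q i x t| <= C;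
  exp_space : forall x t i (s : R), 0 <= t ->
    `|v (s *: delta_mx 0 i + x) t - v x t - s * P i x t - s ^+ 2 / 2 * Q i x t|
      <= C * (s ^+ 2 * `|s| `^ a);
  exp_time : forall x (t s : R), 0 < s -> 2 * s <= t ->
    `|v x (t - s) - v x t + s * m x t| <= C * (s * s `^ (a / 2));
  exp_eq : forall x t, 0 <= t -> m x t = \sum_i Q i x t + edot (b x) (\row_i P i x t)
}.

(** Constants solve the equation, so affine images of a solution do. The pairs (0, 1) and ([U 0 t],
    -1) serve positivity and decay; the constant does not depend on the starting time [t0]. *)
Lemma expandable_affine (R : realType) (n : nat) (a : R) (b : 'rV[R]_n -> 'rV[R]_n)
    (u : 'rV[R]_n -> R -> R) (k0 k1 : R) :
  0 < a -> C_2alpha_parabolic a u ->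
  (forall x t, 0 <= t -> dtime u x t = laplacian (u^~ t) x + edot (b x) (gradient (u^~ t) x)) ->
  exists C, forall t0, 0 <= t0 ->
  expandable a b C (fun x t => k0 + k1 * u x (t0 + t))
    (fun i x t => k1 * partial i (u^~ (t0 + t)) x)
    (fun i x t => k1 * partial i (partial i (u^~ (t0 + t))) x)
    (fun x t => k1 * dtime u x (t0 + t)).
Proof.
move=> a0 cu eu; have [C C0 [H1 H2 H3 H4 H5]] := parabolic_expansion a0 cu.
exists (`|k0| + `|k1| * C) => t0 t00.
have kC : `|k1| * C <= `|k0| + `|k1| * C by rewrite lerDr.
split.
- by rewrite addr_ge0// mulr_ge0.
- move=> x t tge; apply: (le_trans (ler_normD _ _)); rewrite lerD2l normrM ler_wpM2l//.
  exact: H1 (addr_ge0 t00 tge).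
- move=> x t tge; rewrite addr0 (_ : _ - _ = k1 * (u x (t0 + t) - u x t0)); last by ring.
  rewrite normrM; apply: (@le_trans _ _ (`|k1| * C * t)); last by rewrite ler_wpM2r.
  rewrite -mulrA ler_wpM2l//; have := H2 x t0 (t0 + t) t00.
  by rewrite lerDl (_ : t0 + t - t0 = t) => [|]; [apply|ring].
- move=> x t i tge; rewrite normrM; apply: le_trans kC; rewrite ler_wpM2l//.
  exact: H5 (addr_ge0 t00 tge).
- move=> x t i s tge; have H := H3 x (t0 + t) i s (addr_ge0 t00 tge).
  move: H; move: (u _ _) (u _ _) (partial _ _ _) (partial _ _ _) => A A' p q H.
  rewrite /= (_ : _ - _ - _ - _ = k1 * (A' - A - s * q - s ^+ 2 / 2 * p)); last by ring.
  rewrite normrM; apply: (@le_trans _ _ (`|k1| * (C * (s ^+ 2 * `|s| `^ a)))).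
    by rewrite ler_wpM2l.
  rewrite [leLHS]mulrA; apply: ler_wpM2r => //.
  by apply: mulr_ge0; [exact: sqr_ge0|exact: powR_ge0].
- move=> x t s s0 st; have st' : 2 * s <= t0 + t by lra.
  have H := H4 x (t0 + t) s s0 st'; rewrite addrA.
  move: H; move: (u _ _) (u _ _) (dtime _ _ _) => A A' q H.
  rewrite /= (_ : _ - _ + _ = k1 * (A' - A + s * q)); last by ring.
  rewrite normrM; apply: (@le_trans _ _ (`|k1| * (C * (s * s `^ (a / 2))))).
    by rewrite ler_wpM2l.
  rewrite [leLHS]mulrA; apply: ler_wpM2r => //.
  by apply: mulr_ge0; [exact: ltW|exact: powR_ge0].
- move=> x t tge; rewrite eu ?addr_ge0// mulrDr /laplacian mulr_sumr -edotZr.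
  by congr (_ + edot _ _); apply/rowP => i; rewrite !mxE.
Qed.

Section Spreading.
Variables (R : realType) (n : nat) (a B rho c T eps : R) (b : 'rV[R]_n -> 'rV[R]_n).
Hypotheses (a0 : 0 < a) (bB : forall x, enorm (b x) <= B).
Hypotheses (rho0 : 0 < rho) (c0 : 0 <= c) (T0 : 0 < T) (eps0 : 0 < eps).

(** The barrier is supported within distance [Y] of [x0] up to time [T]. In [C1] the part [2 * c]
    comes from the moving front, [4 * n%:R] from the Laplacian of [|x - x0|^2], and [4 * B * Y] from
    the drift. *)
Let Y := Num.sqrt (rho + c * T).
Let C1 := 2 * c + 4 * n%:R + 4 * B * Y.
(* Large enough for [A e^(- K t) (rho + c t - |x - x0|^2)_+^2] to be a subsolution. *)
Let K := 2 * C1 / rho + C1 ^+ 2 / (16 * rho).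
Let A := eps / rho ^+ 2.

Let B0 : 0 <= B. Proof. exact: le_trans (enorm_ge0 _) (bB 0). Qed.
Let Y0 : 0 <= Y. Proof. exact: sqrtr_ge0. Qed.
Let C10 : 0 <= C1. Proof. by rewrite !addr_ge0// !mulr_ge0. Qed.
Let A0 : 0 < A. Proof. by rewrite divr_gt0// exprn_gt0. Qed.
Let K0 : 0 <= K.
Proof.
have r0 := ltW rho0; apply: addr_ge0; first by rewrite divr_ge0// mulr_ge0.
by rewrite divr_ge0 ?sqr_ge0// mulr_ge0.
Qed.
Let Y2 : Y ^+ 2 = rho + c * T.
Proof. by rewrite sqr_sqrtr// addr_ge0 ?mulr_ge0// ltW. Qed.

(** For [z >= rho / 2] the first summand of [K] suffices. Otherwise [s >= rho / 2], so
    [8 s >= 4 rho], and completing the square [(C1 z - 8 rho)^2] accounts for the second summand. *)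
Let barrier_ineq (z s : R) : 0 <= z -> 0 <= s -> rho <= z + s ->
  C1 * z <= K * z ^+ 2 + 8 * s.
Proof.
move=> z0 s0 zs; have rp := rho0; have r0 := ltW rho0; have C1p := C10.
have [zr|zr] := leP (rho / 2) z.
  have H1 : C1 * z <= 2 * C1 / rho * z ^+ 2.
    rewrite [leRHS](_ : _ = C1 * z * (z / (rho / 2))); last by field; rewrite gt_eqF.
    rewrite ler_peMr ?mulr_ge0// ler_pdivlMr ?mul1r// divr_gt0//.
  have H2 : 0 <= C1 ^+ 2 / (16 * rho) * z ^+ 2.
    by rewrite mulr_ge0 ?sqr_ge0// divr_ge0 ?sqr_ge0// mulr_ge0.
  rewrite /K; lra.
have H2 : C1 * z <= C1 ^+ 2 / (16 * rho) * z ^+ 2 + 4 * rho.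
  have : 0 <= (C1 * z - 8 * rho) ^+ 2 / (16 * rho) by rewrite divr_ge0 ?sqr_ge0// mulr_ge0.
  by rewrite [X in 0 <= X](_ : _ = C1 ^+ 2 / (16 * rho) * z ^+ 2 + 4 * rho - C1 * z);
    [lra|field; rewrite gt_eqF].
have H1 : 0 <= 2 * C1 / rho * z ^+ 2.
  by rewrite mulr_ge0 ?sqr_ge0// divr_ge0// mulr_ge0.
rewrite /K; lra.
Qed.

Variables (v : 'rV[R]_n -> R -> R) (P Q : 'I_n -> 'rV[R]_n -> R -> R).
Variables (m : 'rV[R]_n -> R -> R) (C : R) (x0 : 'rV[R]_n).
Hypothesis Hv : expandable a b C v P Q m.
Hypothesis v_ge0 : forall x t, 0 <= t -> t <= T -> 0 <= v x t.
Hypothesis v_init : forall x, enorm (x - x0) ^+ 2 <= rho -> eps <= v x 0.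

Let z x t := rho + c * t - enorm (x - x0) ^+ 2.
Let zp x t := Num.max (z x t) 0.
Let w x t := A * expR (- (K * t)) * zp x t ^+ 2 - v x t.

Let z_line x t (s : R) i : z (s *: delta_mx 0 i + x) t =
  z x t - 2 * s * (x - x0) 0 i - s ^+ 2.
Proof. by rewrite /z -[_ + x - x0]addrA sqr_enorm_line; ring. Qed.

Let zle x t : 0 <= t -> t <= T -> z x t <= Y ^+ 2.
Proof.
move=> t0 tT; rewrite Y2 /z; have := ler_wpM2l c0 tT.
have := sqr_ge0 (enorm (x - x0)); lra.
Qed.

Let exp01 (t : R) : 0 <= t -> 0 < expR (- (K * t)) <= 1.
Proof. by move=> t0; rewrite expR_gt0 -expR0 ler_expR oppr_le0 mulr_ge0. Qed.

(** As [v >= 0], the difference can be positive only inside the support of the barrier, where the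
    truncated square is smooth; this is why the maximum principle restricts its hypotheses to
    [0 < w]. *)
Let w_pos x t : 0 <= t -> t <= T -> 0 < w x t ->
  [/\ 0 < z x t, zp x t = z x t & enorm (x - x0) <= Y].
Proof.
move=> t0 tT wp; have zpos : 0 < z x t.
  rewrite ltNge; apply/negP => z0; move: wp.
  rewrite /w /zp max_r// expr0n mulr0 sub0r; have := v_ge0 x t0 tT; lra.
split => //; first by rewrite /zp max_l// ltW.
rewrite -(@ler_pXn2r _ 2)// ?nnegrE ?enorm_ge0// Y2.
move: zpos; rewrite /z; have := ler_wpM2l c0 tT; lra.
Qed.

Let w_init x : w x 0 <= 0.
Proof.
rewrite /w mulr0 oppr0 expR0 mulr1; have [z0|z0] := leP (z x 0) 0.
  rewrite /zp max_r// expr0n mulr0 sub0r oppr_le0; exact: v_ge0 (lexx _) (ltW T0).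
rewrite /zp max_l ?(ltW z0)//.
have zr : z x 0 <= rho by have := sqr_ge0 (enorm (x - x0)); rewrite /z mulr0; lra.
have : eps <= v x 0 by apply: v_init; move: z0; rewrite /z mulr0 addr0; lra.
have : A * z x 0 ^+ 2 <= A * rho ^+ 2.
  by rewrite ler_wpM2l ?(ltW A0)// ler_pXn2r ?nnegrE ?(ltW z0)// ltW.
rewrite {2}/A divfK ?expf_neq0 ?gt_eqF//; lra.
Qed.

Let w_lip x t : 0 <= t -> t <= T -> w x t <= (A * (2 * (Y ^+ 2 * c)) + C) * t.
Proof.
move=> t0 tT; have := w_init x; have := exp_lip Hv x t0; rewrite ler_norml => /andP[H1 _].
rewrite /w mulr0 oppr0 expR0 mulr1 => H2.
have [/andP[e0 e1]] := (exp01 t0).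
have ct : 0 <= c * t by rewrite mulr_ge0.
have zt : z x t = z x 0 + c * t by rewrite /z mulr0; ring.
have p0 : 0 <= zp x 0 by rewrite le_max lexx orbT.
have pt0 : 0 <= zp x t by rewrite le_max lexx orbT.
have pt : zp x t <= zp x 0 + c * t.
  rewrite /zp ge_max addr_ge0// andbT zt lerD2r le_max lexx//.
have pY : zp x t <= Y ^+ 2 by rewrite /zp ge_max zle// sqr_ge0.
have p0Y : zp x 0 <= Y ^+ 2 by rewrite /zp ge_max zle ?sqr_ge0// ltW.
have D : zp x t ^+ 2 - zp x 0 ^+ 2 <= 2 * (Y ^+ 2 * (c * t)).
  rewrite subr_sqr; apply: (@le_trans _ _ (c * t * (zp x t + zp x 0))).
    by rewrite ler_wpM2r ?addr_ge0//; lra.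
  rewrite mulrC [leRHS]mulrA ler_wpM2r//; lra.
have E : A * expR (- (K * t)) * zp x t ^+ 2 <= A * zp x t ^+ 2.
  by rewrite ler_wpM2r ?sqr_ge0// ler_piMr// ltW.
have := ler_wpM2l (ltW A0) D; lra.
Qed.

Let barrier_final (X S Yd D zz gg qs : R) : X <= S ->
  gg * (4 * zz) * Yd <= gg * (4 * zz) * (B * Y) ->
  gg * (C1 * zz) <= gg * (K * zz ^+ 2 + 8 * D) ->
  gg * (2 * c * zz - K * zz ^+ 2) - (qs + (- X - gg * (4 * zz) * Yd))
    <= gg * (8 * D - 4 * n%:R * zz) - qs + S.
Proof. rewrite /C1; move: Y K => Y' K'; lra. Qed.

(** The square expands exactly; beyond second order it leaves [s^4 >= 0] and the cubic term
    [4 s^2 h d], the only one without a sign. *)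
Let barrier_space (G0 z0 d h s e w0 w1 p q Cs : R) : h ^+ 2 = s ^+ 2 ->
  `|w1 - w0 - h * p - s ^+ 2 / 2 * q| <= C * Cs -> C * Cs <= s ^+ 2 * (e / 2) ->
  - (s ^+ 2 * (e / 2)) <= G0 * (4 * s ^+ 2 * (h * d)) -> 0 <= G0 * s ^+ 2 ^+ 2 ->
  G0 * z0 ^+ 2 - w0 + h * (G0 * (- (4 * z0 * d)) - p)
      + s ^+ 2 / 2 * (G0 * (8 * d ^+ 2 - 4 * z0) - q) - e * s ^+ 2
  <= G0 * (z0 - 2 * h * d - s ^+ 2) ^+ 2 - w1.
Proof.
move=> h2 H H1 H2 H3.
have -> : (z0 - 2 * h * d - s ^+ 2) ^+ 2 = z0 ^+ 2 + 4 * h ^+ 2 * d ^+ 2 + s ^+ 2 ^+ 2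
   - 4 * (z0 * h * d) - 2 * z0 * s ^+ 2 + 4 * (s ^+ 2 * (h * d)) by ring.
move: H; rewrite h2 ler_norml => /andP[H H']; lra.
Qed.

Let barrier_time (K' c' G0 G1 z0 s e w0 w1 m' Cs : R) : 0 <= K' -> 0 <= s -> 0 <= G0 ->
  (1 + K' * s) * G0 <= G1 ->
  `|w1 - w0 + s * m'| <= Cs -> Cs <= s * (e / 2) ->
  s * (2 * (K' * c' * (G0 * z0))) <= e / 2 ->
  G0 * z0 ^+ 2 - w0 - s * (G0 * (2 * c' * z0 - K' * z0 ^+ 2) - m') - e * s
  <= G1 * (z0 - c' * s) ^+ 2 - w1.
Proof.
move=> K0' s0 G00 G1G H H1 H2.
have := ler_wpM2r (sqr_ge0 (z0 - c' * s)) G1G.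
have Ks : 0 <= (1 + K' * s) * G0 by rewrite mulr_ge0// addr_ge0// mulr_ge0.
have := mulr_ge0 Ks (sqr_ge0 (c' * s)).
have := ler_wpM2l s0 H2.
move: H; rewrite ler_norml => /andP[_ H]; lra.
Qed.

Lemma spreading x t : 0 <= t -> t <= T ->
  A * expR (- (K * t)) * zp x t ^+ 2 <= v x t.
Proof.
move=> t0 tT; rewrite -subr_le0.
pose g t := A * expR (- (K * t)).
have g0 r : 0 < g r by rewrite /g mulr_gt0// expR_gt0.
have gA r : 0 <= r -> g r <= A.
  by move=> r0; rewrite /g ler_piMr ?(ltW A0)//; have /andP[] := exp01 r0.
have C0 := exp_C Hv.
apply: (@max_principle R n B (A * (8 * Y ^+ 2 + 4 * Y ^+ 2) + C) (A * (2 * (Y ^+ 2 * c)) + C)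
  (A * (Y ^+ 2) ^+ 2 + C) T w
  (fun i x t => g t * (- (4 * z x t * (x - x0) 0 i)) - P i x t)
  (fun i x t => g t * (8 * (x - x0) 0 i ^+ 2 - 4 * z x t) - Q i x t)
  (fun x t => g t * (2 * c * z x t - K * z x t ^+ 2) - m x t) B0 T0) => //.
- move=> y r r0 rT; rewrite /w -/(g r).
  have := exp_bound Hv y r0; rewrite ler_norml => /andP[H _].
  have p0 : 0 <= zp y r by rewrite le_max lexx orbT.
  have pY : zp y r <= Y ^+ 2 by rewrite /zp ge_max zle// sqr_ge0.
  have : g r * zp y r ^+ 2 <= A * (Y ^+ 2) ^+ 2.
    apply: ler_pM; rewrite ?sqr_ge0// ?(ltW (g0 r)) ?gA//.
    by rewrite ler_pXn2r ?nnegrE ?sqr_ge0.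
  lra.
- move=> y r r0 rT wp; have [zpos zpz dY] := w_pos (ltW r0) rT wp.
  rewrite (exp_eq Hv y (ltW r0)).
  set d := y - x0 in dY *.
  have bd : edot (b y) d <= B * Y.
    apply: (le_trans (ler_norm _)); apply: (le_trans (edot_le _ _)).
    by apply: ler_pM; rewrite ?enorm_ge0 ?bB.
  have E1 : edot (b y) (\row_i P i y r) = - edot (b y) (\row_i (g r * (- (4 * z y r * d 0 i)) - P i y r))
      - g r * (4 * z y r) * edot (b y) d.
    rewrite -[RHS]opprD -[- (_ + _)]mulN1r -edotZr -edotDr -edotZr.
    by congr edot; apply/rowP => i; rewrite !mxE; ring.
  have E2 := @edot_le_sum _ _ B (b y) (\row_i (g r * (- (4 * z y r * d 0 i)) - P i y r)) (bB y).
  have E3 : \sum_(i < n) (g r * (8 * d 0 i ^+ 2 - 4 * z y r) - Q i y r) =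
      g r * (8 * enorm d ^+ 2 - 4 * n%:R * z y r) - \sum_(i < n) Q i y r.
    rewrite sumrB -mulr_sumr; congr (g r * _ - _).
    rewrite sumrB sumr_const card_ord -mulr_sumr sqr_enorm -[4 * z y r *+ n]mulr_natr; congr (8 * _ - _).
  by ring.
  rewrite big_split/= E3 E1.
  have E4 : \sum_i B * `|(\row_i (g r * (- (4 * z y r * d 0 i)) - P i y r)) 0 i| =
     \sum_(i < n) B * `|g r * - (4 * z y r * d 0 i) - P i y r|.
    by apply: eq_bigr => i _; rewrite mxE.
  rewrite E4 in E2.
  have Hb := barrier_ineq (ltW zpos) (sqr_ge0 (enorm d)) _.
  have {}Hb : C1 * z y r <= K * z y r ^+ 2 + 8 * enorm d ^+ 2.
    apply: Hb; rewrite /z -/d; have : 0 <= c * r by rewrite mulr_ge0// ltW.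
    lra.
  have Hb2 := ler_wpM2l (mulr_ge0 (ltW (g0 r)) (mulr_ge0 (ler0n R 4) (ltW zpos))) bd.
  have Hb3 := ler_wpM2l (ltW (g0 r)) Hb.
  exact: (barrier_final _ E2 Hb2 Hb3).
- move=> i y r r0 rT wp; have [zpos zpz dY] := w_pos (ltW r0) rT wp.
  apply: (le_trans (ler_normB _ _)); apply: lerD; last exact: exp_Q Hv _ _ _ (ltW r0).
  rewrite normrM (gtr0_norm (g0 r)); apply: ler_pM => //; first exact: ltW.
    exact: gA (ltW r0).
  apply: (le_trans (ler_normB _ _)); apply: lerD; rewrite normrM normr_nat ler_wpM2l//.
    rewrite normrX ler_pXn2r ?nnegrE//; exact: le_trans (coord_le_enorm _ _) dY.
  by rewrite gtr0_norm// zle// ltW.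
- move=> th e th0 e0.
  have [k1 k10 K1] := @small_power R C (e / 2) a (divr_gt0 e0 (ltr0Sn _ 1)) a0.
  have a2 : 0 < a / 2 by rewrite divr_gt0.
  have [k2 k20 K2] := @small_power R C (e / 2) (a / 2) (divr_gt0 e0 (ltr0Sn _ 1)) a2.
  (* Where [w >= th], the barrier forces [z >= zeta], and steps below [k5] keep [z] nonnegative.
     [k3] absorbs the cubic remainder in space, [k4] the mixed term of the time step. *)
  pose zeta := Num.sqrt (th / A).
  have zeta0 : 0 < zeta by rewrite sqrtr_gt0 divr_gt0.
  pose k3 := e / (2 * (A * (4 * Y) + 1)).
  pose k4 := e / (2 * (2 * (K * c * Y ^+ 2) * A + 1)).
  pose k5 := zeta / (2 * Y + 1 + c).
  have AY : 0 < A * (4 * Y) + 1 by rewrite ltr_wpDl// mulr_ge0 ?(ltW A0)// mulr_ge0.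
  have KY : 0 <= K * c * Y ^+ 2 by rewrite mulr_ge0 ?sqr_ge0// mulr_ge0.
  have AK : 0 < 2 * (K * c * Y ^+ 2) * A + 1 by rewrite ltr_wpDl// mulr_ge0 ?(ltW A0)// mulr_ge0.
  have Yc : 0 < 2 * Y + 1 + c by have := Y0; have := c0; lra.
  have k30 : 0 < k3 by rewrite divr_gt0// mulr_gt0.
  have k40 : 0 < k4 by rewrite divr_gt0// mulr_gt0.
  have k50 : 0 < k5 by rewrite divr_gt0.
  exists (Num.min 1 (Num.min k1 (Num.min k2 (Num.min k3 (Num.min k4 k5))))) => [|s s0].
    by rewrite !lt_min ltr01 k10 k20 k30 k40 k50.
  rewrite !le_min => /andP[s1 /andP[sk1 /andP[sk2 /andP[sk3 /andP[sk4 sk5]]]]] y r r0 rT thw.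
  have {}K1 := ler_wpM2l (sqr_ge0 s) (K1 s (ltW s0) sk1).
  have {}K2 := ler_wpM2l (ltW s0) (K2 s (ltW s0) sk2).
  have [zpos zpz dY] := w_pos (ltW r0) rT (lt_le_trans th0 thw).
  have g1 := g0 r; have g2 := gA r (ltW r0).
  have zzeta : zeta <= z y r.
    have thA : 0 <= th / A := ltW (divr_gt0 th0 A0).
    rewrite -(@ler_pXn2r _ 2)// ?nnegrE ?(ltW zeta0) ?(ltW zpos)// (sqr_sqrtr thA).
    rewrite (ler_pdivrMr _ _ A0) mulrC; move: thw; rewrite /w zpz -/(g r).
    have := ler_wpM2r (sqr_ge0 (z y r)) g2; have := v_ge0 y (ltW r0) rT; lra.
  have {}sk3 : s * (A * (4 * Y)) <= e / 2.
    move: sk3; rewrite ler_pdivlMr ?mulr_gt0//; lra.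
  have {}sk4 : s * (2 * (K * c * Y ^+ 2) * A) <= e / 2.
    move: sk4; rewrite ler_pdivlMr ?mulr_gt0//; lra.
  have {}sk5 : s * (2 * Y + 1 + c) <= z y r.
    by apply: le_trans zzeta; move: sk5; rewrite ler_pdivlMr.
  have ss : s * s <= s by rewrite -[leRHS]mulr1 ler_wpM2l// ltW.
  have s20 : 0 <= s ^+ 2 := sqr_ge0 s.
  have sY0 : 0 <= s * Y by rewrite mulr_ge0// ltW.
  have sc0 : 0 <= s * c by rewrite mulr_ge0// ltW.
  have space (h : R) i : `|h| = s ->
      w y r + h * (g r * (- (4 * z y r * (y - x0) 0 i)) - P i y r)
      + h ^+ 2 / 2 * (g r * (8 * (y - x0) 0 i ^+ 2 - 4 * z y r) - Q i y r) - e * s ^+ 2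
      <= w (h *: delta_mx 0 i + y) r.
    move=> hs; have := exp_space Hv y i h (ltW r0); rewrite hs.
    have h2 : h ^+ 2 = s ^+ 2 by rewrite -(real_normK (num_real h)) hs.
    have dd : `|(y - x0) 0 i| <= Y := le_trans (coord_le_enorm _ _) dY.
    move: dd; set d := (y - x0) 0 i => dd.
    have hd : `|h * d| <= s * Y by rewrite normrM hs ler_wpM2l// ltW.
    have zh0 : 0 <= z (h *: delta_mx 0 i + y) r.
      rewrite z_line -/d h2; move: hd; rewrite ler_norml => /andP[? ?].
      by move: ss; rewrite expr2; lra.
    have zph : zp (h *: delta_mx 0 i + y) r = z y r - 2 * h * d - s ^+ 2.
      by rewrite /zp max_l// z_line h2.
    rewrite /w zph zpz -!/(g r) h2.
    have cub : - (s ^+ 2 * (e / 2)) <= g r * (4 * s ^+ 2 * (h * d)).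
      have : g r * (4 * s ^+ 2 * `|h * d|) <= A * (4 * s ^+ 2 * (s * Y)).
        apply: ler_pM => //; first exact: ltW.
          by rewrite mulr_ge0// mulr_ge0.
        by rewrite ler_wpM2l// mulr_ge0.
      have := ler_wpM2l s20 sk3.
      have : - `|h * d| <= h * d by rewrite lerNl -normrN ler_norm.
      move=> /(ler_wpM2l (mulr_ge0 (ltW g1) (mulr_ge0 (ler0n R 4) s20))); lra.
    have qua : 0 <= g r * s ^+ 2 ^+ 2 by rewrite mulr_ge0 ?sqr_ge0// ltW.
    by move=> H; apply: (barrier_space _ h2 H _ cub qua); rewrite mulrCA.
  split=> [i|sr]; first split.
  + by apply: space; rewrite gtr0_norm.
  + by have := space (- s) i; rewrite normrN gtr0_norm// sqrrN mulNr => /(_ erefl).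
  + have zt : z y (r - s) = z y r - c * s by rewrite /z; ring.
    have zpt : zp y (r - s) = z y r - c * s.
      rewrite /zp max_l zt// subr_ge0; move: sk5 s0 sY0; lra.
    rewrite /w zpt zpz -!/(g _).
    have KG : (1 + K * s) * g r <= g (r - s).
      have -> : g (r - s) = expR (K * s) * g r.
        rewrite /g mulrCA -expRD; congr (_ * expR _); ring.
      by rewrite ler_wpM2r ?(ltW g1)// expR_ge1Dx.
    apply: (barrier_time K0 (ltW s0) (ltW g1) KG (exp_time Hv y s0 sr)).
      by rewrite mulrCA.
    have gz : g r * z y r <= A * Y ^+ 2.
      by apply: ler_pM => //; [exact: ltW|exact: ltW|exact: zle (ltW r0) rT].
    have Kc : 0 <= K * c by rewrite mulr_ge0.
    apply: le_trans sk4; apply: ler_wpM2l; first exact: ltW.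
    have := ler_wpM2l Kc gz.
    move: (K * c) (g r * z y r) (Y ^+ 2) => q1 q2 q3; lra.
Qed.

End Spreading.

(** The bound [k] is chosen before the solution, its constant and the centre. This uniformity is
    what lets the maximum drop by the same amount in every unit of time. *)
Lemma spreading_gap (R : realType) (n : nat) (a B rho c T eps : R) (b : 'rV[R]_n -> 'rV[R]_n) :
  0 < a -> (forall x, enorm (b x) <= B) -> 0 < rho -> 0 <= c -> 0 < T -> 0 < eps ->
  exists2 k : R, 0 < k & forall v P Q m C x0, expandable a b C v P Q m ->
    (forall x t, 0 <= t -> t <= T -> 0 <= v x t) ->
    (forall x, enorm (x - x0) ^+ 2 <= rho -> eps <= v x 0) ->
    forall x, enorm (x - x0) ^+ 2 <= c * T -> k <= v x T.
Proof.
move=> a0 bB rho0 c0 T0 eps0; eexists; last first.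
  move=> v P Q m C x0 Hv v0 vi x xT.
  apply: le_trans (spreading a0 bB rho0 c0 T0 eps0 Hv v0 vi x (ltW T0) (lexx T)).
  apply: ler_wpM2l.
    by rewrite mulr_ge0 ?expR_ge0// divr_ge0 ?sqr_ge0// ltW.
  have zr : rho <= rho + c * T - enorm (x - x0) ^+ 2 by lra.
  have z0 := le_trans (ltW rho0) zr.
  have zr2 : rho ^+ 2 <= (rho + c * T - enorm (x - x0) ^+ 2) ^+ 2.
    by rewrite ler_pXn2r ?nnegrE ?(ltW rho0).
  by rewrite (max_l z0); exact: zr2.
by rewrite mulr_gt0 ?exprn_gt0// mulr_gt0 ?expR_gt0// divr_gt0// exprn_gt0.
Qed.

(** * Decay of the profile *)

(** Over N equal pieces the superlinear errors add up to at most [(t - s) e] once the pieces are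
    short, for any [e > 0]. *)
Lemma superlinear_nonincreasing (R : realType) (f : R -> R) (K c : R) : 0 < c ->
  (forall s t, 0 <= s -> s <= t -> f t - f s <= K * ((t - s) * (t - s) `^ c)) ->
  forall s t, 0 <= s -> s <= t -> f t <= f s.
Proof.
move=> c0 H s t s0 st.
have ts : 0 <= t - s by rewrite subr_ge0.
suff S e : 0 < e -> f t - f s <= (t - s) * e.
  have [/eqP|tsp] := eqVneq (t - s) 0.
    by rewrite subr_eq0 => /eqP ->.
  have {}tsp : 0 < t - s by rewrite lt_neqAle eq_sym tsp.
  apply/ler_addgt0Pr => e e0; rewrite -lerBlDl.
  by have := S (e / (t - s)) (divr_gt0 e0 tsp); rewrite mulrCA divff ?gt_eqF// mulr1.
move=> e0; have [d d0 Hd] := small_power K e0 c0.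
have [N HN] : exists N : nat, (t - s) / N.+1%:R <= d.
  exists (Num.truncn ((t - s) / d)); rewrite ler_pdivrMr// mulrC -ler_pdivrMr//.
  by apply/ltW; rewrite truncnS_gt.
pose h := (t - s) / N.+1%:R.
have h0 : 0 <= h by rewrite divr_ge0.
have I i : f (s + i%:R * h) - f s <= i%:R * (h * e).
  elim: i => [|i IH]; first by rewrite !mul0r addr0 subrr.
  have si : 0 <= s + i%:R * h by rewrite addr_ge0// mulr_ge0.
  have := H (s + i%:R * h) (s + i.+1%:R * h) si.
  rewrite (_ : s + i.+1%:R * h - (s + i%:R * h) = h); last by rewrite -natr1; ring.
  rewrite lerD2l ler_wpM2r// ?ler_nat// => /(_ isT).
  have := ler_wpM2l h0 (Hd h h0 HN); rewrite -natr1; lra.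
have := I N.+1; rewrite /h [N.+1%:R * (_ / _)]mulrCA divff ?pnatr_eq0// mulr1 subrKC.
by rewrite mulrA [N.+1%:R * _]mulrCA divff ?pnatr_eq0// mulr1.
Qed.

Lemma derive_ge0_le (R : realType) (f f' : R -> R) (x y : R) : x <= y ->
  (forall z : R, x <= z -> {for z, continuous f}) ->
  (forall z : R, x < z -> z < y -> is_derive z 1 f (f' z)) ->
  (forall z, x < z -> z < y -> 0 <= f' z) -> f x <= f y.
Proof.
move=> xy cf df f0.
have cw : {within `[x, y], continuous f}.
  by apply: continuous_in_subspaceT => z; rewrite inE/= in_itv/= => /andP[xz _]; exact: cf.
have dfz z : z \in `]x, y[%R -> is_derive z 1 f (f' z).
  by rewrite in_itv/= => /andP[? ?]; exact: df.
have [->//|xny] := eqVneq x y.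
have xlty : x < y by rewrite lt_neqAle xny.
have [c] := MVT xlty dfz cw.
rewrite in_itv/= => /andP[xc cy] E.
by rewrite -subr_ge0 E mulr_ge0 ?f0// subr_ge0.
Qed.

(** The integral starts at a negative [c], so the antiderivative is differentiable at 0 too, with no
    one-sided derivative to treat. *)
Lemma antiderivative (R : realType) (f : R -> R) (c : R) : c < 0 ->
  (forall x : R, c <= x -> {for x, continuous f}) ->
  exists2 F : R -> R, F 0 = 0 & forall x : R, c < x -> is_derive x 1 F (f x).
Proof.
move=> c0 cf; pose F0 (x : R) := \int[@lebesgue_measure R]_(t in [set` `[c, x]]) f t.
exists (fun x => F0 x - F0 0); first by rewrite subrr.
move=> x x1.
have xx : x < x + 1 by rewrite ltrDl.
have I : (@lebesgue_measure R).-integrable `[c, x + 1] (EFin \o f).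
  apply: continuous_compact_integrable; first exact: segment_compact.
  by apply: continuous_in_subspaceT => z; rewrite inE/= in_itv/= => /andP[cz _]; exact: cf.
have [dF F1] := continuous_FTC1_closed xx I x1 (cf x (ltW x1)).
have dF0 : is_derive x 1 F0 (f x).
  by split; [exact: dF|rewrite -F1 derive1E].
by rewrite -[f x]subr0; apply: is_deriveB.
Qed.

Lemma is_derive_continuous_at (R : realType) (f : R -> R) (x d : R) :
  is_derive x 1 f d -> {for x, continuous f}.
Proof. by case=> df _; apply: differentiable_continuous; apply/derivable1_diffP. Qed.

Lemma holder_continuous (R : realType) (f : R -> R) (K c : R) : 0 < c ->
  (forall x y, `|x - y| <= 1 -> `|f x - f y| <= K * `|x - y| `^ c) -> continuous f.
Proof.
move=> c0 H x; apply/cvgrPdist_le => e e0.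
have [d d0 Hd] := small_power K e0 c0.
have d1 : 0 < Num.min 1 d by rewrite lt_min ltr01.
near=> y; have xy : `|x - y| <= Num.min 1 d.
  by near: y; by exists (Num.min 1 d) => //= z /ltW.
move: xy; rewrite le_min => /andP[xy1 xyd].
exact: le_trans (H _ _ xy1) (Hd _ (normr_ge0 _) xyd).
Unshelve. all: by end_near. Qed.

Lemma is_derive_lin (R : realType) (f g : R -> R) (x c1 c2 df dg : R) :
  is_derive x 1 f df -> is_derive x 1 g dg ->
  is_derive x 1 (fun y => c1 * f y + c2 * g y) (c1 * df + c2 * dg).
Proof.
move=> Hf Hg; have [d e] := is_deriveD (is_deriveZ c1 Hf) (is_deriveZ c2 Hg).
by split; [exact: d|exact: e].
Qed.

Lemma is_derive_mul (R : realType) (f g : R -> R) (x df dg : R) :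
  is_derive x 1 f df -> is_derive x 1 g dg ->
  is_derive x 1 (fun y => f y * g y) (f x * dg + g x * df).
Proof.
by move=> Hf Hg; have [d e] := is_deriveM Hf Hg; split; [exact: d|exact: e].
Qed.

(** * Monotonicity of the maximum and of the weighted mass *)

Section RadialMass.
Variables (R : realType) (a : R) (m : nat) (psi : R -> R) (C : R).
Variables (U V W Z G : R -> R -> R) (p : R -> R).
Hypothesis a01 : 0 < a < 1.
Hypothesis P : radial_profile a m psi C U V W Z G.
Hypothesis Udecr : forall r s t : R, 0 <= r -> r <= s -> 0 <= t -> U s t <= U r t.
Hypothesis psip : forall r, 0 <= r -> psi r <= p r.

Let a0 : 0 < a. Proof. by case/andP: a01. Qed.
Let C0 : 0 <= C := prof_C P.

Lemma profile_V_le0 (r t : R) : 0 <= r -> 0 <= t -> V r t <= 0.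
Proof.
move=> r0 t0; rewrite leNgt; apply/negP => Vp.
pose h := V r t / (2 * (C + 1)).
have Cp : 0 < C + 1 by rewrite ltr_wpDl.
have h0 : 0 < h by rewrite divr_gt0// mulr_gt0.
have rh : r <= r + h by rewrite lerDl ltW.
have := prof_dU P r0 rh t0; have := Udecr r0 rh t0.
rewrite (_ : r + h - r = h); last by ring.
rewrite ler_norml => H /andP[H1 _].
have hV : (C + 1) * h = V r t / 2 by rewrite /h; field; rewrite gt_eqF.
have := ler_wpM2l (ltW h0) (lexx ((C + 1) * h)); rewrite {2}hV.
have := mulr_gt0 h0 Vp; have := mulr_gt0 h0 h0.
move: H1; rewrite expr2; lra.
Qed.

Let W_le0 (t : R) : 0 <= t -> W 0 t <= 0.
Proof.
move=> t0; apply/ler_addgt0Pr => e e0; rewrite add0r.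
have [d d0 Hd] := small_power C e0 a0.
have := prof_holder P (lexx 0) (ltW d0) t0; rewrite subr0 => -[+ _ _].
have := Hd d (ltW d0) (lexx d).
have := profile_V_le0 (ltW d0) t0; rewrite (prof_V P (ltW d0) t0) pmulr_rle0// ler_norml.
move=> W0 H /andP[H1 _]; lra.
Qed.

(** At the origin the equation reads [G = (m + 1) W], and [W <= 0] as the limit of [V / r]. *)
Lemma profile_max_nonincreasing (s t : R) : 0 <= s -> s <= t -> U 0 t <= U 0 s.
Proof.
apply: (@superlinear_nonincreasing _ (U 0) C (a / 2)); first by rewrite divr_gt0.
move=> {}s {}t s0 st.
have := prof_dUt P (lexx 0) s0 st; rewrite ler_norml => /andP[_ H].
suff G0 : G 0 s <= 0.
  have : (t - s) * G 0 s <= 0 by rewrite mulr_ge0_le0// subr_ge0.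
  lra.
rewrite -(prof_eq P (lexx 0) s0) (prof_V P (lexx 0) s0) mul0r mulr0 subr0.
have := prof_ZW P (lexx 0) s0; rewrite powR0 ?gt_eqF// mulr0 normr_le0 subr_eq0 => /eqP ->.
have := W_le0 s0; have := mulr_ge0_le0 (ler0n R m) (W_le0 s0); lra.
Qed.

Variable Psi : R -> R.
Hypothesis dPsi : forall x : R, -2 < x -> is_derive x 1 Psi (p x).

(* Invariant density of the radial diffusion with drift [- p]: as [psi <= p] and
   [V <= 0], the weighted mass of [U] on an interval [[0, r]] cannot increase. *)
Let mw (r : R) := r ^+ m * expR (- Psi r).

Let mw_ge0 (r : R) : 0 <= r -> 0 <= mw r.
Proof. by move=> r0; rewrite mulr_ge0 ?expR_ge0// exprn_ge0. Qed.

Let dmw (r : R) : 0 < r ->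
  is_derive r 1 mw (mw r * (m%:R / r - p r)).
Proof.
move=> r0; have r2 : -2 < r by lra.
have H := dPsi r2.
have H1 : is_derive r 1 (fun x : R => expR (- Psi x)) (- p r * expR (- Psi r)).
  rewrite mulrC; exact: (@is_derive1_comp R expR (- Psi) r _ _ (is_derive_expR _) (is_deriveN H)).
have H2 : is_derive r 1 (fun x : R => x ^+ m) (m%:R * r ^+ m.-1).
  have := @is_deriveX R R^o id m r 1 1 (is_derive_id _ _).
  by rewrite exprfctE => -[dX eX]; split; [exact: dX|rewrite eX [LHS]mulr1].
rewrite (_ : mw r * _ = r ^+ m * (- p r * expR (- Psi r)) + expR (- Psi r) * (m%:R * r ^+ m.-1)).
  exact: is_derive_mul.
rewrite /mw.
have -> : m%:R * r ^+ m.-1 = r ^+ m * (m%:R / r) :> R.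
  by case: m => [|k] /=; rewrite ?mul0r ?mulr0// exprSr; field; rewrite gt_eqF.
by ring.
Qed.

Let cmw (r : R) : -2 < r -> {for r, continuous mw}.
Proof.
move=> r2; apply: (@continuousM _ _ (fun x : R => x ^+ m) (fun x => expR (- Psi x))).
  exact: exprn_continuous.
apply: (@continuous_comp _ _ _ (fun x => - Psi x) expR).
  by apply: continuousN; exact: is_derive_continuous_at (dPsi r2).
exact: continuous_expR.
Qed.

Let cU (t : R) : 0 <= t -> continuous (fun x : R => U `|x| t).
Proof.
move=> t0; apply: (@holder_continuous _ _ (4 * C) 1) => // x y xy; rewrite powRr1//.
have xy' := ler_dist_dist x y.
have [_ v _ _ _] := prof_bound P (normr_ge0 y) t0.
have := prof_U_expansion a01 P (normr_ge0 y) (normr_ge0 x) t0.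
have := ler_normD (U `|x| t - U `|y| t - (`|x| - `|y|) * V `|y| t) ((`|x| - `|y|) * V `|y| t).
rewrite subrK normrM -(real_normK (num_real (_ - _))) expr2.
move: (`| `|x| - `|y| |) xy' (normr_ge0 (`|x| - `|y|)) => d dxy d0 H1 H2.
have d2 : d * d <= d by rewrite ler_piMr// (le_trans dxy).
have := ler_wpM2l C0 d2; have := ler_wpM2l d0 v; have := ler_wpM2l C0 dxy; lra.
Qed.

Let cV (t : R) : 0 <= t -> continuous (fun x : R => V `|x| t).
Proof.
move=> t0; apply: (@holder_continuous _ _ (2 * C) 1) => // x y xy; rewrite powRr1//.
apply: le_trans (prof_V_lipschitz a01 P (normr_ge0 y) (normr_ge0 x) t0) _.
by rewrite ler_wpM2l ?mulr_ge0// ler_dist_dist.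
Qed.

Let dVb (r t : R) : 0 < r -> 0 <= t -> is_derive r 1 (fun x : R => V `|x| t) (Z r t).
Proof.
move=> r0 t0; have [|d e] := @derive_of_expansion R R^o (fun x : R => V `|x| t) r 1 (Z r t) (2 * C) a r a0 r0.
  move=> h hr; have rh : 0 <= h + r by move: hr; rewrite ler_norml; lra.
  have := prof_V_expansion P (ltW r0) rh t0.
  by rewrite addrK (gtr0_norm r0) [h *: _]mulr1 (ger0_norm rh).
by split.
Qed.

(** [N r] is the weight and [F t r] the mass of [U] on [[0, r]]. As [U] decreases in [r],
    [U r t * N r <= F t r <= F 0 r]; splitting the initial mass at [R0] bounds it by
    [C * N R0 + e / 2 * N r], and [N r] tends to infinity. *)
Lemma profile_decay : (exists2 R1 : R, 0 < R1 & forall r, R1 <= r -> Psi r <= m.+1%:R * ln r) ->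
  (forall e : R, 0 < e -> exists2 R0 : R, 0 <= R0 & forall r, R0 <= r -> U r 0 <= e) ->
  forall e : R, 0 < e -> exists2 r : R, 0 <= r & forall t, 0 <= t -> U r t <= e.
Proof.
move=> [R1 R10 growth] init e e0.
have m1 (x : R) : -1 <= x -> -2 < x by move=> ?; lra.
have m1' (x : R) : 0 <= x -> -1 < x by move=> ?; lra.
have m11 : -1 < 0 :> R by [].
have [N N0 dN] := antiderivative m11 (fun x x1 => cmw (m1 x x1)).
have : forall t : R, exists F : R -> R, 0 <= t -> F 0 = 0 /\
    forall x : R, -1 < x -> is_derive x 1 F (U `|x| t * mw x).
  move=> t; have [t0|t0] := leP 0 t; last by exists (fun=> 0).
  have cUm (x : R) : -1 <= x -> {for x, continuous (fun x => U `|x| t * mw x)}.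
    by move=> x1; apply: continuousM; [exact: cU|exact: cmw (m1 _ x1)].
  by have [F F0 dF] := antiderivative m11 cUm; exists F.
move=> /choice[F HF].
have F0 t : 0 <= t -> F t 0 = 0 by move=> /HF[].
have dF t (x : R) : 0 <= t -> -1 < x -> is_derive x 1 (F t) (U `|x| t * mw x).
  by move=> /HF[_ H] /H.
(* The combination has derivative [(c1 U + c2) mw], so pointwise bounds on [U] become bounds between
   mass and weight. *)
have compare (c1 c2 : R) t (x y : R) : 0 <= t -> 0 <= x -> x <= y ->
    (forall r, x <= r -> r <= y -> 0 <= c1 * U r t + c2) ->
    c1 * F t x + c2 * N x <= c1 * F t y + c2 * N y.
  move=> t0 x0 xy H.
  have dL (z : R) : 0 <= z -> is_derive z 1 (fun y => c1 * F t y + c2 * N y)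
      (c1 * (U `|z| t * mw z) + c2 * mw z).
    by move=> z0; apply: is_derive_lin; [exact: dF t0 (m1' _ z0)|exact: dN (m1' _ z0)].
  apply: (derive_ge0_le xy) (fun z xz => is_derive_continuous_at (dL z (le_trans x0 xz)))
      (fun z xz _ => dL z (le_trans x0 (ltW xz))) _ => z xz zy.
  have z0 : 0 <= z := le_trans x0 (ltW xz).
  by rewrite mulrA -mulrDl mulr_ge0 ?mw_ge0// (ger0_norm z0) H// ltW.
(* The mass changes at rate [mw V + \int (p - psi) V mw <= 0]. Instead of differentiating under the
   integral, [H] compares its increment with [(s - t) mw V] plus the expansion error [k N]: [H]
   vanishes at 0 and has nonnegative derivative. *)
have Fdecr t (r : R) : 0 <= t -> 0 <= r -> F t r <= F 0 r.
  move=> t0 r0; apply: (@superlinear_nonincreasing _ (fun t => F t r) (C * N r) (a / 2)) t0 => //.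
    by rewrite divr_gt0.
  move=> {}t s t0 ts; have s0 := le_trans t0 ts.
  have d0 : 0 <= s - t by rewrite subr_ge0.
  pose k := C * ((s - t) * (s - t) `^ (a / 2)).
  have k0 : 0 <= k by rewrite mulr_ge0// mulr_ge0 ?powR_ge0.
  pose H1 x := (s - t) * (mw x * V `|x| t) + k * N x.
  pose H2 x := F s x - F t x.
  pose H x := H1 x - H2 x.
  have cH (x : R) : 0 <= x -> {for x, continuous H}.
    move=> x0; have x1 := m1' _ x0.
    apply: (@continuousB _ _ _ H1 H2).
      apply: (@continuousD _ _ _ (fun x => (s - t) * (mw x * V `|x| t)) (fun x => k * N x)).
        apply: (@continuousM _ _ (fun=> s - t) (fun x => mw x * V `|x| t)); first exact: cvg_cst.
        by apply: continuousM; [exact: cmw (m1 _ (ltW x1))|exact: cV].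
      apply: (@continuousM _ _ (fun=> k) N); first exact: cvg_cst.
      exact: is_derive_continuous_at (dN x x1).
    by apply: continuousB; apply: is_derive_continuous_at; exact: dF x1.
  have dH (x : R) : 0 < x -> is_derive x 1 H
      ((s - t) * (mw x * Z x t + V `|x| t * (mw x * (m%:R / x - p x))) + k * mw x
       - (U `|x| s * mw x - U `|x| t * mw x)).
    move=> x0; have x1 := m1' _ (ltW x0).
    have A1 := is_derive_lin (s - t) k (is_derive_mul (dmw x0) (dVb x0 t0)) (dN x x1).
    exact: is_deriveB A1 (is_deriveB (dF s x s0 x1) (dF t x t0 x1)).
  have H0 : H 0 = 0.
    by rewrite /H /H1 /H2 N0 !F0// normr0 (prof_V P (lexx 0) t0) mul0r !mulr0 addr0 !subrr.
  have Hr : 0 <= H r.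
    rewrite -H0; apply: (derive_ge0_le r0 cH (fun z z0 _ => dH z z0)) => z z0 zr.
    have z0' := ltW z0; rewrite (gtr0_norm z0).
    have Vz : V z t * (m%:R / z) = m%:R * W z t.
      by rewrite (prof_V P z0' t0); field; rewrite gt_eqF.
    have := prof_dUt P z0' t0 ts; rewrite -/k ler_norml => /andP[_ dUt].
    have Vp : psi z * V z t >= p z * V z t.
      by rewrite ler_wnM2r ?psip// profile_V_le0.
    rewrite [X in 0 <= X](_ : _ = mw z * ((s - t) * (Z z t + V z t * (m%:R / z) - p z * V z t)
       + k - (U z s - U z t))); last by ring.
    rewrite mulr_ge0 ?mw_ge0// Vz; have GE := prof_eq P z0' t0.
    have : (s - t) * G z t <= (s - t) * (Z z t + m%:R * W z t - p z * V z t).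
      by rewrite ler_wpM2l// -GE; move: Vp; lra.
    move: dUt; lra.
  have : mw r * V `|r| t <= 0 by rewrite mulr_ge0_le0 ?mw_ge0// profile_V_le0.
  move=> /(ler_wpM2l d0); move: Hr; rewrite /H /H1 /H2 /k; lra.
have Nmono (x y : R) : 0 <= x -> x <= y -> N x <= N y.
  move=> x0 xy; have := @compare 0 1 0 x y (lexx 0) x0 xy.
  by rewrite !mul0r !add0r !mul1r; apply => r _ _; rewrite mul0r add0r.
have Nge0 (x : R) : 0 <= x -> 0 <= N x by move=> x0; rewrite -N0 Nmono.
(* From [Psi r <= (m + 1) ln r] the weight is at least [r^m r^(- (m + 1)) = 1 / r]. *)
have Nln (r : R) : R1 <= r -> ln r - ln R1 <= N r.
  move=> R1r; have := @derive_ge0_le _ (fun x => 1 * N x + (-1) * ln x) (fun x => 1 * mw x + (-1) * x^-1) R1 r R1r.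
  have dL (x : R) : R1 <= x -> is_derive x 1 (fun x => 1 * N x + (-1) * ln x) (1 * mw x + (-1) * x^-1).
    move=> xR; have x0 := lt_le_trans R10 xR.
    by apply: is_derive_lin; [exact: dN (m1' _ (ltW x0))|exact: is_derive1_ln].
  move=> /(_ (fun x xR => is_derive_continuous_at (dL x xR)) (fun x xR _ => dL x (ltW xR))).
  have mwx (z : R) : R1 < z -> z < r -> 0 <= 1 * mw z + -1 * z^-1.
    move=> zR _; have z0 := lt_trans R10 zR.
    rewrite mulN1r mul1r subr_ge0 /mw.
    have -> : z^-1 = z ^+ m * expR (- (m.+1%:R * ln z)).
      by rewrite expRN expRM_natl lnK ?posrE// exprS; field; rewrite ?expf_neq0 ?gt_eqF.
    by rewrite ler_wpM2l ?exprn_ge0 ?(ltW z0)// ler_expR lerN2 growth// ltW.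
  have NR1 := Nge0 _ (ltW R10).
  by move=> /(_ mwx); lra.
have e2 : 0 < e / 2 by rewrite divr_gt0.
have [R0 R00 HR0] := init (e / 2) e2.
(* Once [N r >= X], the mass [C * N R0] is at most [e / 2 * N r]; the added 1 keeps [N r]
   positive. *)
pose X := C * N R0 / (e / 2) + 1.
pose r := Num.max R0 (R1 * expR X).
have r0 : 0 <= r by rewrite le_max R00.
have rR0 : R0 <= r by rewrite le_max lexx.
have X0 : 0 <= X by rewrite addr_ge0// mulr_ge0 ?invr_ge0 ?(ltW e2)// mulr_ge0// Nge0.
have rR1 : R1 * expR X <= r by rewrite le_max lexx orbT.
have NX : X <= N r.
  have ex1 : 1 <= expR X by rewrite -expR0 ler_expR.
  have R1e : R1 <= R1 * expR X by rewrite ler_peMr// ltW.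
  have Re0 : 0 <= R1 * expR X by rewrite mulr_ge0 ?expR_ge0// ltW.
  apply: le_trans (Nmono _ _ Re0 rR1); have := Nln _ R1e.
  by rewrite lnM ?posrE ?expR_gt0// expRK addrAC subrr add0r.
exists r => // t t0.
have H1 : U r t * N r <= F t r.
  have := compare 1 (- U r t) t 0 r t0 (lexx 0) r0.
  rewrite N0 F0// !mulr0 addr0 mul1r mulNr subr_ge0; apply => s s0 sr.
  by rewrite mul1r subr_ge0 Udecr.
have H2 : F 0 R0 <= C * N R0.
  have := compare (- 1) C 0 0 R0 (lexx 0) (lexx 0) R00.
  rewrite N0 F0// !mulr0 addr0 mulN1r addrC subr_ge0; apply => s s0 sr.
  have [+ _ _ _ _] := prof_bound P s0 (lexx 0); rewrite ler_norml => /andP[_]; lra.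
have H3 : F 0 r - F 0 R0 <= e / 2 * (N r - N R0).
  have := compare (- 1) (e / 2) 0 R0 r (lexx 0) R00 rR0.
  have Hs s : R0 <= s -> s <= r -> 0 <= -1 * U s 0 + e / 2.
    by move=> s0 sr; have := HR0 s s0; lra.
  by move=> /(_ Hs); lra.
have H4 := Fdecr t r t0 r0.
have Xe : X * (e / 2) = C * N R0 + e / 2 by rewrite /X mulrDl mul1r divfK// gt_eqF.
have Np : 0 < N r.
  by apply: lt_le_trans NX; rewrite /X ltr_wpDl// mulr_ge0 ?invr_ge0 ?(ltW e2)// mulr_ge0// Nge0.
rewrite -(ler_pM2r Np).
have := mulr_ge0 (ltW e2) (Nge0 _ R00).
have := ler_wpM2r (ltW e2) NX; rewrite Xe; lra.
Qed.

End RadialMass.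

(** * Positivity and decay of the radial solution *)

Section RadialSolution.
Variables (R : realType) (a B : R) (m : nat) (psi : R -> R) (C : R).
Variables (U V W Z G : R -> R -> R) (b : 'rV[R]_m.+1 -> 'rV[R]_m.+1).
Hypothesis a01 : 0 < a < 1.
Hypothesis P : radial_profile a m psi C U V W Z G.
Hypothesis bE : forall x, x != 0 -> b x = - (psi (enorm x) *: ((enorm x)^-1 *: x)).
Hypothesis bB : forall x, enorm (b x) <= B.
Hypothesis Udecr : forall r s t : R, 0 <= r -> r <= s -> 0 <= t -> U s t <= U r t.
Hypothesis U_ge0 : forall r t : R, 0 <= r -> 0 <= t -> 0 <= U r t.

Let a0 : 0 < a. Proof. by case/andP: a01. Qed.

Let affine (k0 k1 : R) : exists D, forall t0, 0 <= t0 ->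
  exists P Q q, expandable a b D (fun x t => k0 + k1 * U (enorm x) (t0 + t)) P Q q.
Proof.
have [D HD] := expandable_affine k0 k1 a0 (radial_lift_parabolic a01 P)
   (fun x t t0 => radial_lift_equation a01 P x bE t0).
by exists D => t0 t00; do 3 eexists; exact: HD t0 t00.
Qed.

Lemma radial_solution_gt0 : 0 < U 0 0 -> forall r t : R, 0 <= r -> 0 < t -> 0 < U r t.
Proof.
move=> U00 r t r0 t0; have C0 := prof_C P.
have Cp : 0 < C + 1 by rewrite ltr_wpDl.
(* As [U_r] vanishes at the origin, [U r 0 >= U 0 0 - C r^2], which is at least half of [U 0 0] for
   [r^2 <= rho]. *)
pose rho := U 0 0 / (2 * (C + 1)).
have rho0 : 0 < rho by rewrite divr_gt0// mulr_gt0.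
have eps0 : 0 < U 0 0 / 2 by rewrite divr_gt0.
(* With this speed the front passes radius [r] by time [t]. *)
have c0 : 0 <= r ^+ 2 / t by rewrite divr_ge0 ?sqr_ge0// ltW.
have [k k0 Hk] := spreading_gap a0 bB rho0 c0 t0 eps0.
have [D /(_ 0 (lexx 0))[P1 [Q [q HD]]]] := affine 0 1.
have := Hk _ _ _ _ _ 0 HD _ _ (r *: delta_mx 0 ord0).
rewrite !add0r mul1r subr0 enormZ enorm_delta mulr1 (ger0_norm r0) divfK ?gt_eqF//.
move=> H; apply: lt_le_trans k0 _; apply: H => //.
- by move=> x s s0 _; rewrite !add0r mul1r U_ge0 ?enorm_ge0.
- move=> x; rewrite subr0 !add0r mul1r => xr.
  have := prof_dU P (lexx 0) (enorm_ge0 x) (lexx 0).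
  rewrite (prof_V P (lexx 0) (lexx 0)) mul0r mulr0 !subr0 ler_norml => /andP[H1 _].
  have := ler_wpM2l C0 xr.
  have : (C + 1) * rho = U 0 0 / 2 by rewrite /rho; field; rewrite gt_eqF.
  lra.
Qed.

Hypothesis decay : forall e : R, 0 < e -> exists2 r : R, 0 <= r & forall t, 0 <= t -> U r t <= e.

(** Spreading is applied to [U 0 t - u] on the time interval [[t, t + 1]], where it is nonnegative
    because the maximum does not increase. *)
Let drop (l : R) : 0 < l -> exists2 k : R, 0 < k &
  forall t, 0 <= t -> l <= U 0 t -> U 0 (t + 1) <= U 0 t - k.
Proof.
move=> l0; have l2 : 0 < l / 2 by rewrite divr_gt0.
have [r r0 Hr] := decay l2.
have c0 : 0 <= (r + 1) ^+ 2 by exact: sqr_ge0.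
have [k k0 Hk] := spreading_gap a0 bB ltr01 c0 ltr01 l2.
exists k => // t t0 lU.
have [D /(_ t t0)[P1 [Q [q HD]]]] := affine (U 0 t) (-1).
(* The unit ball around [x0] lies outside radius [r], where [U <= l / 2]; the speed [(r + 1)^2]
   brings the front from there to the origin in unit time. *)
pose x0 : 'rV[R]_m.+1 := (r + 1) *: delta_mx 0 ord0.
have := Hk _ _ _ _ _ x0 HD _ _ 0.
have r1 : 0 <= r + 1 by rewrite addr_ge0.
have x0r : enorm x0 = r + 1 by rewrite enormZ enorm_delta mulr1 ger0_norm.
rewrite sub0r enormN x0r mulr1 enorm0 => H.
suff : k <= U 0 t + -1 * U 0 (t + 1) by lra.
apply: H => //.
- move=> x s s0 _; have ts : t <= t + s by rewrite lerDl.
  have := profile_max_nonincreasing a01 P Udecr t0 ts.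
  have := Udecr (lexx 0) (enorm_ge0 x) (le_trans t0 ts); lra.
- move=> x xx0; rewrite addr0.
  have xx1 : enorm (x - x0) <= 1.
    by rewrite -(@ler_pXn2r _ 2)// ?nnegrE ?enorm_ge0// expr1n.
  have rx : r <= enorm x.
    by have := enormD_le (x0 - x) x; rewrite subrK x0r -opprB enormN; lra.
  have := Hr t t0; have := Udecr r0 rx t0; lra.
Qed.

Lemma profile_max_cvg0 : U 0 t @[t --> +oo] --> (0 : R).
Proof.
have mono := profile_max_nonincreasing a01 P Udecr.
apply/cvgrPdist_le => e e0.
have [T T0 UT] : exists2 T : R, 0 <= T & U 0 T <= e.
  have [k k0 Hk] := drop e0.
  apply: contrapT => noT.
  have big t : 0 <= t -> e <= U 0 t.
    by move=> t0; rewrite leNgt; apply/negP => /ltW Ue; apply: noT; exists t.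
  have I (i : nat) : U 0 i%:R <= U 0 0 - i%:R * k.
    elim: i => [|i IH]; first by rewrite mul0r subr0.
    have := Hk i%:R (ler0n _ _) (big _ (ler0n _ _)).
    rewrite natr1; move: IH; rewrite -natr1; lra.
  have [N HN] : exists N : nat, U 0 0 / k < N%:R.
    exists (Num.truncn (U 0 0 / k)).+1; exact: truncnS_gt.
  have := I N; have := U_ge0 (lexx 0) (ler0n R N).
  by move: HN; rewrite ltr_pdivrMr//; lra.
near=> t.
have Tt : T <= t by near: t; apply: nbhs_pinfty_ge; rewrite num_real.
rewrite sub0r normrN (ger0_norm (U_ge0 (lexx 0) (le_trans T0 Tt))).
exact: le_trans (mono _ _ T0 Tt) UT.
Unshelve. all: by end_near. Qed.

Lemma sup_range_radial (t : R) : 0 <= t ->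
  sup (range (fun x : 'rV[R]_m.+1 => U (enorm x) t)) = U 0 t.
Proof.
move=> t0; apply/le_anti/andP; split.
  apply: ge_sup; first by exists (U (enorm (0 : 'rV[R]_m.+1)) t), 0.
  by move=> _ [x _ <-]; exact: Udecr (lexx 0) (enorm_ge0 x) t0.
apply: ub_le_sup; last by exists 0 => //; rewrite enorm0.
by exists (U 0 t) => _ [x _ <-]; exact: Udecr (lexx 0) (enorm_ge0 x) t0.
Qed.

End RadialSolution.

(** * The initial datum and the drift *)

Lemma lebesgue_tuple_setT (R : realType) (n : nat) :
  @lebesgue_tuple R n.+1 setT = +oo%E.
Proof.
have lT : @lebesgue_measure R setT = +oo%E by rewrite -set_itvNyy lebesgue_measure_itv.
have H k : @lebesgue_tuple R k.+1 setT = (+oo * @lebesgue_tuple R k setT)%E.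
  rewrite /= /pushforward preimage_setT -setXTT product_measure1E//.
  by congr (_ * _)%E; exact: lT.
elim: n => [|n IH]; first by rewrite H /= diracE in_setT mule1.
by rewrite H IH mulyy.
Qed.

Lemma L1_not_bounded_below (R : realType) (n : nat) (f : 'rV[R]_n.+1 -> R) (e : R) :
  L1 f -> 0 < e -> ~ (forall x, e <= f x).
Proof.
move=> /integrableP[mf fin] e0 H.
have fE t : `|(f (\row_i tnth t i))%:E|%E = (f (\row_i tnth t i))%:E.
  by rewrite gee0_abs// lee_fin (le_trans (ltW e0)).
move: fin; under eq_integral do rewrite fE; move=> fin.
have : (\int[@lebesgue_tuple R n.+1]_(t in setT) (cst e%:E) t <=
  \int[@lebesgue_tuple R n.+1]_(t in setT) (f (\row_i tnth t i))%:E)%E.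
  apply: ge0_le_integral => //.
  - by move=> t _; rewrite lee_fin ltW.
  - by move=> t _; rewrite lee_fin.
rewrite integral_cst// [X in (_ * X)%E](lebesgue_tuple_setT R n) gt0_muley ?lte_fin//.
by rewrite leye_eq => /eqP fy; move: fin; rewrite fy.
Qed.

(** A limsup below [n] yields a neighbourhood of infinity on which the quotient is below [n]; the
    integral in it is [Psi r] by the fundamental theorem of calculus. *)
Lemma log_mean_growth (R : realType) (n : nat) (psi p Psi : R -> R) :
  (log_mean_limsup psi < n%:R%:E)%E ->
  continuous p -> (forall r, 0 < r -> p r = Num.max (psi r) 0) ->
  Psi 0 = 0 -> (forall x : R, -2 < x -> is_derive x 1 Psi (p x)) ->
  exists2 R1 : R, 0 < R1 & forall r, R1 <= r -> Psi r <= n%:R * ln r.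
Proof.
move=> /ereal_inf_lt[_ [A [M [_ AM]] <-] supA] cp pE Psi0 dPsi.
exists (Num.max M 1 + 1); first by rewrite ltr_pwDr// le_max ler01 orbT.
move=> r rM; have [Mr r1] : M < r /\ 1 < r.
  by move: (le_max M M 1) (le_max 1 M 1); rewrite !lexx orbT /=; lra.
have r0 : 0 < r by rewrite (lt_trans ltr01).
have := le_lt_trans (ereal_sup_ubound (imageP _ (AM r Mr))) supA.
set I := (\int[_]_(rho in _) _)%E.
have pcc : {within `[0, r], continuous p} by exact: continuous_subspaceT.
have pm : measurable_fun `]0, r] (EFin \o p).
  apply/measurable_EFinP; apply: measurable_funTS.
  exact: continuous_measurable_fun.
have pmax x : `]0, r]%classic x -> (Num.max (psi x) 0)%:E = (p x)%:E.
  by rewrite /= in_itv/= => /andP[x0 _]; rewrite pE.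
have -> : I = (Psi r)%:E.
  (* [p] and the positive part of [psi] agree only for positive radii, so the endpoint 0, a null
     set, is removed before the integrands are exchanged. *)
  rewrite /I -integral_itv_obnd_cbnd; last first.
    apply: eq_measurable_fun pm => x; rewrite inE => /pmax E.
    by rewrite /= -E.
  transitivity (\int[@lebesgue_measure R]_(x in `]0%R, r]) (p x)%:E)%E.
    by apply: eq_integral => x; rewrite inE => /pmax.
  rewrite integral_itv_obnd_cbnd//.
  have dP : derivable_oo_LRcontinuous Psi 0 r.
    have dr (x : R) : -2 < x -> derivable Psi x 1 by move=> /dPsi[].
    have cr (x : R) : -2 < x -> {for x, continuous Psi}.
      by move=> /dPsi; exact: is_derive_continuous_at.
    split; first by move=> x; rewrite in_itv/= => /andP[x0 _]; apply: dr; lra.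
      by apply: cvg_at_right_filter; apply: cr; lra.
    by apply: cvg_at_left_filter; apply: cr; lra.
  rewrite (continuous_FTC2 r0 pcc dP) ?Psi0 ?sube0// => x.
  rewrite in_itv/= => /andP[x0 _]; have x2 : -2 < x by lra.
  by have [_] := dPsi x x2; rewrite derive1E.
have l0 : 0 < ln r by rewrite ln_gt0.
by rewrite -EFinM lte_fin mulrC ltr_pdivrMr// => /ltW.
Qed.

Lemma rotationally_symmetricE (R : realType) (m : nat) (f : 'rV[R]_m.+1 -> R) x :
  rotationally_symmetric f -> f x = f (enorm x *: delta_mx 0 ord0).
Proof.
move=> rot; have xE : enorm x = enorm (enorm x *: delta_mx 0 ord0 : 'rV[R]_m.+1).
  by rewrite enormZ enorm_delta mulr1 ger0_norm// enorm_ge0.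
by have [Q QQ <-] := orthogonal_transitive xE; rewrite rot.
Qed.

(** Restriction to a coordinate line gives the scheme its one-dimensional data; the factor 2 in the
    last constant collects the Taylor remainders at [r + h] and [r - h]. *)
Lemma ray_regularity (R : realType) (n : nat) (a : R) (i : 'I_n) (f : 'rV[R]_n -> R) :
  0 < a -> C_2alpha a f ->
  let U0 r := f (r *: delta_mx 0 i) in
  let U2 r := partial i (partial i f) (r *: delta_mx 0 i) in
  exists M0 L0 M2 K2,
  [/\ forall r : R, `|U0 r| <= M0,
      forall r s : R, `|U0 r - U0 s| <= L0 * `|r - s|,
      forall r : R, `|U2 r| <= M2,
      forall r s : R, `|U2 r - U2 s| <= K2 * `|r - s| `^ a &
      forall r h : R, 0 < h ->
        `|U0 (r + h) - 2 * U0 r + U0 (r - h) - h ^+ 2 * U2 r| <= K2 * h ^+ 2 * h `^ a].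
Proof.
move=> a0 [[df ddf] [M0 HM0] b1 b2 h2] U0 U2.
have [L HL] := b1 i; have [M2 HM2] := b2 i i; have [K HK] := h2 i i.
pose U1 r := partial i f (r *: delta_mx 0 i).
have d1 (x : R) : is_derive x 1 U0 (U1 x).
  have := @is_derive_line _ _ f (delta_mx 0 i) 0 x; rewrite addr0 => /(_ (df _ _)).
  by under eq_fun do rewrite addr0.
have d2 (x : R) : is_derive x 1 U1 (U2 x).
  have := @is_derive_line _ _ (partial i f) (delta_mx 0 i) 0 x; rewrite addr0 => /(_ (ddf _ _ _)).
  by under eq_fun do rewrite addr0.
have shift (r : R) (g g' : R -> R) : (forall x : R, is_derive x 1 g (g' x)) ->
    forall x : R, is_derive x 1 (fun s => g (r + s)) (g' (r + x)).
  move=> dg x; have H : is_derive x 1 (fun s : R => r + s) (0 + 1) by exact: is_deriveD.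
  have [d e] := @is_derive1_comp _ g (fun s : R => r + s) x _ _ (dg (r + x)) H.
  by split; [exact: d|apply: (etrans e); rewrite add0r mulr1].
have K0 : K <= `|K| := ler_norm K.
have HK' r s : `|U2 r - U2 s| <= `|K| * `|r - s| `^ a.
  apply: (le_trans (HK _ _)); rewrite -scalerBl enormZ enorm_delta mulr1.
  by rewrite ler_wpM2r// powR_ge0.
exists M0, L, M2, (2 * `|K|); split.
- by move=> r; exact: HM0.
- move=> r s; have := @mean_value_bound _ _ _ L (r - s) (shift s _ _ d1).
  by rewrite subrKC addr0; apply => x _; exact: HL.
- by move=> r; exact: HM2.
- move=> r s; apply: le_trans (HK' r s) _; rewrite ler_wpM2r ?powR_ge0//.
  have := normr_ge0 K; lra.
- move=> r h h0.
  have E (s : R) : `|s| = h ->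
      `|U0 (r + s) - U0 r - s * U1 r - s ^+ 2 / 2 * U2 r| <= `|K| * (s ^+ 2 * h `^ a).
    move=> sh; have := @second_order_expansion _ _ _ _ a `|K| s a0 (shift r _ _ d1) (shift r _ _ d2).
    rewrite addr0 sh; apply => x; apply: le_trans (HK' _ _) _.
    by rewrite addrAC subrr add0r.
  have := ler_normD (U0 (r + h) - U0 r - h * U1 r - h ^+ 2 / 2 * U2 r)
    (U0 (r - h) - U0 r - (- h) * U1 r - (- h) ^+ 2 / 2 * U2 r).
  have := E h (gtr0_norm h0); have := E (- h); rewrite normrN => /(_ (gtr0_norm h0)).
  rewrite sqrrN.
  rewrite (_ : U0 (r + h) - U0 r - h * U1 r - h ^+ 2 / 2 * U2 r + _ =
    U0 (r + h) - 2 * U0 r + U0 (r - h) - h ^+ 2 * U2 r); last by field.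
  lra.
Qed.

(** Once [f <= e] at one point, it stays so at all larger radii; and [f > e] everywhere would
    contradict integrability over a space of infinite measure. *)
Lemma radial_vanishing (R : realType) (m : nat) (f : 'rV[R]_m.+1 -> R) :
  L1 f -> rotationally_symmetric f -> radially_decreasing f ->
  forall e : R, 0 < e -> exists2 r0 : R, 0 <= r0 &
    forall r, r0 <= r -> f (r *: delta_mx 0 ord0) <= e.
Proof.
move=> fL rot dec e e0; apply: contrapT => H; apply: (L1_not_bounded_below fL e0) => x.
rewrite (rotationally_symmetricE x rot) leNgt; apply/negP => fx; apply: H.
exists (enorm x); first exact: enorm_ge0.
by move=> r xr; apply: le_trans (dec _ _ _ (enorm_ge0 x) xr) (ltW fx).
Qed.

(** * The drift as a scalar function of the radius *)

Section RadialField.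
Variables (R : realType) (m : nat) (a : R) (psi : R -> R) (b : 'rV[R]_m.+1 -> 'rV[R]_m.+1).
Hypothesis bE : forall x, x != 0 -> b x = - (psi (enorm x) *: ((enorm x)^-1 *: x)).
Hypothesis ba : C_alpha_field a b.

(* [psi 0] is unconstrained; this is the continuous representative. *)
Definition radial_component (r : R) : R := - b (r *: delta_mx 0 ord0) 0 ord0.

Lemma radial_componentE r : 0 < r -> radial_component r = psi r.
Proof.
move=> r0; have rE : enorm (r *: delta_mx 0 ord0 : 'rV[R]_m.+1) = r.
  by rewrite enormZ enorm_delta mulr1 gtr0_norm.
have rn0 : r *: delta_mx 0 ord0 != 0 :> 'rV[R]_m.+1.
  by apply/eqP => rd; move: rE; rewrite rd enorm0 => r00; rewrite -r00 ltxx in r0.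
by rewrite /radial_component bE// rE !mxE !eqxx opprK mulr1 mulVf ?gt_eqF// mulr1.
Qed.

Lemma radial_field_equation x : x != 0 ->
  b x = - (radial_component (enorm x) *: ((enorm x)^-1 *: x)).
Proof.
move=> x0; rewrite bE// radial_componentE// lt_neqAle enorm_ge0 andbT eq_sym.
by apply: contra x0 => /eqP/enorm0_eq0 ->.
Qed.

Lemma radial_component_regular : exists B K : R,
  [/\ 1 <= B, 0 <= K, forall x, enorm (b x) <= B, forall r, `|radial_component r| <= B &
      forall r s, `|radial_component r - radial_component s| <= K * `|r - s| `^ a].
Proof.
have [[B HB] [K HK]] := ba.
have bB x : enorm (b x) <= Num.max 1 B.
  by rewrite le_max; have := HB x; rewrite (ger0_norm (enorm_ge0 _)) => ->; rewrite orbT.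
exists (Num.max 1 B), `|K|; split => //; first by rewrite le_max lexx.
  by move=> r; rewrite normrN; apply: le_trans (coord_le_enorm _ _) (bB _).
move=> r s; rewrite /radial_component opprK addrC.
pose d := b (s *: delta_mx 0 ord0) - b (r *: delta_mx 0 ord0).
have := coord_le_enorm d ord0; rewrite {1}/d !mxE => H; apply: le_trans H _.
apply: le_trans (HK _ _) _; rewrite -scalerBl enormZ enorm_delta mulr1 distrC.
by rewrite ler_wpM2r ?powR_ge0// ler_norm.
Qed.

End RadialField.

Lemma max0_dist (R : realType) (x y : R) : `|Num.max x 0 - Num.max y 0| <= `|x - y|.
Proof.
wlog xy : x y / y <= x.
  by move=> H; have [/H//|/ltW/H] := leP y x; rewrite distrC (distrC y).
rewrite (ger0_norm (_ : 0 <= x - y)) ?subr_ge0// ler_norml.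
case: (leP x 0) => x0; case: (leP y 0) => y0; lra.
Qed.

(** * Existence, uniqueness, symmetry and decay put together *)

Theorem theorem3p1 (R : realType) (n : nat) (alpha : R) (psi : R -> R)
    (b : 'rV[R]_n -> 'rV[R]_n) (u0 : 'rV[R]_n -> R) :
  (1 <= n)%N ->
  0 < alpha -> alpha < 1 ->
  (forall x, x != 0 -> b x = - (psi (enorm x) *: ((enorm x)^-1 *: x))) ->
  C_alpha_field alpha b ->
  (log_mean_limsup psi < n%:R%:E)%E ->
  C_2alpha alpha u0 ->
  L1 u0 ->
  (forall x, 0 <= u0 x) ->
  (exists x, u0 x != 0) ->
  rotationally_symmetric u0 ->
  radially_decreasing u0 ->
  exists u : 'rV[R]_n -> R -> R,
    [/\ positive_solution alpha b u0 u,
        forall v, positive_solution alpha b u0 v ->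
          forall x t, 0 <= t -> v x t = u x t,
        forall t, 0 <= t -> rotationally_symmetric (u^~ t) &
        sup (range (u^~ t)) @[t --> +oo] --> (0 : R)].
Proof.
case: n b u0 => // m b u0 _ a0 a1 bE ba logmean u0C u0L u00 [x0 u0x0] u0rot u0dec.
have a01 : 0 < alpha < 1 by rewrite a0.
have [B [K [B1 K0 bB psiB psiK]]] := radial_component_regular ba.
have bE' := radial_field_equation bE.
pose psi' := radial_component b.
have [M0 [L0 [M2 [K2 [U0M U0L U2M U2K U02]]]]] := ray_regularity ord0 a0 u0C.
have u0E x : u0 x = u0 (enorm x *: delta_mx 0 ord0) := rotationally_symmetricE x u0rot.
pose U0 r := u0 (r *: delta_mx 0 ord0).
have U0even r : U0 (- r) = U0 r.
  by rewrite /U0 u0E [RHS]u0E !enormZ normrN.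
have [C [U [V [W [Z [G [P Uinit Upos Udecr]]]]]]] := @radial_profile_exists R alpha m psi' U0
  _ B K M0 L0 M2 K2 a01 B1
  (fun r _ => psiB r) (fun r s _ _ => psiK r s) U0M U0even U0L U2M U2K U02.
have {}Upos := Upos (fun r _ => u00 _).
have {}Udecr := Udecr (fun r s => u0dec _ r s).
have u_init (x : 'rV[R]_m.+1) : U (enorm x) 0 = u0 x.
  by rewrite Uinit ?enorm_ge0// /U0 -u0E.
(* A radially decreasing symmetric datum is largest at the origin, so it is positive there. *)
have U00 : 0 < U 0 0.
  rewrite Uinit// /U0; apply: lt_le_trans (_ : u0 x0 <= _).
    by rewrite lt_neqAle eq_sym u0x0 u00.
  by rewrite (u0E x0); apply: u0dec => //; exact: enorm_ge0.
have uC := radial_lift_parabolic a01 P.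
have uE x t t0 := @radial_lift_equation _ _ _ _ _ _ _ _ _ _ a01 P b x t bE' t0.
exists (fun x t => U (enorm x) t); split.
- split => //.
  by move=> x t t0; exact: radial_solution_gt0 a01 P bE' bB Upos U00 _ _ (enorm_ge0 x) t0.
- move=> v [vC vE v0 _] x t t0; apply/le_anti/andP; split.
    by apply: (parabolic_solution_le a0 bB vC uC vE uE) t0 => y; rewrite v0 u_init.
  by apply: (parabolic_solution_le a0 bB uC vC uE vE) t0 => y; rewrite v0 u_init.
- by move=> t _ Q QQ x; rewrite enorm_orthogonal.
(* The even extension is continuous on the whole line, so [Psi] is differentiable on both sides of
   0. *)
pose p (r : R) := Num.max (psi' `|r|) 0.
have cp : continuous p.
  apply: (@holder_continuous _ _ K alpha a0) => x y _.
  apply: le_trans (max0_dist _ _) _; apply: le_trans (psiK _ _) _.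
  by rewrite ler_wpM2l// ge0_ler_powR ?nnegrE ?(ltW a0)// ler_dist_dist.
have m20 : -2 < 0 :> R by rewrite oppr_lt0.
have [Psi Psi0 dPsi] := antiderivative m20 (fun x _ => cp x).
have growth := log_mean_growth logmean cp _ Psi0 dPsi.
have {}growth : exists2 R1 : R, 0 < R1 & forall r, R1 <= r -> Psi r <= m.+1%:R * ln r.
  apply: growth => r r0; rewrite /p (gtr0_norm r0) /psi'.
  by rewrite (radial_componentE bE).
have init (e : R) : 0 < e -> exists2 r0 : R, 0 <= r0 & forall r, r0 <= r -> U r 0 <= e.
  move=> e0; have [r0 r00 Hr0] := radial_vanishing u0L u0rot u0dec e0.
  by exists r0 => // r rr; rewrite Uinit ?(le_trans r00)//; exact: Hr0.
have psip (r : R) : 0 <= r -> psi' r <= p r.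
  by move=> r0; rewrite /p (ger0_norm r0) le_max lexx.
have decay := profile_decay a01 P Udecr psip dPsi growth init.
have cvg := profile_max_cvg0 a01 P bE' bB Udecr Upos decay.
apply: cvg_trans cvg; apply: near_eq_cvg; near=> t.
rewrite sup_range_radial//; near: t; apply: nbhs_pinfty_ge; exact: num_real.
Unshelve. all: by end_near. Qed.
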